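(* Let $K$ be any field. For the Poisson superalgebra $\mathbf P=\mathrm{Poisson}(V_0,V_1,V_2)$ and the associative algebra $\mathbf A=\mathrm{Alg}(v_0,v_1,v_2)$ one has $$\mathrm{GKdim}\,\mathbf P=\underline{\mathrm{GKdim}}\,\mathbf P=\mathrm{GKdim}\,\mathbf A=\underline{\mathrm{GKdim}}\,\mathbf A=2\log_\lambda2\approx3.3036,$$ where $\lambda\approx1.5214$ is the real root of $t^3-t-2$.
   Context: $\mathbf A$: let $\Lambda$ be the Grassmann algebra over $K$ on odd $x_0,x_1,\dots$, $x_i$ acting by left multiplication, $\partial_i$ the superderivation with $\partial_i(x_j)=\delta_{ij}$, $v_i=\sum_{k\ge0}\big(\prod_{n=0}^{k-1}x_{i+3n}x_{i+3n+1}\big)\partial_{i+3k}$; $\mathbf A$ is the associative subalgebra of $\operatorname{End}\Lambda$ generated by $v_0,v_1,v_2$. $\mathbf P$: let $H_\infty=\Lambda(x_i,y_i\mid i\ge0)$ (odd generators) with Poisson bracket determined by $\{y_i,x_j\}=\delta_{ij}$, $\{x_i,x_j\}=\{y_i,y_j\}=0$ and the super Leibniz rule; let $\widetilde H$ be its completion by formal sums $c\cdot1+\sum\lambda_{\alpha,\beta}x^\alpha y^\beta$ over monomials with $\beta\ne0$ and (largest index in $\alpha$) $<$ (largest index in $\beta$), to which product and bracket extend. $V_i=\sum_{k\ge0}\big(\prod_{n=0}^{k-1}x_{i+3n}x_{i+3n+1}\big)y_{i+3k}$, and $\mathbf P$ is the smallest unital subalgebra of $\widetilde H$ containing $V_0,V_1,V_2$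 closed under product and bracket, and, if $\operatorname{char}K=2$, under the formal square of odd elements (determined by $m^{[2]}=0$ for odd monomials $m$ in $x_i,y_i$ and $(f+g)^{[2]}=f^{[2]}+\{f,g\}+g^{[2]}$). Growth functions count the dimension of the span of all monomials (products, brackets, and in characteristic $2$ formal squares) in the given generators with total number of generator occurrences at most $n$; $\mathrm{GKdim}=\limsup\ln\gamma(n)/\ln n$, $\underline{\mathrm{GKdim}}=\liminf\ln\gamma(n)/\ln n$. *)

(* Defs.v *)
From Stdlib Require Import Reals.
From Coquelicot Require Import Coquelicot.
From HB Require Import structures.
From mathcomp Require Import all_boot all_order all_algebra.
From mathcomp Require Import finmap.

Set Implicit Arguments.
Unset Strict Implicit.
Unset Printing Implicit Defensive.

Section RealPart.
Local Open Scope R_scope.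

Definition gk_ratio (g : nat -> nat) : nat -> R :=
  fun n => ln (INR (g n)) / ln (INR n).

Definition GKdim_is (g : nat -> nat) (d : R) : Prop :=
  LimSup_seq (gk_ratio g) = Rbar.Finite d.
Definition lowerGKdim_is (g : nat -> nat) (d : R) : Prop :=
  LimInf_seq (gk_ratio g) = Rbar.Finite d.

Definition cubic_root (lam : R) : Prop := lam * lam * lam - lam - 2 = 0.

Definition two_log2 (lam : R) : R := 2 * (ln 2 / ln lam).
End RealPart.

Import GRing.Theory.
Local Open Scope ring_scope.
Local Open Scope fset_scope.

(* Monomials of a Grassmann algebra on odd generators indexed by nat:
   a finite set T of generator indices, standing for the product of the
   generators in T in increasing order of index.                          *)
Notation mono := {fset nat}.

Section Grassmann.
Variable K : fieldType.

(* (formal, possibly infinite) linear combinations of monomials *)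
Definition ser := mono -> K.

Definition sgn (b : nat) : K := (-1) ^+ b.

(* number of inversions when concatenating the increasing words A and B *)
Definition ninv (A B : mono) : nat :=
  (\sum_(a <- A) count (fun b => b < a) B)%N.

Definition gmul (f g : ser) : ser := fun T =>
  \sum_(A <- fpowerset T) sgn (ninv A (T `\` A)) * f A * g (T `\` A).

Definition below (T : mono) (j : nat) : nat := count (fun t => (t < j)%N) T.

(* left superderivation d/d(gen j): d_j (gen_j) = 1, d_j (other gen) = 0 *)
Definition gder (j : nat) (f : ser) : ser := fun T =>
  if j \in T then 0 else sgn (below T j) * f (j |` T).

Definition mon (M : mono) : ser := fun T => (T == M)%:R.

(* a bound on the indices that can contribute to the coefficient at T *)
Definition bnd (T : mono) : nat := ((\max_(t <- T) t).+2)%N.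

(* finitely supported series = elements of the Grassmann algebra *)
Definition finsupp (f : ser) : Prop :=
  exists s : seq mono, forall T, f T != 0 -> T \in s.

(* Lambda = Grassmann algebra on x_0, x_1, ... : generator x_j has index j. *)

(* prod_{n<k} x_{i+3n} x_{i+3n+1} (already in increasing order) *)
Definition Mk (i k : nat) : mono :=
  [fset (i + 3 * n)%N | n in iota 0 k] `|` [fset (i + 3 * n).+1 | n in iota 0 k].

(* v_i = sum_k (prod_{n<k} x_{i+3n} x_{i+3n+1}) d_{i+3k}; for each
   coefficient only the terms k < bnd T can contribute, so the truncated
   sum is exactly the infinite sum. *)
Definition vop (i : nat) (f : ser) : ser := fun T =>
  \sum_(k < bnd T) gmul (mon (Mk i k)) (gder (i + 3 * k) f) T.

Inductive amon : nat -> (ser -> ser) -> Prop :=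
| amon_gen i : (i < 3)%N -> amon 1 (vop i)
| amon_mul a b F G : amon a F -> amon b G -> amon (a + b) (fun f => F (G f)).

(* H_infty = Grassmann algebra on x_i, y_i; encoding x_i |-> 2i, y_i |-> 2i+1 *)
Definition xg (i : nat) : nat := (2 * i)%N.
Definition yg (i : nat) : nat := (2 * i).+1.

Definition grade_inv (f : ser) : ser := fun T => sgn #|` T| * f T.

(* The Poisson bracket with {y_i,x_j} = delta_ij, {x_i,x_j}={y_i,y_j}=0:
   {f,g} = sum_i ( grade_inv(d_{y_i} f) d_{x_i} g + grade_inv(d_{x_i} f) d_{y_i} g ).
   For elements of the completion H~ only indices i < bnd T contribute to the
   coefficient at T, so the truncation gives the exact bracket on H~. *)
Definition pbr (f g : ser) : ser := fun T =>
  \sum_(i < bnd T)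
     (gmul (grade_inv (gder (yg i) f)) (gder (xg i) g) T
    + gmul (grade_inv (gder (xg i) f)) (gder (yg i) g) T).

(* formal square of an odd element in characteristic 2:
   f^[2] = sum_i d_{y_i} f * d_{x_i} f  (satisfies m^[2] = 0 for odd
   monomials m and (f+g)^[2] = f^[2] + {f,g} + g^[2] in characteristic 2) *)
Definition fsq (f : ser) : ser := fun T =>
  \sum_(i < bnd T) gmul (gder (yg i) f) (gder (xg i) f) T.

Definition odd_el (f : ser) : Prop := forall T, f T != 0 -> odd #|` T|.

(* the monomial prod_{n<k}(x_{i+3n} x_{i+3n+1}) y_{i+3k}, increasing order *)
Definition Vmon (i k : nat) : mono :=
  [fset xg (i + 3 * n) | n in iota 0 k] `|` [fset xg (i + 3 * n).+1 | n in iota 0 k]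
  `|` [fset yg (i + 3 * k)].

(* V_i = sum_k Vmon i k (each coefficient 0 or 1; only k < bnd T can match) *)
Definition Vgen (i : nat) : ser := fun T =>
  \sum_(k < bnd T) (T == Vmon i k)%:R.

Inductive pmon : nat -> ser -> Prop :=
| pmon_gen i : (i < 3)%N -> pmon 1 (Vgen i)
| pmon_mul a b f g : pmon a f -> pmon b g -> pmon (a + b) (gmul f g)
| pmon_br a b f g : pmon a f -> pmon b g -> pmon (a + b) (pbr f g)
| pmon_sq a f : (2%:R : K) = 0 -> odd_el f -> pmon a f -> pmon (2 * a) (fsq f).

(* vectors of type V, compared through the family of linear "coordinate"
   functionals ev _ i for the indices i satisfying P *)
Definition lin_indep (V I : Type) (P : I -> Prop) (ev : V -> I -> K)
    (l : seq V) : Prop :=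
  forall c : seq K, size c = size l ->
    (forall i, P i -> \sum_(p <- zip c l) p.1 * ev p.2 i = 0) ->
    all (fun a => a == 0) c.

Definition dim_span (V I : Type) (P : I -> Prop) (ev : V -> I -> K)
    (S : V -> Prop) (d : nat) : Prop :=
  (exists l : seq V, size l = d /\ List.Forall S l /\ lin_indep P ev l) /\
  (forall l : seq V, List.Forall S l -> lin_indep P ev l -> (size l <= d)%N).

Definition growthP (n d : nat) : Prop :=
  dim_span (fun _ : mono => True) (fun (f : ser) T => f T)
    (fun f => exists k, (k <= n)%N /\ pmon k f) d.

(* growth function of A w.r.t. v_0,v_1,v_2; operators are compared as
   endomorphisms of Lambda (the finitely supported series) *)
Definition growthA (n d : nat) : Prop :=
  dim_span (fun p : ser * mono => finsupp p.1)
    (fun (F : ser -> ser) p => F p.1 p.2)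
    (fun F => exists k, (k <= n)%N /\ amon k F) d.

End Grassmann.

(* Main.v *)
Require Import Defs.
From Stdlib Require Import Reals Lra.
From Coquelicot Require Import Coquelicot.
From HB Require Import structures.
From mathcomp Require Import all_boot all_order all_algebra.
From mathcomp Require Import finmap.
From mathcomp Require Import boolp zify ring lra Rstruct.

(** Both algebras are governed by the recursion [v_i = d_i + x_i x_(i+1) v_(i+3)]
    (with [d_i] replaced by [y_i] for the Poisson superalgebra), and all relations
    are homogeneous for the weights [wt v_i = lam ^ i], [wt x_i = - lam ^ i],
    because [lam ^ 3 = lam + 2].

    Upper bound.  The Lie superalgebra generated by [v_0, v_1, v_2] lies in the
    span of the words [x^a v_n] in which [a] is contained in [0, n-2] and does not
    contain both [n-2] and [n-3].  The weight of such a word is at least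
    [const * lam ^ n].  A monomial of degree [k] has weight at most [lam ^ 2 * k];
    it is therefore a combination of products of such words with
    [lam ^ n <= const * k], hence of the [4 ^ (n+1)] elements [x^a v^b] with
    indices at most [n].

    Lower bound.  For [n = 3 q + 3] brackets produce [x_0 ... x_(n-3) v_n], and
    bracketing with [v_i] deletes the letter [x_i].  So the elements
    [x^a v_n v^b], with [a] in [0, n-3] and [b] in [0, n-1], are obtained in degree
    at most [3 lam ^ n]; they are linearly independent, and there are
    [2 ^ (2 n - 2)] of them. *)

(** The bracket computations are shared: they use only the axioms of [superalg]. The two upper
    bounds part when products are normalised. Operators must be sorted, in the manner of Poincare,
    Birkhoff and Witt, and each exchange creates a bracket whose weight has to be controlled; in the
    Poisson superalgebra the product is supercommutative and the Leibniz rule moves brackets inside.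
    Characteristic 2 disturbs this uniformity, because the square of an odd element is then not
    determined by its bracket with itself. The remedy is to compute squares directly:
    [v_n ^ 2 = x_(n+1) v_(n+3)] for operators, and for series [V_n ^ 2 = 0] and, in characteristic
    2, [V_n ^ [2] = x_(n+1) V_(n+3)]; weights still add up. The second obstacle is the infinite
    sums. Every identity is checked at one coefficient at a time, where a finite truncation
    suffices. The two counts give the same exponent because each is reached in degree [lam ^ n] up
    to a constant factor; so the logarithm of the growth function is [2 log_lam 2 * ln n + O(1)],
    and the ratio has a genuine limit. *)

Set Implicit Arguments.
Unset Strict Implicit.
Unset Printing Implicit Defensive.

Import Order.TTheory GRing.Theory Num.Theory.
Local Open Scope fset_scope.
Local Open Scope ring_scope.

(** * Dimensions of spans *)

Section Dimension.
Variables (K : fieldType) (V I : Type) (P : I -> Prop) (ev : V -> I -> K).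

(** Taking [f] itself as the default of [nth] avoids asking for an inhabitant of [V]; the indices
    stay in range. *)
Definition evspan (L : seq V) (f : V) : Prop :=
  exists c : nat -> K, forall i, P i ->
    ev f i = \sum_(k < size L) c k * ev (nth f L k) i.

Lemma sum_zipE (x0 : V) (c : seq K) (l : seq V) i : size c = size l ->
  \sum_(p <- zip c l) p.1 * ev p.2 i =
  \sum_(k < size l) c`_k * ev (nth x0 l k) i.
Proof.
move=> sz; rewrite (big_nth (0, x0)) big_mkord size_zip sz minnn.
by apply: eq_bigr => k _; rewrite nth_zip.
Qed.

Lemma ForallP (S : V -> Prop) (x0 : V) l :
  List.Forall S l <-> forall k, (k < size l)%N -> S (nth x0 l k).
Proof.
elim: l => [|a l IH]; first by split=> // _; constructor.
split=> [H|H].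
  inversion H as [|? ? Sa Sl]; subst => -[|k] //= lk.
  exact: (IH.1 Sl k lk).
constructor; first exact: (H 0%N).
by apply: IH.2 => k lk; apply: (H k.+1).
Qed.

(** Steinitz by matrices: with more rows than columns, the coefficient matrix has a nonzero vector
    in its left kernel, and that vector is a relation among the elements of [l]. *)
Lemma indep_size_le (L l : seq V) :
  List.Forall (evspan L) l -> lin_indep P ev l -> (size l <= size L)%N.
Proof.
case: l => [//|x0 l0]; set l := x0 :: l0 => Hl Hind.
have Hn k : evspan L (nth x0 l (k : 'I_(size l))) by apply: (ForallP _ _ _).1.
have [cf cfP] := choice Hn.
rewrite leqNgt; apply/negP => lt.
pose M := \matrix_(k < size l, m < size L) cf k m.
have /rowV0Pn [u /sub_kermxP uM u0] : kermx M != 0.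
  rewrite -mxrank_eq0 mxrank_ker subn_eq0 -ltnNge.
  by apply: leq_ltn_trans (rank_leq_col _) lt.
pose c := [seq u ord0 k | k : 'I_(size l)].
have sc : size c = size l by rewrite size_map size_enum_ord.
have cE (k : 'I_(size l)) : c`_k = u ord0 k.
  by rewrite (nth_map k) ?size_enum_ord // nth_ord_enum.
have /allP c0 : all (fun a => a == 0) c.
  apply: Hind => // i Pi; rewrite (sum_zipE x0) //.
  under eq_bigr => k _.
    rewrite cE (cfP k i Pi) mulr_sumr.
    under eq_bigr => m _ do rewrite (set_nth_default x0) // mulrA.
    over.
  rewrite exchange_big big1 // => m _; rewrite -mulr_suml.
  have := congr1 (fun A : 'rV_(size L) => A ord0 m) uM; rewrite !mxE => uMm.
  rewrite [X in X * _](_ : _ = 0) ?mul0r // -[RHS]uMm.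
  by apply: eq_bigr => j _; rewrite !mxE.
case/eqP: u0; apply/rowP => k; rewrite mxE -cE; apply/eqP/c0/mem_nth.
by rewrite sc.
Qed.

Lemma evspan_trans (L L' : seq V) f :
  List.Forall (evspan L) L' -> evspan L' f -> evspan L f.
Proof.
move=> HL [c cP].
have Hn k : evspan L (nth f L' (k : 'I_(size L'))) by apply: (ForallP _ _ _).1.
have [cf cfP] := choice Hn.
exists (fun m => \sum_(k < size L') c k * cf k m) => i Pi.
rewrite cP //; under [RHS]eq_bigr => m _ do rewrite mulr_suml.
rewrite exchange_big; apply: eq_bigr => k _.
rewrite (cfP k i Pi) mulr_sumr; apply: eq_bigr => m _.
by rewrite mulrA (set_nth_default f).
Qed.

Variable S : V -> Prop.

Lemma maximal_indep_spans (l : seq V) f :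
  lin_indep P ev l -> ~ lin_indep P ev (f :: l) -> evspan l f.
Proof.
move=> Hl /existsNP [c] /not_implyP [sc] /not_implyP [c0 nc].
case: c sc c0 nc => [//|a c] [sc] c0 nc.
have a0 : a != 0.
  apply/eqP => a0; case: nc; rewrite /= a0 eqxx; apply: Hl => // i Pi.
  by have := c0 i Pi; rewrite /= big_cons /= a0 mul0r add0r.
exists (fun k => - (c`_k / a)) => i Pi.
have := c0 i Pi; rewrite /= big_cons /= (sum_zipE f) // => /eqP.
rewrite addr_eq0 => /eqP E; apply: (mulfI a0); rewrite E mulr_sumr -sumrN.
by apply: eq_bigr => k _; rewrite mulNr mulrN [a * _]mulrA [a * (_ / _)]mulrC divfK.
Qed.

(** The bound [B] guarantees a largest size of independent families. This is what makes the growth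
    functions of the theorem exist. *)
Lemma dim_span_exists (B : nat) :
  (forall l, List.Forall S l -> lin_indep P ev l -> (size l <= B)%N) ->
  exists d, Defs.dim_span P ev S d.
Proof.
move=> HB.
pose Q d := `[< exists l : seq V, size l = d /\ List.Forall S l /\ lin_indep P ev l >].
have Qex : exists d, Q d.
  by exists 0%N; apply/asboolP; exists [::]; do !split => //; case.
have Qub d : Q d -> (d <= B)%N by move/asboolP=> [l [<- [? ?]]]; apply: HB.
case: (ex_maxnP Qex Qub) => d /asboolP Qd dmax; exists d; split=> // l Sl il.
by apply/dmax/asboolP; exists l.
Qed.

Lemma dim_span_le (L : seq V) d :
  (forall f, S f -> evspan L f) -> Defs.dim_span P ev S d -> (d <= size L)%N.
Proof.
move=> HS [[l [<- [Sl il]]] _]; apply: indep_size_le il.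
by apply: List.Forall_impl Sl.
Qed.

(** The members of [E] need only be combinations of elements of [S]: an iterated supercommutator of
    operators is a sum of monomials, not a monomial. *)
Lemma dim_span_ge (E : seq V) d :
  (forall k x0, (k < size E)%N ->
     exists L, List.Forall S L /\ evspan L (nth x0 E k)) ->
  lin_indep P ev E -> Defs.dim_span P ev S d -> (size E <= d)%N.
Proof.
move=> HE iE [[l [sl [Sl il]]] lmax]; rewrite -sl; apply: indep_size_le iE.
case: E HE => [|x0 E] HE; first by constructor.
apply: (ForallP _ x0 _).2 => k lk; have [L [SL eL]] := HE k x0 lk.
apply: evspan_trans eL; apply: List.Forall_impl SL => f Sf.
apply: maximal_indep_spans => // ifl.
by have := lmax (f :: l) (List.Forall_cons _ Sf Sl) ifl; rewrite /= sl ltnn.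
Qed.

(** Pairing [E j] with the test coordinate [th i] gives a matrix that is triangular for the rank
    [rk], so the coefficients vanish by induction on the rank. *)
Lemma triangular_indep (J : eqType) (s : seq J) (E : J -> V) (th : J -> I)
    (rk : J -> nat) :
  uniq s -> (forall j, j \in s -> P (th j)) ->
  (forall j, j \in s -> ev (E j) (th j) != 0) ->
  (forall i j, i \in s -> j \in s -> ev (E j) (th i) != 0 ->
     j = i \/ (rk j < rk i)%N) ->
  lin_indep P ev [seq E j | j <- s].
Proof.
case: s => [|j0 s0]; first by move=> _ _ _ _ [].
set s := j0 :: s0 => us Pth diag tri c; rewrite size_map => sc c0.
suff H n k : (k < size s)%N -> (rk (nth j0 s k) < n)%N -> c`_k = 0.
  by apply/(all_nthP 0) => k; rewrite sc => lk; rewrite (H _ k lk (ltnSn _)).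
elim: n k => // n IH k lk; rewrite ltnS => rkn.
have ks : nth j0 s k \in s by rewrite mem_nth.
have := c0 _ (Pth _ ks).
rewrite (sum_zipE (E j0)) ?size_map // (bigD1 (Ordinal lk)) //= big1 => [|m mk].
  rewrite addr0 -map_cons (nth_map j0) // => /eqP; rewrite mulf_eq0.
  by rewrite (negPf (diag _ ks)) orbF => /eqP.
have lm : (m < size s)%N := ltn_ord m.
rewrite -map_cons (nth_map j0) //; apply/eqP; rewrite mulf_eq0; apply/orP.
have [E0|E0] := eqVneq (ev (E (nth j0 s m)) (th (nth j0 s k))) 0; [by right|left].
have [/eqP|lr] := tri _ _ ks (mem_nth j0 lm) E0.
  by rewrite nth_uniq // => /eqP mk'; case/eqP: mk; apply: val_inj.
by rewrite IH //; apply: leq_trans lr rkn.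
Qed.

End Dimension.

(** * Super Leibniz algebras and good words *)

Definition sg (K : fieldType) (b : bool) : K := (-1) ^+ b.
Arguments sg {K} b.

(* Common abstraction of End(Lambda) with the supercommutator and of the Poisson
   superalgebra; [hom p] is the set of homogeneous elements of parity [p], and
   [v i - x i * x i.+1 * v i.+3] is the derivation d_i, respectively y_i. *)
Record superalg (K : fieldType) (R : algType K) := SuperAlg {
  hom : bool -> R -> Prop;
  br : bool -> bool -> R -> R -> R;
  x : nat -> R;
  v : nat -> R;
  hom0 : forall p, hom p 0;
  homD : forall p f g, hom p f -> hom p g -> hom p (f + g);
  homZ : forall p c f, hom p f -> hom p (c *: f);
  homM : forall p q f g, hom p f -> hom q g -> hom (p (+) q) (f * g);
  hom1 : hom false 1;
  homx : forall i, hom true (x i);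
  homv : forall i, hom true (v i);
  hombr : forall p q f g, hom p f -> hom q g -> hom (p (+) q) (br p q f g);
  brDl : forall p q f f' g, hom p f -> hom p f' -> hom q g ->
    br p q (f + f') g = br p q f g + br p q f' g;
  brZl : forall p q c f g, hom p f -> hom q g -> br p q (c *: f) g = c *: br p q f g;
  brC : forall p q f g, hom p f -> hom q g ->
    br p q f g = - (sg (p && q) *: br q p g f);
  brMl : forall p q r s f g h, s = p (+) q -> hom p f -> hom q g -> hom r h ->
    br s r (f * g) h = f * br q r g h + sg (q && r) *: (br p r f h * g);
  brMr : forall p q r s f g h, s = q (+) r -> hom p f -> hom q g -> hom r h ->
    br p s f (g * h) = br p q f g * h + sg (p && q) *: (g * br p r f h);
  xxC : forall i j, x i * x j = - (x j * x i);
  xx0 : forall i, x i * x i = 0;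
  vxC : forall i j, (i < j)%N -> v j * x i = - (x i * v j);
  brxx : forall i j, br true true (x i) (x j) = 0;
  brxv : forall i j, (i < j)%N -> br true true (x i) (v j) = 0;
  brdx : forall i j,
    br true true (v i - x i * x i.+1 * v i.+3) (x j) = (i == j)%:R;
  brdv : forall i j, (i < j)%N ->
    br true true (v i - x i * x i.+1 * v i.+3) (v j) = 0;
  brdd : forall i, br true true (v i - x i * x i.+1 * v i.+3)
                                (v i - x i * x i.+1 * v i.+3) = 0 }.

Section Abstract.
Variables (K : fieldType) (R : algType K) (S : superalg R).
Local Notation x := (x S).
Local Notation v := (v S).
Local Notation hom := (hom S).
Local Notation br := (br S).

Definition d i := v i - x i * x i.+1 * v i.+3.
Definition xw (a : seq nat) : R := \prod_(i <- a) x i.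

Lemma xw_nil : xw [::] = 1. Proof. exact: big_nil. Qed.
Lemma xw_cons i a : xw (i :: a) = x i * xw a. Proof. exact: big_cons. Qed.
Lemma xw_cat a b : xw (a ++ b) = xw a * xw b. Proof. exact: big_cat. Qed.
Definition xwE := (xw_nil, xw_cons, xw_cat).

Lemma hom_xw a : hom (odd (size a)) (xw a).
Proof.
elim: a => [|i a IH]; first by rewrite xwE; apply: hom1.
by rewrite xwE; apply: (homM (homx S i) IH).
Qed.

Lemma hom_xwv a n : hom (~~ odd (size a)) (xw a * v n).
Proof. by rewrite -addbT; apply: homM (hom_xw a) (homv S n). Qed.

Lemma homN p f : hom p f -> hom p (- f).
Proof. by move=> hf; rewrite -scaleN1r; apply: homZ. Qed.

Lemma hom_xxv a : hom true (x a * x a.+1 * v a.+3).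
Proof.
exact: (homM (homM (homx S a) (homx S a.+1)) (homv S a.+3)).
Qed.

Lemma hom_d a : hom true (d a).
Proof. by apply: homD (homv S a) (homN (hom_xxv a)). Qed.

Lemma v_rec a : v a = d a + x a * x a.+1 * v a.+3.
Proof. by rewrite /d subrK. Qed.

Lemma br0l p q g : hom q g -> br p q 0 g = 0.
Proof. by move=> hg; rewrite -(scale0r 0) brZl ?scale0r //; apply: hom0. Qed.

Lemma br0r p q f : hom p f -> br p q f 0 = 0.
Proof. by move=> hf; rewrite brC ?br0l ?scaler0 ?oppr0 //; apply: hom0. Qed.

Lemma brDr p q f g g' : hom p f -> hom q g -> hom q g' ->
  br p q f (g + g') = br p q f g + br p q f g'.
Proof.
move=> hf hg hg'.
by rewrite !(brC hf) ?brDl ?scalerDr ?opprD //; apply: homD.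
Qed.

Lemma brZr p q c f g : hom p f -> hom q g -> br p q f (c *: g) = c *: br p q f g.
Proof.
move=> hf hg; rewrite !(brC hf) ?brZl //; last exact: homZ.
by rewrite scalerN !scalerA mulrC.
Qed.

Lemma br_oddC f g : hom true f -> hom true g -> br true true f g = br true true g f.
Proof. by move=> hf hg; rewrite brC // /sg expr1 scaleN1r opprK. Qed.

Lemma br_xxv q a g : hom q g -> br true q (x a) g = 0 -> br true q (x a.+1) g = 0 ->
  br true q (x a * x a.+1 * v a.+3) g = x a * x a.+1 * br true q (v a.+3) g.
Proof.
move=> hg e1 e2; rewrite -mulrA.
rewrite (brMl (p := true) (q := false)) ?e1 ?mul0r ?scaler0 ?addr0 -?mulrA //.
- rewrite (brMl (p := true) (q := true)) ?e2 ?mul0r ?scaler0 ?addr0 //; exact: homx || exact: homv.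
- exact: homx.
- exact: (homM (homx S _) (homv S _)).
Qed.

Lemma brvx_lt a j : (j < a)%N -> br true true (v a) (x j) = 0.
Proof. by move=> lt; rewrite br_oddC ?brxv //; apply: homx || apply: homv. Qed.

Lemma brvx_rec a j : br true true (v a) (x j) =
  (a == j)%:R + x a * x a.+1 * br true true (v a.+3) (x j).
Proof.
rewrite {1}v_rec brDl ?brdx ?br_xxv ?brxx //; first [exact: homx | exact: hom_d | exact: hom_xxv].
Qed.

Lemma brxvv a : br true true (v a) (x a) = 1.
Proof. by rewrite brvx_rec eqxx brvx_lt ?mulr0 ?addr0 //; lia. Qed.

Lemma brvv_rec a b : (a.+1 < b)%N ->
  br true true (v a) (v b) = x a * x a.+1 * br true true (v a.+3) (v b).
Proof.
move=> ab; rewrite {1}v_rec brDl ?brdv ?add0r ?br_xxv ?brxv //; try lia;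
  first [exact: homv | exact: hom_d | exact: hom_xxv].
Qed.

(** The derivation [d a] kills [v a.+1]. In the tail [x a * x a.+1 * v a.+3] the letter [x a.+1]
    pairs with [v a.+1] to 1, while the bracket of [v a.+3] with [v a.+1] starts with [x a.+1] and
    dies against the same letter. *)
Lemma brvv_S a : br true true (v a) (v a.+1) = - (x a * v a.+3).
Proof.
have hx := homx S; have hv := homv S.
rewrite {1}v_rec brDl ?brdv ?add0r //; [|exact: hom_d|exact: hom_xxv].
have hxv : hom false (x a.+1 * v a.+3) by apply: (homM (hx _) (hv _)).
rewrite -mulrA (brMl (p := true) (q := false)) // brxv // mul0r scaler0 addr0.
rewrite (brMl (p := true) (q := true)) // [br _ _ (v a.+3) _]br_oddC //.
rewrite brvv_rec; last lia.
rewrite -!mulrA [x a.+1 * (x a.+1 * _)]mulrA xx0 mul0r add0r.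
by rewrite [br _ _ (x _) _]br_oddC // brxvv mul1r /sg expr1 scaleN1r mulrN.
Qed.

Lemma brvv_2 a : br true true (v a) (v a.+2) = - (x a * x a.+1 * x a.+2 * v a.+1.+4).
Proof.
have hv := homv S.
by rewrite brvv_rec ?[br _ _ (v a.+3) _]br_oddC ?brvv_S ?mulrN ?mulrA.
Qed.

Lemma brd_xxv a : br true true (d a) (x a * x a.+1 * v a.+3) = x a.+1 * v a.+3.
Proof.
have hx := homx S; have hv := homv S; have hd := hom_d a.
have hxv : hom false (x a.+1 * v a.+3) by apply: (homM (hx _) (hv _)).
rewrite -mulrA (brMr (q := true) (r := false)) // brdx eqxx mul1r.
rewrite (brMr (q := true) (r := true)) // brdx brdv; last lia.
by rewrite (ltn_eqF (ltnSn a)) mul0r mulr0 scaler0 addr0 mulr0 scaler0 addr0.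
Qed.

Lemma br_xxv_xxv a :
  br true true (x a * x a.+1 * v a.+3) (x a * x a.+1 * v a.+3) = 0.
Proof.
have hx := homx S; have hv := homv S; have hu := hom_xxv a.
have hxv : hom false (x a.+1 * v a.+3) by apply: (homM (hx _) (hv _)).
have brxu i : (i < a.+3)%N -> br true true (x i) (x a * x a.+1 * v a.+3) = 0.
  move=> lt; rewrite -mulrA (brMr (q := true) (r := false)) // brxx mul0r add0r.
  rewrite (brMr (q := true) (r := true)) // brxx brxv //.
  by rewrite mul0r mulr0 scaler0 addr0 mulr0 scaler0.
rewrite br_xxv ?brxu //; try lia.
rewrite -[X in br _ _ _ X]mulrA (brMr (q := true) (r := false)) // brvx_lt; last lia.
rewrite mul0r add0r -scalerAr (xxC _ a) mulNr -!mulrA.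
by rewrite (mulrA (x a) (x a)) xx0 mul0r mulr0 oppr0 scaler0.
Qed.

(** Split [v a] by its recursion: both summands have zero bracket with themselves, so only the cross
    term remains, twice. *)
Lemma brvv a : br true true (v a) (v a) = 2%:R *: (x a.+1 * v a.+3).
Proof.
have hd := hom_d a; have hu := hom_xxv a; have hdu := homD hd hu.
have dd : br true true (d a) (d a) = 0 by apply: brdd.
rewrite {1 2}v_rec brDl // (brDr hd hd hu) (brDr hu hd hu) dd brd_xxv br_xxv_xxv add0r addr0.
by rewrite br_oddC // brd_xxv scaler_nat mulr2n.
Qed.

Lemma addrr_id0 (f : R) : f = f + f -> f = 0.
Proof. by move=> H; apply: (addrI f); rewrite addr0 -H. Qed.

(** The Leibniz rule for [1 * 1] shows that this bracket equals twice itself. *)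
Lemma br_1l q g : hom q g -> br false q 1 g = 0.
Proof.
move=> hg; have H : br false q 1 g = br false q 1 g + br false q 1 g.
  rewrite -{1}(mulr1 (1 : R)) (brMl (p := false) (q := false)) //; try exact: hom1.
  by rewrite mul1r mulr1 /sg expr0 scale1r.
exact: addrr_id0.
Qed.

Lemma br_1r p f : hom p f -> br p false f 1 = 0.
Proof.
move=> hf; rewrite brC ?br_1l ?scaler0 ?oppr0 //; exact: hom1.
Qed.

Lemma br_x_xw i a : br true (odd (size a)) (x i) (xw a) = 0.
Proof.
elim: a => [|j a IH].
  by rewrite xwE br_1r //; apply: homx.
rewrite xwE (brMr (q := true) (r := odd (size a))) ?brxx ?IH //.
- by rewrite mul0r mulr0 scaler0 addr0.
- exact: homx. - exact: homx. - exact: hom_xw.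
Qed.

Lemma br_x_xwv i a n : (i < n)%N ->
  br true (~~ odd (size a)) (x i) (xw a * v n) = 0.
Proof.
move=> lt; rewrite (brMr (q := odd (size a)) (r := true)) ?br_x_xw ?brxv //.
- by rewrite mul0r mulr0 scaler0 addr0.
- by rewrite addbT.
- exact: homx. - exact: hom_xw. - exact: homv.
Qed.

Lemma br_xw_xwv c a n : {in c, forall i, i < n}%N ->
  br (odd (size c)) (~~ odd (size a)) (xw c) (xw a * v n) = 0.
Proof.
elim: c => [|i c IH] H; first by rewrite xwE br_1l //; apply: hom_xwv.
rewrite xwE (brMl (p := true) (q := odd (size c))) ?br_x_xwv ?IH //.
- by rewrite mul0r mulr0 scaler0 addr0.
- by move=> j jc; apply: H; rewrite inE jc orbT.
- by apply: H; rewrite inE eqxx.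
- exact: homx. - exact: hom_xw. - exact: hom_xwv.
Qed.

Lemma br_v_xw0 a c : {in c, forall j, j < a}%N ->
  br true (odd (size c)) (v a) (xw c) = 0.
Proof.
elim: c => [|i c IH] H; first by rewrite xwE br_1r //; apply: homv.
rewrite xwE (brMr (q := true) (r := odd (size c))) ?brvx_lt ?IH //.
- by rewrite mul0r mulr0 scaler0 addr0.
- by move=> j jc; apply: H; rewrite inE jc orbT.
- by apply: H; rewrite inE eqxx.
- exact: homv. - exact: homx. - exact: hom_xw.
Qed.

(** The sign is left existential, since it is invisible to spans and to the degree predicate
    [deg]. *)
Lemma xw_rem i a : i \in a -> exists e : bool, xw a = sg e *: (x i * xw (rem i a)).
Proof.
elim: a => // j a IH; rewrite inE => /orP[/eqP->|ia] /=.
  by exists false; rewrite eqxx xwE /sg expr0 scale1r.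
have [->|ji] := eqVneq j i; first by exists false; rewrite xwE /sg expr0 scale1r.
have [e E] := IH ia; exists (~~ e); rewrite !xwE E -scalerAr mulrA xxC mulNr -mulrA.
by rewrite scalerN -scaleNr /sg; case: e {E}; rewrite ?expr1 ?expr0 ?opprK.
Qed.

Lemma xw_nuniq a : ~~ uniq a -> xw a = 0.
Proof.
elim: a => //= i a IH; rewrite negb_and negbK xwE => /orP[ia|/IH->]; last by rewrite mulr0.
by have [e ->] := xw_rem ia; rewrite -scalerAr mulrA xx0 mul0r scaler0.
Qed.

(** * Weights and good words *)

Section Weights.
Variables (F : realFieldType) (lam : F).
Hypotheses (lam3 : lam ^+ 3 = lam + 2%:R) (lam_gt : 3%:R / 2%:R < lam).
Local Notation pw n := (lam ^+ n).

Definition wsum (a : seq nat) : F := \sum_(i <- a) pw i.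
Lemma wsum_nil : wsum [::] = 0. Proof. exact: big_nil. Qed.
Lemma wsum_cons i a : wsum (i :: a) = pw i + wsum a. Proof. exact: big_cons. Qed.
Lemma wsum_cat a b : wsum (a ++ b) = wsum a + wsum b. Proof. exact: big_cat. Qed.
Definition wsumE := (wsum_nil, wsum_cons, wsum_cat).

Lemma pw3 n : pw n.+3 = pw n.+1 + 2%:R * pw n.
Proof. by rewrite -addn3 exprD lam3 exprS; ring. Qed.

Lemma lam_gt0 : 0 < lam. Proof. by have := lam_gt; lra. Qed.
Lemma pw_gt0 n : 0 < pw n. Proof. by rewrite exprn_gt0 // lam_gt0. Qed.

(** Each unrolling of the recursion collects [x_a x_(a+1)] and moves from [a] to [a+3]. A nonzero
    value arises only if [j] is hit exactly; the last pair collected is then [j-3, j-2], which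
    bounds the letters. *)
Lemma brvxP a j : br true true (v a) (x j) = 0 \/
  exists X, [/\ br true true (v a) (x j) = xw X, ~~ odd (size X),
    {in X, forall i, i.+2 <= j}%N, (a <= j)%N & wsum X = pw j - pw a].
Proof.
move: {2}(j.+1 - a)%N (leqnn (j.+1 - a)) => n; elim: n a => [|n IH] a le.
  by left; apply: brvx_lt; lia.
have [lt|aj] := ltnP j a; first by left; apply: brvx_lt.
rewrite brvx_rec; have [->|ne] := eqVneq a j.
  right; exists [::]; split=> //; last by rewrite wsumE subrr.
  by rewrite xwE brvx_lt ?mulr0 ?addr0 //; lia.
have le' : (j.+1 - a.+3 <= n)%N by lia.
rewrite add0r; have [->|[X [-> sX HX aj' wX]]] := IH a.+3 le'; first by left; rewrite mulr0.
right; exists [:: a, a.+1 & X]; split=> //=; rewrite ?negbK //.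
- by rewrite !xwE mulrA.
- by move=> i; rewrite !inE => /or3P[/eqP->|/eqP->|/HX//]; lia.
- by rewrite !wsumE wX pw3; lra.
Qed.

(** Unrolling in steps of 3 ends when the difference of the indices is 0, 1 or 2. These endings
    contribute the letter [n-2] alone, [n-3] alone, or [n-5, n-4, n-3]; all letters collected on the
    way are at most [n-4]. So [n-2] and [n-3] never meet. *)
Lemma brvvP a b : (a <= b)%N -> exists c X n,
  [/\ br true true (v a) (v b) = c *: (xw X * v n), odd (size X),
      {in X, forall i, i.+2 <= n}%N,
      forall i, i.+3 = n -> i.+1 \in X -> i \notin X
    & (b.+2 <= n)%N /\ pw n - wsum X = pw a + pw b].
Proof.
move: {2}(b - a)%N (leqnn (b - a)) => k; elim: k a => [|k IH] a le ab.
  have -> : a = b by lia.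
  exists 2%:R, [:: b.+1], b.+3; rewrite brvv xwE xwE mulr1 !wsumE; split=> //.
  - by move=> i; rewrite inE => /eqP->.
  - by move=> i [<-]; rewrite !inE; lia.
  - by split; [lia|rewrite pw3; lra].
have [abE|ltab] := leqP b a.
  by apply: IH; lia.
have [E1|E1] := eqVneq b a.+1.
  exists (-1), [:: a], a.+3; rewrite E1 brvv_S xwE xwE mulr1 scaleN1r !wsumE.
  split=> //.
  - by move=> i; rewrite inE => /eqP->; lia.
  - by move=> i [->]; rewrite inE; lia.
  - by split; [lia|rewrite pw3; lra].
have [E2|E2] := eqVneq b a.+2.
  exists (-1), [:: a; a.+1; a.+2], a.+1.+4; rewrite E2 brvv_2 !xwE mulr1 scaleN1r !wsumE.
  rewrite !mulrA; split=> //.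
  - by move=> i; rewrite !inE; lia.
  - by move=> i; rewrite !inE; lia.
  - by split; [lia|rewrite !pw3; lra].
have [||c [X [n [E oX HX HX2 [bn wX]]]]] := IH a.+3; try lia.
exists c, [:: a, a.+1 & X], n; rewrite brvv_rec ?E ?xwE ?wsumE; last lia.
split=> //=; rewrite ?negbK //.
- by rewrite -scalerAr !mulrA.
- by move=> i; rewrite !inE => /or3P[/eqP->|/eqP->|/HX//]; lia.
- move=> i in_; rewrite !inE => /or3P[/eqP|/eqP|iX]; try lia.
  by have := HX2 i in_ iX; move: (i \in X) => -[]; lia.
- by split; [lia|move: wX; rewrite pw3; lra].
Qed.

(* No product [x_(n-2) x_(n-3) v_n] ever arises; this restriction is what keeps
   all weights positive, see [good_weight]. *)
Definition good (a : seq nat) (n : nat) : Prop :=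
  {in a, forall i, i.+2 <= n}%N /\
  forall i, i.+3 = n -> i.+1 \in a -> i \notin a.

Definition weight a n := pw n - wsum a.

(** A filtration of the span of good words: [b] bounds the index from below, [w] bounds the weight
    from above, [p] is the parity. The lower bound on the index is what later lets the sorting of
    operator products succeed. *)
Inductive goodspan (b : nat) (w : F) (p : bool) : R -> Prop :=
| goodspan_word a n : uniq a -> good a n -> (b <= n)%N -> weight a n <= w ->
    p = ~~ odd (size a) -> goodspan b w p (xw a * v n)
| goodspan0 : 0 <= w -> goodspan b w p 0
| goodspanD f g : goodspan b w p f -> goodspan b w p g -> goodspan b w p (f + g)
| goodspanZ c f : goodspan b w p f -> goodspan b w p (c *: f).

Lemma goodspan_hom b w p f : goodspan b w p f -> hom p f.
Proof.
elim=> [a n _ _ _ _ ->|_|? ? _ ? _ ?|? ? _ ?].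
- exact: hom_xwv. - exact: hom0. - exact: homD. - exact: homZ.
Qed.

Lemma goodspan_weaken b b' w w' p f : (b' <= b)%N -> w <= w' ->
  goodspan b w p f -> goodspan b' w' p f.
Proof.
move=> lb lw; elim=> [a n ua ga bn wa ->|w0|? ? _ ? _ ?|? ? _ ?].
- by apply: goodspan_word => //; [apply: leq_trans bn|apply: le_trans lw].
- by apply: goodspan0; apply: le_trans lw.
- exact: goodspanD.
- exact: goodspanZ.
Qed.

(** A word with a repeated letter is zero, so concatenations may be formed without checking that
    letters are distinct. *)
Lemma goodspan_any_word b w p a n : good a n -> (b <= n)%N -> 0 <= w -> weight a n <= w ->
  p = ~~ odd (size a) -> goodspan b w p (xw a * v n).
Proof.
move=> ga bn w0 wa pa; have [ua|nua] := boolP (uniq a); first exact: goodspan_word.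
by rewrite xw_nuniq // mul0r; apply: goodspan0.
Qed.

Lemma goodspan_opp b w p f : goodspan b w p f -> goodspan b w p (- f).
Proof. by rewrite -scaleN1r; apply: goodspanZ. Qed.

Lemma wsum_subset a b : uniq a -> {subset a <= b} -> wsum a <= wsum b.
Proof.
elim: a b => [|i a IH] b /=.
  by move=> _ _; rewrite wsumE; apply: sumr_ge0 => j _; apply/ltW/pw_gt0.
move=> /andP[ia ua] sub; have ib : i \in b by apply: sub; rewrite inE eqxx.
rewrite /wsum (perm_big _ (perm_to_rem ib)) !big_cons lerD2l; apply: IH => // j ja.
have jb : j \in b by apply: sub; rewrite inE ja orbT.
have : j \in i :: rem i b by rewrite -(perm_mem (perm_to_rem ib)).
by rewrite inE => /orP[/eqP ji|//]; rewrite -ji ja in ia.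
Qed.

Lemma wsum_iota n : (lam - 1) * wsum (iota 0 n) = pw n - 1.
Proof.
elim: n => [|n IH]; first by rewrite wsumE mulr0 expr0 subrr.
by rewrite -addn1 iotaD wsumE mulrDr IH add0n !wsumE addr0 addn1 exprS; ring.
Qed.

(** A crude bound, enough for the inequalities below: [t^3 - t - 2] is already positive from 8/5
    on. *)
Lemma lam_lt : lam < 8%:R / 5%:R.
Proof.
rewrite ltNge; apply/negP => H; have : lam * lam * lam = lam + 2%:R.
  by rewrite -lam3; ring.
by nra.
Qed.

(** The factor [2 lam - 3] comes from the lightest kind of good word, with letters [n-2] and
    [0, ..., n-4]: its weight is at least [lam^(n-3) (2 lam - 3) / (lam - 1)]. Hence the need for
    [lam > 3/2]; the 4 absorbs the remaining factors. *)
Definition wconst : F := (2%:R * lam - 3%:R) / 4%:R.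
Lemma wconst_gt0 : 0 < wconst. Proof. by have := lam_gt; rewrite /wconst; lra. Qed.

Lemma good_weight a n : uniq a -> good a n -> wconst * pw n <= weight a n.
Proof.
move=> ua [H1 H2]; rewrite /weight; have l8 := lam_lt; have lg := lam_gt.
have L3 : lam * lam * lam = lam + 2%:R by rewrite -lam3; ring.
case: n H1 H2 => [|[|[|n]]] H1 H2.
- have -> : a = [::] by case: (a) H1 => // i a' /(_ i); rewrite inE eqxx => /(_ isT).
  by rewrite wsumE expr0 /wconst; lra.
- have -> : a = [::] by case: (a) H1 => // i a' /(_ i); rewrite inE eqxx => /(_ isT).
  by rewrite wsumE expr1 /wconst; nra.
- have /(wsum_subset ua) : {subset a <= [:: 0]}%N.
    by move=> i /H1; rewrite inE; lia.
  by rewrite !wsumE expr0 expr2 /wconst; nra.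
have p0 := pw_gt0 n; have l1 : 0 < lam - 1 by lra.
have E3 : pw n.+3 = (lam + 2%:R) * pw n by rewrite pw3 exprS; ring.
have I1 := wsum_iota n; have I2 := wsum_iota n.+1; rewrite exprS in I2.
(* The index is now [n.+3]. If its top letter [n.+1] occurs, goodness excludes [n] and the other
   letters lie below [n]; otherwise all letters are at most [n]. In each case the geometric sum
   bounds the loss. *)
have [n1a|n1a] := boolP (n.+1 \in a).
  have /(wsum_subset ua) : {subset a <= n.+1 :: iota 0 n}.
    move=> i ia; rewrite inE mem_iota; have := H1 i ia; have na := H2 n erefl n1a.
    by have [E|ne] := eqVneq i n; [rewrite -E ia in na|lia].
  rewrite wsumE exprS; move: (wsum a) (wsum (iota 0 n)) I1 => s t I1 le.
  have k : 0 <= (2%:R * lam - 3%:R) * (4%:R - (lam - 1) * (lam + 2%:R)) * pw n.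
    by rewrite mulr_ge0 ?(ltW p0) // mulr_ge0; nra.
  rewrite E3 /wconst -(ler_pM2l l1); nra.
have /(wsum_subset ua) : {subset a <= iota 0 n.+1}.
  move=> i ia; rewrite mem_iota; have := H1 i ia.
  by have [E|ne] := eqVneq i n.+1; [rewrite -E ia in n1a|lia].
move: (wsum a) (wsum (iota 0 n.+1)) I2 => s t I2 le.
have k : 0 <= (4%:R * (lam * lam - 2%:R)
               - (2%:R * lam - 3%:R) * ((lam - 1) * (lam + 2%:R))) * pw n.
  by rewrite mulr_ge0 ?(ltW p0) //; nra.
rewrite E3 /wconst -(ler_pM2l l1); nra.
Qed.

Lemma weight_ge0 a n : uniq a -> good a n -> 0 <= weight a n.
Proof.
move=> ua ga; apply: le_trans (good_weight ua ga).
by rewrite mulr_ge0 // ltW // ?wconst_gt0 ?pw_gt0.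
Qed.

End Weights.
End Abstract.

(** * Good words are closed under the bracket *)

Section GoodBracket.
Variables (K : fieldType) (R : algType K) (S : superalg R).
Local Notation x := (x S).
Local Notation v := (v S).
Local Notation hom := (hom S).
Local Notation br := (br S).
Local Notation xw := (xw S).
Variables (F : realFieldType) (lam : F).
Hypotheses (lam3 : lam ^+ 3 = lam + 2%:R) (lam_gt : 3%:R / 2%:R < lam).
Local Notation pw n := (lam ^+ n).
Local Notation wsum := (wsum lam).
Local Notation wt := (weight lam).
Local Notation goodspan := (goodspan S lam).

(** The new letters are at most [j-2], hence at most [b-4], so they cannot create the forbidden pair
    [b-2, b-3]. *)
Lemma good_replace b c X j c' : good (c ++ j :: c') b -> {in X, forall i, i.+2 <= j}%N ->
  good (c ++ X ++ c') b.
Proof.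
move=> [H1 H2] HX; have jb : (j.+2 <= b)%N by apply: H1; rewrite mem_cat !inE eqxx orbT.
have sub i : i \in c ++ X ++ c' -> (i \in c ++ j :: c') || (i.+4 <= b)%N.
  rewrite !mem_cat inE; case/or3P => [->//|/HX iX|->]; last by rewrite !orbT.
  by apply/orP; right; lia.
split=> [i /sub /orP[/H1//|]|i ib /sub /orP[i1|]]; try lia.
by apply/negP => /sub /orP[ic|]; [have := H2 i ib i1; rewrite ic|lia].
Qed.

(** [v a] acts on [e] letter by letter as a superderivation; [c] holds the prefix already passed,
    which makes the induction go through. *)
Lemma goodspan_brvx a b c e w p : good (c ++ e) b -> 0 <= w ->
  pw a + wt (c ++ e) b <= w -> p = odd (size c + size e) ->
  goodspan b w p (xw c * br true (odd (size e)) (v a) (xw e) * v b).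
Proof.
elim: e c p => [|j e IH] c p ge w0 we pE.
  by rewrite xwE br_1r ?mulr0 ?mul0r; [apply: goodspan0|apply: homv].
rewrite xwE (brMr (q := true) (r := odd (size e))) //;
  [|exact: homv|exact: homx|exact: hom_xw].
rewrite mulrDr mulrDl; apply: goodspanD; last first.
  have -> : xw c * (sg (true && true) *: (x j * br true (odd (size e)) (v a) (xw e))) * v b
    = - (xw (rcons c j) * br true (odd (size e)) (v a) (xw e) * v b).
    by rewrite -cats1 !xwE mulr1 /sg expr1 scaleN1r mulrN mulNr !mulrA.
  apply: goodspan_opp; apply: IH; rewrite ?cat_rcons //.
  by rewrite pE size_rcons addSnnS.
have [->|[X [-> sX HX aj wX]]] := brvxP S lam3 lam_gt a j.
  by rewrite mul0r mulr0 mul0r; apply: goodspan0.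
rewrite -xw_cat -xw_cat; apply: (goodspan_any_word S) => //.
- exact: good_replace ge HX.
- move: we; rewrite /weight !wsumE wX; lra.
- by rewrite pE !size_cat /= !oddD (negPf sX) /= addbN.
Qed.

(** As [n <= m], the letters of [a] bracket trivially with the second word, so only [v n] acts: on
    the letters of [b], or on [v m]. It kills [b] unless [n+2 <= m], and then the letters of [a] are
    at most [m-4] and do no harm to goodness. *)
Lemma goodspan_br_words a n b m : uniq a -> good a n -> uniq b -> good b m -> (n <= m)%N ->
  goodspan m (wt a n + wt b m) ((~~ odd (size a)) (+) (~~ odd (size b)))
    (br (~~ odd (size a)) (~~ odd (size b)) (xw a * v n) (xw b * v m)).
Proof.
move=> ua ga ub gb nm; have hx := hom_xw S; have hv := homv S.
have wa := weight_ge0 lam3 lam_gt ua ga; have wb := weight_ge0 lam3 lam_gt ub gb.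
have ww : 0 <= wt a n + wt b m by apply: addr_ge0.
rewrite (brMl (p := odd (size a)) (q := true)) ?addbT //; last exact: hom_xwv.
rewrite br_xw_xwv; last by move=> i /ga.1; lia.
rewrite mul0r scaler0 addr0 (brMr (q := odd (size b)) (r := true)) ?addbT //.
rewrite mulrDr; apply: goodspanD.
  have [le|lt] := leqP n.+2 m.
    rewrite mulrA; apply: goodspan_brvx => //.
    - split=> [i|i im].
        by rewrite mem_cat => /orP[/ga.1|/gb.1//]; lia.
      rewrite !mem_cat => /orP[/ga.1|ib]; first lia.
      apply/norP; split; last exact: gb.2 ib.
      by apply/negP => /ga.1; lia.
    - rewrite /weight !wsumE; lra.
    - by rewrite oddD addbN addNb negbK.
  rewrite br_v_xw0 ?mul0r ?mulr0; first exact: goodspan0.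
  by move=> i /gb.1; lia.
(* The new index [k] is at least [m+2], so the letters of [a] and [b] are at most [k-4] and goodness
   depends on [X] only. *)
have [c [X [k [-> oX HX HX2 [mk wX]]]]] := brvvP S lam3 lam_gt nm.
rewrite -!scalerAr; apply: goodspanZ; apply: goodspanZ.
rewrite !mulrA -!xw_cat; apply: (goodspan_any_word S) => //; try lia.
- split=> [i|i ik].
    by rewrite !mem_cat -orbA => /or3P[/ga.1|/gb.1|/HX//]; lia.
  rewrite !mem_cat -!orbA => /or3P[/ga.1|/gb.1|iX]; [lia|lia|].
  apply/norP; split; first by apply/negP => /ga.1; lia.
  apply/norP; split; first by apply/negP => /gb.1; lia.
  exact: HX2.
- by move: wX; rewrite /weight !wsumE; lra.
- by rewrite !size_cat !oddD oX; case: (odd (size a)); case: (odd (size b)).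
Qed.

Lemma goodspan_ge0 b w p f : goodspan b w p f -> 0 <= w.
Proof.
elim=> // a n ua ga _ wa _; apply: le_trans wa.
exact: (weight_ge0 lam3 lam_gt ua ga).
Qed.

Lemma goodspan_br b b' w w' p q f g : goodspan b w p f -> goodspan b' w' q g ->
  goodspan (maxn b b') (w + w') (p (+) q) (br p q f g).
Proof.
move=> Gf Gg; have hg := goodspan_hom Gg.
have ww : 0 <= w + w' by rewrite addr_ge0 ?(goodspan_ge0 Gf) ?(goodspan_ge0 Gg).
elim: Gf => [a n ua ga bn wa ->|_|f1 f2 G1 I1 G2 I2|c f1 G1 I1]; last first.
- by rewrite brZl ?(goodspan_hom G1) //; [apply: goodspanZ|apply: goodspan_hom G1].
- by rewrite brDl //; [apply: goodspanD|apply: goodspan_hom G1|apply: goodspan_hom G2].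
- by rewrite br0l //; apply: goodspan0.
have ha := hom_xwv S a n; clear hg.
elim: Gg => [e m ue ge bm we ->|_|f1 f2 G1 I1 G2 I2|c f1 G1 I1]; last first.
- by rewrite brZr ?(goodspan_hom G1) //; [apply: goodspanZ|apply: goodspan_hom G1].
- by rewrite brDr //; [apply: goodspanD|apply: goodspan_hom G1|apply: goodspan_hom G2].
- by rewrite br0r //; apply: goodspan0.
have [nm|mn] := leqP n m.
  apply: goodspan_weaken (goodspan_br_words ua ga ue ge nm); first lia.
  exact: lerD.
rewrite brC //; last exact: hom_xwv.
apply/goodspan_opp/goodspanZ; rewrite addbC.
apply: goodspan_weaken (goodspan_br_words ue ge ua ga (ltnW mn)); first lia.
by rewrite addrC lerD.
Qed.

End GoodBracket.

(** * Spanning lists *)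

Section SpanLists.
Variables (K : fieldType) (R : algType K).

Inductive lspan (P : R -> Prop) : R -> Prop :=
| lspan_in f : P f -> lspan P f
| lspan0 : lspan P 0
| lspanD f g : lspan P f -> lspan P g -> lspan P (f + g)
| lspanZ c f : lspan P f -> lspan P (c *: f).

Lemma lspan_opp P f : lspan P f -> lspan P (- f).
Proof. by rewrite -scaleN1r; apply: lspanZ. Qed.

Lemma lspan_map (P Q : R -> Prop) z f : (forall g, P g -> lspan Q (z * g)) ->
  lspan P f -> lspan Q (z * f).
Proof.
move=> H; elim=> [g /H//||g h _ ? _ ?|c g _ ?].
- by rewrite mulr0; apply: lspan0.
- by rewrite mulrDr; apply: lspanD.
- by rewrite -scalerAr; apply: lspanZ.
Qed.

Lemma lspan_trans (P Q : R -> Prop) f : (forall g, P g -> lspan Q g) ->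
  lspan P f -> lspan Q f.
Proof.
by move=> H Pf; rewrite -[f]mul1r; apply: lspan_map Pf => g /H; rewrite mul1r.
Qed.

Lemma lspan_mulr (P Q : R -> Prop) z f : (forall g, P g -> lspan Q (g * z)) ->
  lspan P f -> lspan Q (f * z).
Proof.
move=> H; elim=> [g /H//||g h _ ? _ ?|c g _ ?].
- by rewrite mul0r; apply: lspan0.
- by rewrite mulrDl; apply: lspanD.
- by rewrite -scalerAl; apply: lspanZ.
Qed.

Lemma lspan_seq (l : seq R) f : lspan (fun g => g \in l) f ->
  exists c : nat -> K, f = \sum_(k < size l) c k *: l`_k.
Proof.
elim=> [g gl||g h _ [c ->] _ [c' ->]|a g _ [c ->]].
- exists (fun k => (k == index g l)%:R); have lt : (index g l < size l)%N by rewrite index_mem.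
  rewrite (bigD1 (Ordinal lt)) //= eqxx scale1r nth_index // big1 ?addr0 // => k ne.
  by case: eqP => [E|_]; [case/eqP: ne; apply: val_inj|rewrite scale0r].
- by exists (fun=> 0); rewrite big1 // => k _; rewrite scale0r.
- exists (fun k => c k + c' k); rewrite -big_split; apply: eq_bigr => k _.
  by rewrite scalerDl.
- exists (fun k => a * c k); rewrite scaler_sumr; apply: eq_bigr => k _.
  by rewrite scalerA.
Qed.

(** The products of an ordered subfamily of [zs] with an element of [l]. If [zs] anticommutes and
    squares to zero, their span is stable under left multiplication by [zs]. *)
Fixpoint extlist (zs : seq R) (l : seq R) : seq R :=
  if zs is z :: zs' then extlist zs' l ++ [seq z * f | f <- extlist zs' l] else l.

Lemma size_extlist zs l : size (extlist zs l) = (2 ^ size zs * size l)%N.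
Proof.
elim: zs => [|z zs IH] /=; first by rewrite mul1n.
by rewrite size_cat size_map IH expnS -mulnDl mul2n addnn.
Qed.

Lemma extlist_base zs l f : f \in l -> f \in extlist zs l.
Proof. by move=> fl; elim: zs => //= z zs IH; rewrite mem_cat IH. Qed.

Lemma extlist_closed zs l z f :
  {in zs &, forall y y', y * y' = - (y' * y)} -> {in zs, forall y, y * y = 0} ->
  z \in zs -> lspan (fun g => g \in extlist zs l) f ->
  lspan (fun g => g \in extlist zs l) (z * f).
Proof.
elim: zs z f => // y zs IH z f anti sq; rewrite inE => zzs fS.
have sub g : lspan (fun h => h \in extlist zs l) g ->
    lspan (fun h => h \in extlist (y :: zs) l) g.
  by apply: lspan_trans => h hl; apply: lspan_in; rewrite /= mem_cat hl.
have suby g : lspan (fun h => h \in extlist zs l) g ->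
    lspan (fun h => h \in extlist (y :: zs) l) (y * g).
  apply: lspan_map => h hl; apply: lspan_in; rewrite /= mem_cat; apply/orP; right.
  by apply/mapP; exists h.
have y0 : y \in y :: zs by rewrite inE eqxx.
have anti' : {in zs &, forall y y', y * y' = - (y' * y)}.
  by move=> a b az bz; apply: anti; rewrite inE ?az ?bz orbT.
have sq' : {in zs, forall y, y * y = 0} by move=> a az; apply: sq; rewrite inE az orbT.
apply: lspan_map fS => g; rewrite /= mem_cat => /orP[gl|/mapP[h hl ->]].
  case/orP: zzs => [/eqP->|zz]; first by apply/suby/lspan_in.
  by apply: sub; apply: IH => //; apply: lspan_in.
case/orP: zzs => [/eqP->|zz].
  by rewrite mulrA sq // mul0r; apply: lspan0.
rewrite mulrA (anti z y) ?inE ?zz ?eqxx ?orbT // mulNr -mulrA; apply: lspan_opp.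
by apply/suby/IH => //; apply: lspan_in.
Qed.

End SpanLists.

(** * Growth bounds in the abstract setting *)

Section Growth.
Variables (K : fieldType) (R : algType K) (S : superalg R).
Local Notation x := (x S).
Local Notation v := (v S).
Local Notation hom := (hom S).
Local Notation br := (br S).
Local Notation xw := (xw S).
Variables (F : realFieldType) (lam : F).
Hypotheses (lam3 : lam ^+ 3 = lam + 2%:R) (lam_gt : 3%:R / 2%:R < lam).
Local Notation pw n := (lam ^+ n).
Local Notation wsum := (wsum lam).
Local Notation wt := (weight lam).
Local Notation goodspan := (goodspan S lam).
Local Notation wconst := (wconst lam).

Lemma pw_lt m n : (pw m < pw n) = (m < n)%N.
Proof. by rewrite ltr_eXn2l //; have := lam_gt; lra. Qed.

Lemma good_index_le N w a n : w < wconst * pw N.+1 -> uniq a -> good a n ->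
  wt a n <= w -> (n <= N)%N.
Proof.
move=> lw ua ga wa; rewrite -ltnS -pw_lt -(ltr_pM2l (wconst_gt0 lam_gt)).
by apply: le_lt_trans lw; apply: le_trans wa; apply: good_weight.
Qed.

(** * Upper bound for operators: sorting products *)

Section Associative.
Hypothesis brE : forall p q f g, br p q f g = f * g - sg (p && q) *: (g * f).
(** In characteristic 2 the bracket of [v n] with itself vanishes and says nothing about this
    square, hence a separate relation. *)
Hypothesis v_sqr : forall n, v n * v n = x n.+1 * v n.+3.

(** Normal form: combinations of products of good words with strictly increasing indices, the first
    one at least [m], and total weight at most [w]. Strictness is what leaves only [2 ^ (N+1)]
    products of the [v i]. *)
Inductive sortspan : nat -> F -> R -> Prop :=
| sortspan1 m w : 0 <= w -> sortspan m w 1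
| sortspan_cons m w w' a n f : uniq a -> good a n -> (m <= n)%N -> wt a n + w' <= w ->
    sortspan n.+1 w' f -> sortspan m w (xw a * v n * f)
| sortspan0 m w : 0 <= w -> sortspan m w 0
| sortspanD m w f g : sortspan m w f -> sortspan m w g -> sortspan m w (f + g)
| sortspanZ m w c f : sortspan m w f -> sortspan m w (c *: f).

Lemma sortspan_ge0 m w f : sortspan m w f -> 0 <= w.
Proof.
elim=> // {}m {}w w' a n g ua ga _ wa _ w0; apply: le_trans wa.
by rewrite addr_ge0 // (weight_ge0 lam3 lam_gt).
Qed.

Lemma sortspan_weaken m m' w w' f : (m' <= m)%N -> w <= w' ->
  sortspan m w f -> sortspan m' w' f.
Proof.
move=> lm lw H; elim: H m' w' lm lw => {m w f}
  [m w w0|m w w1 a n f ua ga mn wa Hf _|m w w0|m w f g _ If _ Ig|m w c f _ If] m' w' lm lw.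
- by apply: sortspan1; apply: le_trans lw.
- apply: sortspan_cons Hf => //; first exact: leq_trans mn.
  exact: le_trans lw.
- by apply: sortspan0; apply: le_trans lw.
- by apply: sortspanD; [apply: If|apply: Ig].
- by apply: sortspanZ; apply: If.
Qed.

Lemma v_xw n e : {in e, forall i, i < n}%N ->
  v n * xw e = sg (odd (size e)) *: (xw e * v n).
Proof.
elim: e => [|i e IH] H; first by rewrite xwE mulr1 mul1r /sg expr0 scale1r.
rewrite xwE mulrA vxC ?H ?inE ?eqxx // mulNr -(mulrA (x i) (v n)) IH; last first.
  by move=> j je; apply: H; rewrite inE je orbT.
rewrite -scalerAr mulrA -scaleNr /=; congr (_ *: _); rewrite /sg.
by case: odd; rewrite ?expr0 ?expr1 ?opprK.
Qed.

Lemma sortspan_lift m w f : 0 <= w ->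
  (forall a n, uniq a -> good a n -> sortspan (minn n m) (wt a n + w) (xw a * v n * f)) ->
  forall b w' p r, goodspan b w' p r -> sortspan (minn b m) (w' + w) (r * f).
Proof.
move=> w0 H b w' p r; elim=> [a n ua ga bn wa _|w'0|r1 r2 _ I1 _ I2|c r1 _ I1].
- apply: sortspan_weaken (H a n ua ga); first lia.
  by rewrite lerD2r.
- by rewrite mul0r; apply: sortspan0; rewrite addr_ge0.
- by rewrite mulrDl; apply: sortspanD.
- by rewrite -scalerAl; apply: sortspanZ.
Qed.

(** Insertion of a word into a sorted product. Every correction term, bracket or square, is again a
    good element of no smaller index multiplying the shorter tail, so induction on the tail
    suffices; [sortspan_lift] extends the hypothesis from words to their combinations. *)
Lemma sortspan_mul_word m w f : sortspan m w f -> forall a n, uniq a -> good a n ->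
  sortspan (minn n m) (wt a n + w) (xw a * v n * f).
Proof.
elim=> {m w f}
  [m w w0|m w w' e k f ue ge mk we Hf IH|m w w0|m w f g _ If _ Ig|m w c f _ If] a n ua ga.
- by apply: (sortspan_cons ua ga (w' := w)) => //; [lia|apply: sortspan1].
- have w'0 := sortspan_ge0 Hf; have L := sortspan_lift w'0 IH.
  have wa := weight_ge0 lam3 lam_gt ua ga; have we0 := weight_ge0 lam3 lam_gt ue ge.
  have [lt|gt|E] := ltngtP n k.
  + apply: (sortspan_cons ua ga (w' := w)) => //; first lia.
    exact: sortspan_cons Hf.
  + have -> : xw a * v n * (xw e * v k * f) =
        sg (~~ odd (size a) && ~~ odd (size e)) *: (xw e * v k * (xw a * v n * f))
        + br (~~ odd (size a)) (~~ odd (size e)) (xw a * v n) (xw e * v k) * f.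
      rewrite brE mulrBl [X in _ + (_ - X)](_ : _ =
        sg (~~ odd (size a) && ~~ odd (size e)) *: (xw e * v k * (xw a * v n * f))).
        by rewrite addrC subrK !mulrA.
      by rewrite -scalerAl !mulrA.
    apply: sortspanD.
      apply: sortspanZ; apply: (sortspan_cons ue ge (w' := wt a n + w')); first lia.
        by rewrite addrCA lerD2l.
      by apply: sortspan_weaken (IH a n ua ga); lia || exact: lexx.
    have G := goodspan_br lam3 lam_gt (goodspan_word S ua ga (leqnn n) (lexx _) erefl)
      (goodspan_word S ue ge (leqnn k) (lexx (wt e k)) erefl).
    apply: sortspan_weaken (L _ _ _ _ G); first lia.
    by rewrite -addrA lerD2l.
  (* Equal indices are merged by the square relation. The new index is [n+3]; its letters are [n+1]
     and letters at most [n-2], so [n] is absent and the word is good. *)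
  + subst k; have -> : xw a * v n * (xw e * v n * f) = sg (odd (size e)) *:
        (xw (a ++ e ++ [:: n.+1]) * v n.+3 * f).
      rewrite !mulrA -(mulrA (xw a)) v_xw; last by move=> i /ge.1; lia.
      rewrite -scalerAr -!scalerAl; congr (_ *: (_ * _)).
      by rewrite -!mulrA v_sqr !xwE mulr1 !mulrA.
    apply: sortspanZ.
    have G : goodspan n.+3 (wt a n + wt e n) (~~ odd (size (a ++ e ++ [:: n.+1])))
        (xw (a ++ e ++ [:: n.+1]) * v n.+3).
      apply: goodspan_any_word => //; last 2 first.
      * exact: addr_ge0.
      * by rewrite /weight !wsumE (pw3 lam3); lra.
      split=> [i|i [E]]; rewrite !mem_cat !inE.
        by case/or3P => [/ga.1|/ge.1|/eqP->]; lia.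
      move=> _; apply/negP => /or3P[/ga.1|/ge.1|/eqP]; lia.
    apply: sortspan_weaken (L _ _ _ _ G); first lia.
    by rewrite -addrA lerD2l.
- by rewrite mulr0; apply: sortspan0; rewrite addr_ge0 // (weight_ge0 lam3 lam_gt).
- by rewrite mulrDr; apply: sortspanD; [apply: If|apply: Ig].
- by rewrite -scalerAr; apply: sortspanZ; apply: If.
Qed.

Lemma good_nil n : good [::] n. Proof. by []. Qed.

Lemma sortspan_gen w i f : (i < 3)%N -> sortspan 0 w f ->
  sortspan 0 (lam ^+ 2 + w) (v i * f).
Proof.
move=> i3 H; have := sortspan_mul_word H (a := [::]) (n := i) isT (@good_nil i).
rewrite xwE mul1r minn0; apply: sortspan_weaken => //.
rewrite lerD2r /weight wsumE subr0 ler_eXn2l; first lia.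
by have := lam_gt; lra.
Qed.

Section UpperList.
Variable N : nat.

Definition vlist n : seq R := extlist [seq v i | i <- iota n (N.+1 - n)] [:: 1].

Definition xvspan n : R -> Prop := lspan (fun g =>
  exists a u, [/\ {in a, forall i, i <= N}%N, u \in vlist n & g = xw a * u]).

Lemma vlist_rec n : (n <= N)%N -> vlist n = vlist n.+1 ++ [seq v n * f | f <- vlist n.+1].
Proof. by move=> nN; rewrite /vlist (subSn nN) /= subSS. Qed.

Lemma xvspan_xw n a f : {in a, forall i, i <= N}%N -> xvspan n f -> xvspan n (xw a * f).
Proof.
move=> aN; apply: lspan_map => g [e [u [eN ul ->]]]; apply: lspan_in.
exists (a ++ e), u; split=> //; last by rewrite xwE mulrA.
by move=> i; rewrite mem_cat => /orP[/aN|/eN].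
Qed.

Lemma xvspan_x n j f : (j <= N)%N -> xvspan n f -> xvspan n (x j * f).
Proof.
move=> jN; rewrite -[x j]mulr1 -(xw_nil S) -xw_cons; apply: xvspan_xw => i.
by rewrite inE => /eqP->.
Qed.

(** Moving [v n] to the right past [x j] leaves the bracket of the two, which is a word in the [x i]
    alone. So all letters can be gathered on the left without creating a new [v]. *)
Lemma xvspan_v n f : (n <= N)%N -> xvspan n.+1 f -> xvspan n (v n * f).
Proof.
move=> nN; apply: lspan_map => g [a [u [aN ul ->]]].
have sub h : xvspan n.+1 h -> xvspan n h.
  apply: lspan_trans => {}h [e [u' [eN ul' ->]]]; apply: lspan_in.
  by exists e, u'; split; rewrite // (vlist_rec nN) mem_cat ul'.
elim: a aN => [|j a IH] aN.
  apply: lspan_in; exists [::], (v n * u); split; rewrite ?xwE ?mul1r //.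
  by rewrite vlist_rec // mem_cat; apply/orP; right; apply: map_f.
have aN' : {in a, forall i, i <= N}%N by move=> i ia; apply: aN; rewrite inE ia orbT.
have jN : (j <= N)%N by apply: aN; rewrite inE eqxx.
have E : v n * x j = br true true (v n) (x j) - x j * v n.
  by rewrite brE /sg expr1 scaleN1r opprK addrK.
rewrite xwE !mulrA E mulrBl -!mulrA mulrBl -!mulrA.
apply: lspanD; last by apply/lspan_opp/xvspan_x => //; apply: IH.
have au : xvspan n (xw a * u) by apply/sub/lspan_in; exists a, u.
have [->|[X [-> _ HX _ _]]] := brvxP S lam3 lam_gt n j.
  by rewrite mul0r; apply: lspan0.
by apply: xvspan_xw => // i /HX; lia.
Qed.

Lemma sortspan_xvspan m w f : w < wconst * pw N.+1 -> sortspan m w f -> xvspan m f.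
Proof.
move=> lw H; elim: H lw => {m w f}
  [m w w0|m w w' a n f ua ga mn wa Hf IH|m w w0|m w f g _ If _ Ig|m w c f _ If] lw.
- apply: lspan_in; exists [::], 1; split=> //; last by rewrite xwE mulr1.
  by apply: extlist_base; rewrite inE.
- have w'0 := sortspan_ge0 Hf; have wa0 := weight_ge0 lam3 lam_gt ua ga.
  have nN : (n <= N)%N by apply: good_index_le lw ua ga _; lra.
  have Hn : xvspan n (v n * f) by apply: xvspan_v => //; apply: IH; lra.
  suff Hm : xvspan m (v n * f).
    by rewrite -mulrA; apply: xvspan_xw => // i /ga.1; lia.
  (* The lists only grow when the starting index decreases, so one descends from [n] to [m]. *)
  apply: lspan_trans Hn => h [e [u [eN ul ->]]]; apply: lspan_in; exists e, u; split=> //.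
  elim: {mn}(n - m)%N {-2}m (subnKC mn) => [|k IHk] i; first by rewrite addn0 => ->.
  move=> E; have iN : (i <= N)%N by lia.
  by rewrite vlist_rec // mem_cat IHk //; lia.
- exact: lspan0.
- by apply: lspanD; [apply: If|apply: Ig].
- by apply: lspanZ; apply: If.
Qed.

Lemma sortspan_list : exists l : seq R, size l = (4 ^ N.+1)%N /\
  forall w f, w < wconst * pw N.+1 -> sortspan 0 w f -> lspan (fun g => g \in l) f.
Proof.
exists (extlist [seq x i | i <- iota 0 N.+1] (vlist 0)); split.
  rewrite /vlist !size_extlist !size_map !size_iota muln1 -expnMn.
  by congr expn.
move=> w f lw /(sortspan_xvspan lw); apply: lspan_trans => g [a [u [aN ul ->]]].
elim: a aN => [|j a IH] aN; first by rewrite xwE mul1r; apply/lspan_in/extlist_base.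
rewrite xwE -mulrA; apply: extlist_closed.
- by move=> _ _ /mapP[i _ ->] /mapP[k _ ->]; apply: xxC.
- by move=> _ /mapP[i _ ->]; apply: xx0.
- by apply: map_f; rewrite mem_iota /= add0n ltnS; apply: aN; rewrite inE eqxx.
- by apply: IH => i ia; apply: aN; rewrite inE ia orbT.
Qed.
End UpperList.
End Associative.

(** * Upper bound for a supercommutative product *)

Section Supercommutative.
Hypothesis mulC : forall p q f g, hom p f -> hom q g -> f * g = sg (p && q) *: (g * f).
Hypothesis v_sqr0 : forall n, v n * v n = 0.

(** No order on the factors is imposed here, since all [x i] and [v i] anticommute. The parity is
    recorded because the signs in the Leibniz rule depend on it. *)
Inductive prodspan : bool -> F -> R -> Prop :=
| prodspan_good w p f : goodspan 0 w p f -> prodspan p w f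
| prodspanM p q s w w' w'' f g : s = p (+) q -> w + w' <= w'' ->
    prodspan p w f -> prodspan q w' g -> prodspan s w'' (f * g)
| prodspanD p w f g : prodspan p w f -> prodspan p w g -> prodspan p w (f + g)
| prodspanZ p w c f : prodspan p w f -> prodspan p w (c *: f).

Lemma prodspan0 p w : 0 <= w -> prodspan p w 0.
Proof. by move=> w0; apply/prodspan_good/goodspan0. Qed.

Lemma prodspan_hom p w f : prodspan p w f -> hom p f.
Proof.
elim=> [? ? ? /goodspan_hom//|? ? ? ? ? ? ? ? -> _ _ ? _ ?|? ? ? ? _ ? _ ?|? ? ? ? _ ?].
- exact: homM. - exact: homD. - exact: homZ.
Qed.

Lemma prodspan_ge0 p w f : prodspan p w f -> 0 <= w.
Proof.
elim=> [? ? ? H|? ? ? ? ? ? ? ? _ le _ ? _ ?|//|//]; first exact: (goodspan_ge0 lam3 lam_gt H).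
by apply: le_trans le; apply: addr_ge0.
Qed.

Lemma prodspan_weaken p w w' f : w <= w' -> prodspan p w f -> prodspan p w' f.
Proof.
move=> lw H; elim: H w' lw => {p w f}
  [w p f G|p q s w1 w2 w f g -> le Hf _ Hg _|p w f g _ If _ Ig|p w c f _ If] w' lw.
- by apply: prodspan_good; apply: goodspan_weaken G.
- by apply: prodspanM Hf Hg => //; apply: le_trans lw.
- by apply: prodspanD; [apply: If|apply: Ig].
- by apply: prodspanZ; apply: If.
Qed.

Lemma prodspan_br p q w w' f g : prodspan p w f -> prodspan q w' g ->
  prodspan (p (+) q) (w + w') (br p q f g).
Proof.
move=> Hf; elim: Hf q w' g => {p w f}
  [w p f G|p1 p2 p w1 w2 w f1 f2 -> le H1 I1 H2 I2|p w f1 f2 H1 I1 H2 I2|p w c f Hf If] q w' g Hg.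
- have hf := goodspan_hom G; elim: Hg => {q w' g}
    [w' q g G'|q1 q2 q w1 w2 w' g1 g2 -> le H1 I1 H2 I2|q w' g1 g2 H1 I1 H2 I2|q w' c g Hg Ig].
  + apply: prodspan_good; apply: goodspan_weaken (goodspan_br lam3 lam_gt G G') => //.
  + have h1 := prodspan_hom H1; have h2 := prodspan_hom H2.
    rewrite (brMr (q := q1) (r := q2)) //; apply: prodspanD.
      apply: (prodspanM _ _ I1 H2); first by rewrite addbA.
      by rewrite -addrA lerD2l.
    apply: prodspanZ; apply: (prodspanM _ _ H1 I2); first by rewrite addbCA.
    by rewrite addrCA lerD2l.
  + by rewrite brDr ?(prodspan_hom H1) ?(prodspan_hom H2) //; [apply: prodspanD|exact: prodspan_hom H1|exact: prodspan_hom H2].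
  + by rewrite brZr //; [apply: prodspanZ|exact: prodspan_hom Hg].
- have h1 := prodspan_hom H1; have h2 := prodspan_hom H2; have hg := prodspan_hom Hg.
  rewrite (brMl (p := p1) (q := p2)) //; apply: prodspanD.
    apply: (prodspanM _ _ H1 (I2 _ _ _ Hg)); first by rewrite addbA.
    by rewrite addrA lerD2r.
  apply: prodspanZ; apply: (prodspanM _ _ (I1 _ _ _ Hg) H2); first by rewrite addbAC.
  by rewrite addrAC lerD2r.
- rewrite brDl; [|exact: prodspan_hom H1|exact: prodspan_hom H2|exact: prodspan_hom Hg].
  by apply: prodspanD; [apply: I1|apply: I2].
- rewrite brZl; [|exact: prodspan_hom Hf|exact: prodspan_hom Hg].
  by apply: prodspanZ; apply: If.
Qed.

Lemma prodspan_list N : exists l : seq R, size l = (4 ^ N.+1)%N /\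
  forall p w f, w < wconst * pw N.+1 -> prodspan p w f -> lspan (fun g => g \in l) f.
Proof.
pose zs := [seq x i | i <- iota 0 N.+1] ++ [seq v i | i <- iota 0 N.+1].
have zhom z : z \in zs -> hom true z.
  by rewrite mem_cat => /orP[] /mapP[i _ ->]; [apply: homx|apply: homv].
have zanti : {in zs &, forall y y', y * y' = - (y' * y)}.
  by move=> y y' /zhom hy /zhom hy'; rewrite (mulC hy hy') /sg expr1 scaleN1r.
have zsq : {in zs, forall y, y * y = 0}.
  by move=> y; rewrite mem_cat => /orP[] /mapP[i _ ->]; rewrite ?xx0 ?v_sqr0.
exists (extlist zs [:: 1]); split.
  rewrite size_extlist size_cat !size_map size_iota muln1 addnn -mul2n expnM.
  by congr expn.
pose L := lspan (fun g => g \in extlist zs [:: 1]); rewrite -/L.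
have Lx i f : (i <= N)%N -> L f -> L (x i * f).
  move=> iN; apply: extlist_closed => //; rewrite mem_cat map_f // mem_iota; lia.
have Lv i f : (i <= N)%N -> L f -> L (v i * f).
  move=> iN; apply: extlist_closed => //; rewrite mem_cat orbC map_f // mem_iota; lia.
(* Strengthened to left multiplication on [L], so that a product is treated one factor at a time. *)
suff H p w f : prodspan p w f -> w < wconst * pw N.+1 -> forall g, L g -> L (f * g).
  move=> p w f lw Hf; rewrite -[f]mulr1; apply: H Hf lw _ _.
  by apply: lspan_in; apply: extlist_base; rewrite inE.
elim=> {p w f} [w p f G|p q s w1 w2 w f g _ le Hf If Hg Ig|p w f g _ If _ Ig|p w c f _ If] lw h Lh.
- elim: G => [a n ua ga _ wa _|w0|f1 f2 _ I1 _ I2|c f1 _ I1].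
  + have nN := good_index_le lw ua ga wa.
    have : {in a, forall i, i <= N}%N by move=> i /ga.1; lia.
    rewrite -mulrA; elim: (a) => [|i e IH] H; first by rewrite xwE mul1r; apply: Lv.
    rewrite xwE -mulrA; apply: Lx; first by apply: H; rewrite inE eqxx.
    by apply: IH => j je; apply: H; rewrite inE je orbT.
  + by rewrite mul0r; apply: lspan0.
  + by rewrite mulrDl; apply: lspanD.
  + by rewrite -scalerAl; apply: lspanZ.
- have w10 := prodspan_ge0 Hf; have w20 := prodspan_ge0 Hg.
  by rewrite -mulrA; apply: If; [lra|apply: Ig => //; lra].
- by rewrite mulrDl; apply: lspanD; [apply: If|apply: Ig].
- by rewrite -scalerAl; apply: lspanZ; apply: If.
Qed.
End Supercommutative.

(** * Lower bound: elements of controlled degree *)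

(** Up to sign, a single iterated product and bracket of generators with at most [t] occurrences.
    Sums are excluded so that in the Poisson case the element is, up to sign, one of the monomials
    counted. The bound lies in [F] so that weights can be used as degrees. *)
Inductive deg : bool -> F -> R -> Prop :=
| deg_gen i t : (i < 3)%N -> 1 <= t -> deg true t (v i)
| degM p q s t t' t'' f g : s = p (+) q -> t + t' <= t'' ->
    deg p t f -> deg q t' g -> deg s t'' (f * g)
| deg_br p q s t t' t'' f g : s = p (+) q -> t + t' <= t'' ->
    deg p t f -> deg q t' g -> deg s t'' (br p q f g)
| degN p t f : deg p t f -> deg p t (- f).

Lemma deg_sg e p t f : deg p t (sg e *: f) -> deg p t f.
Proof.
by case: e; rewrite /sg ?expr0 ?scale1r // expr1 scaleN1r => /degN; rewrite opprK.
Qed.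

Lemma br_d_xw i a : i \notin a -> br true (odd (size a)) (d S i) (xw a) = 0.
Proof.
elim: a => [|j a IH]; first by rewrite xwE br_1r //; apply: hom_d.
rewrite inE => /norP[ij ia]; rewrite xwE (brMr (q := true) (r := odd (size a))) //.
- by rewrite brdx (negPf ij) IH // mul0r mulr0 scaler0 addr0.
- exact: hom_d. - exact: homx. - exact: hom_xw.
Qed.

(** [v i] pairs with the leading [x i] to 1. In the other Leibniz term [d i] gives 0, and the tail
    of [v i] starts with [x i], which squares to zero. *)
Lemma br_delete i a n : i \notin a -> (i < n)%N ->
  br true (odd (size a)) (v i) (xw (i :: a) * v n) = xw a * v n.
Proof.
move=> ia lt; have hv := homv S; have hx := homx S.
have hg := hom_xwv S a n; have hd := hom_d S i.
have hxv : hom false (x i.+1 * v i.+3) by apply: (homM (hx _) (hv _)).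
rewrite xwE -mulrA (brMr (q := true) (r := ~~ odd (size a))) //; last by rewrite /= negbK.
rewrite brxvv mul1r.
rewrite [X in br _ _ X (xw a * v n)]v_rec brDl //; last exact: hom_xxv.
rewrite -mulrA (brMl (p := true) (q := false)) // br_x_xwv // mul0r scaler0 addr0.
rewrite (brMr (q := odd (size a)) (r := true)) ?addbT // ?br_d_xw ?brdv //; last exact: hom_xw.
by rewrite mulr0 mul0r scaler0 addr0 add0r mulrA xx0 mul0r scaler0 addr0.
Qed.

(** Up to sign, [v_(k+3)] is the bracket of [v_k] with the bracket of [v_k] and [v_(k+1)]; the
    degrees add up to [2 lam^k + lam^(k+1) = lam^(k+3)]. *)
Lemma deg_v n : deg true (pw n) (v n).
Proof.
elim/ltn_ind: n => n IH; have [n3|n3] := ltnP n 3.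
  apply: deg_gen => //; apply: exprn_ege1; by have := lam_gt; lra.
have -> : n = (n - 3).+3 by lia.
move: (n - 3)%N (leq_subr 3 n) (subnK n3) => k _ kn.
have <- : br true false (v k) (xw [:: k] * v k.+3) = v k.+3.
  by have := @br_delete k [::] k.+3; rewrite xw_nil mul1r; apply => //; lia.
have -> : xw [:: k] * v k.+3 = - br true true (v k) (v k.+1).
  by rewrite brvv_S opprK !xwE mulr1.
apply: (deg_br (p := true) (q := false) (t := pw k) (t' := pw k + pw k.+1)) => //.
- by rewrite (pw3 lam3); lra.
- by apply: IH; lia.
apply: degN; apply: (deg_br (p := true) (q := true) (t := pw k) (t' := pw k.+1)) => //.
- by apply: IH; lia.
- by apply: IH; lia.
Qed.

(** With [m = 3 q], bracketing with [v_(m+1)] leaves the letters up to [m] alone and turns [v_(m+3)]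
    into [x_(m+1) x_(m+2) x_(m+3) v_(m+6)] up to sign. Homogeneity makes the degree equal to the
    weight at each step. *)
Lemma deg_full q : let a := iota 0 (3 * q).+1 in
  deg (~~ odd (size a)) (wt a (3 * q).+3) (xw a * v (3 * q).+3).
Proof.
elim: q => [|q IH]; cbv zeta.
  rewrite muln0 /=; have -> : xw [:: 0%N] * v 3 = - br true true (v 0) (v 1).
    by rewrite brvv_S opprK !xwE mulr1.
  apply: degN; apply: (deg_br (p := true) (q := true) (t := pw 0) (t' := pw 1)) => //.
  - by rewrite /weight !wsumE (pw3 lam3); lra.
  - exact: deg_v.
  - exact: deg_v.
set m := (3 * q)%N in IH *; have -> : (3 * q.+1)%N = m.+3 by rewrite /m; lia.
move: IH; set a := iota 0 m.+1; set p := ~~ odd (size a) => IH.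
have ha := hom_xw S a; have iE : iota 0 m.+4 = a ++ [:: m.+1; m.+2; m.+3].
  by rewrite /a -(addn3 m.+1) iotaD.
have E : br true p (v m.+1) (xw a * v m.+3) =
    - (sg (true && ~~ p) *: (xw (iota 0 m.+4) * v m.+1.+1.+4)).
  rewrite (brMr (q := ~~ p) (r := true)) ?addbT ?negbK //; try exact: homv.
  rewrite br_v_xw0; last by move=> i; rewrite mem_iota.
  rewrite mul0r add0r brvv_2 mulrN scalerN.
  by rewrite iE !xwE mulr1 !mulrA.
have : deg (~~ p) (wt (iota 0 m.+4) m.+1.+1.+4) (br true p (v m.+1) (xw a * v m.+3)).
  apply: (deg_br (p := true) (q := p) (t := pw m.+1) (t' := wt a m.+3)) => //; last exact: deg_v.
  rewrite iE /weight !wsumE (pw3 lam3 m.+3) (pw3 lam3 m.+1); lra.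
rewrite E => /degN; rewrite opprK => /deg_sg.
by rewrite /p !size_iota /= !negbK.
Qed.

Lemma deg_delete p t a n i : i \in a -> uniq a -> (i < n)%N -> p = ~~ odd (size a) ->
  deg p t (xw a * v n) -> deg (~~ p) (t + pw i) (xw (rem i a) * v n).
Proof.
move=> ia ua lt pE H; have sz : size a = (size (rem i a)).+1.
  by rewrite size_rem // prednK //; case: (a) ia.
have ina : i \notin rem i a by rewrite mem_rem_uniq // inE eqxx.
have {}H : deg p t (xw (i :: rem i a) * v n).
  have [e E] := xw_rem S ia; apply: (@deg_sg e); move: H.
  by rewrite E -scalerAl xwE.
rewrite -(br_delete ina lt).
have -> : odd (size (rem i a)) = p by rewrite pE sz /= negbK.
apply: (deg_br (p := true) (q := p) (t := pw i) (t' := t)) => //; first by rewrite addrC.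
exact: deg_v.
Qed.

(** The unwanted letters are deleted from the full word in increasing order; deleting [i] costs
    [lam^i], exactly the gain in weight. In [A k] the deletions below [k] have been made. *)
Lemma deg_word q (P : pred nat) : let a := [seq i <- iota 0 (3 * q).+1 | P i] in
  deg (~~ odd (size a)) (wt a (3 * q).+3) (xw a * v (3 * q).+3).
Proof.
set m := (3 * q).+1; pose A k := [seq i <- iota 0 m | P i || (k <= i)%N].
have AP k : deg (~~ odd (size (A k))) (wt (A k) m.+2) (xw (A k) * v m.+2).
  elim: k => [|k IH].
    have -> : A 0%N = iota 0 m.
      by rewrite /A -[RHS]filter_predT; apply: eq_filter => i; rewrite leq0n orbT.
    exact: deg_full.
  have uA : uniq (A k) by rewrite filter_uniq // iota_uniq.
  have AS : A k.+1 = [seq i <- A k | P i || (i != k)].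
    rewrite /A -filter_predI; apply: eq_filter => i /=; case: (P i) => //=; lia.
  have [kA|kA] := boolP ((k \in A k) && ~~ P k); last first.
    suff -> : A k.+1 = A k by [].
    rewrite AS; apply/all_filterP/allP => i iA.
    have [E|_] := eqVneq i k; rewrite ?orbT // orbF E.
    by rewrite E in iA; rewrite iA /= negbK in kA.
  case/andP: kA => kA Pk.
  have E : A k.+1 = rem k (A k).
    rewrite AS rem_filter //; apply: eq_in_filter => i iA /=.
    by have [->|] := eqVneq i k; rewrite ?(negPf Pk) ?orbT.
  have lt : (k < m.+2)%N by move: kA; rewrite mem_filter mem_iota; lia.
  have := deg_delete kA uA lt erefl IH; rewrite -E negbK.
  have sz : size (A k) = (size (A k.+1)).+1.
    by rewrite E size_rem // prednK //; case: (A k) kA.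
  rewrite [X in deg _ X _](_ : _ = wt (A k.+1) m.+2); first by rewrite sz.
  have WE : wsum (A k) = pw k + wsum (rem k (A k)).
    by rewrite -wsumE; apply: perm_big; apply: perm_to_rem.
  by rewrite /weight E WE; ring.
have := AP m; rewrite [A m](_ : _ = [seq i <- iota 0 m | P i]) //.
by apply: eq_in_filter => i; rewrite mem_iota => H; case: (P i) => //=; lia.
Qed.

Definition vw (b : seq nat) : R := \prod_(i <- b) v i.
Lemma vw_cons i b : vw (i :: b) = v i * vw b. Proof. exact: big_cons. Qed.

(** The constant 3 is 1 + 2: the word has weight at most [lam^n], and the geometric sum over [b] is
    at most [lam^n / (lam - 1)], below [2 lam^n] because [lam > 3/2]. *)
Lemma deg_basis q (P : pred nat) b : uniq b -> {in b, forall i, i < (3 * q).+3}%N ->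
  exists p, deg p (3%:R * pw (3 * q).+3)
    (xw [seq i <- iota 0 (3 * q).+1 | P i] * v (3 * q).+3 * vw b).
Proof.
move=> ub bn; set n := (3 * q).+3; set a := filter _ _.
have H c p t f : deg p t f -> exists p', deg p' (t + wsum c) (f * vw c).
  elim: c p t f => [|i c IH] p t f Hf.
    by exists p; rewrite /vw big_nil mulr1 wsumE addr0.
  rewrite vw_cons mulrA wsumE addrA.
  by apply: (IH (p (+) true)); apply: degM (deg_v i).
have [p Hp] := H b _ _ _ (deg_word q P); exists p; move: Hp.
have le : wt a n + wsum b <= 3%:R * pw n.
  have a0 : 0 <= wsum a by apply: sumr_ge0 => i _; rewrite ltW // (pw_gt0 lam_gt).
  have bs : wsum b <= wsum (iota 0 n).
    by apply: (wsum_subset lam_gt) => // i /bn; rewrite mem_iota.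
  have := wsum_iota lam n; have := lam_gt; have := pw_gt0 lam_gt n.
  rewrite /weight; move: (wsum a) (wsum b) (wsum (iota 0 n)) a0 bs => s1 s2 s3 *; nra.
have W p' t t' f : t <= t' -> deg p' t f -> deg p' t' f.
  move=> tt' Hf; elim: Hf t' tt' => {p' t f}
    [i t i3 t1|p1 p2 s t1 t2 t f g -> le' H1 _ H2 _|p1 p2 s t1 t2 t f g -> le' H1 _ H2 _|p1 t f _ If] t' tt'.
  - by apply: deg_gen => //; apply: le_trans tt'.
  - by apply: degM H1 H2 => //; apply: le_trans tt'.
  - by apply: deg_br H1 H2 => //; apply: le_trans tt'.
  - by apply: degN; apply: If.
exact: W.
Qed.

End Growth.

(** * Grassmann series *)

Section SeriesModule.
Variable K : fieldType.

HB.instance Definition _ := gen_eqMixin (ser K).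
HB.instance Definition _ := gen_choiceMixin (ser K).

Let addA : associative (fun f g : ser K => (fun T => f T + g T) : ser K).
Proof. by move=> f g h; apply: funext => T; apply: addrA. Qed.
Let addC : commutative (fun f g : ser K => (fun T => f T + g T) : ser K).
Proof. by move=> f g; apply: funext => T; apply: addrC. Qed.
Let add0 : left_id (fun=> 0 : K) (fun f g : ser K => (fun T => f T + g T) : ser K).
Proof. by move=> f; apply: funext => T; apply: add0r. Qed.
Let addN : left_inverse (fun=> 0 : K) (fun f : ser K => (fun T => - f T) : ser K)
  (fun f g : ser K => (fun T => f T + g T) : ser K).
Proof. by move=> f; apply: funext => T; apply: addNr. Qed.

HB.instance Definition _ := GRing.isZmodule.Build (ser K) addA addC add0 addN.

Let scA (a b : K) (f : ser K) : (fun T => a * (b * f T)) = (fun T => a * b * f T).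
Proof. by apply: funext => T; apply: mulrA. Qed.
Let sc1 (f : ser K) : (fun T => 1 * f T) = f.
Proof. by apply: funext => T; apply: mul1r. Qed.
Let scDr : right_distributive (fun (c : K) (f : ser K) => (fun T => c * f T) : ser K) +%R.
Proof. by move=> c f g; apply: funext => T; apply: mulrDr. Qed.
Let scDl (f : ser K) :
  {morph (fun (c : K) => (fun T => c * f T) : ser K) : a b / a + b >-> a + b}.
Proof. by move=> a b; apply: funext => T; apply: mulrDl. Qed.

HB.instance Definition _ := GRing.Zmodule_isLmodule.Build K (ser K) scA sc1 scDr scDl.
End SeriesModule.

Section Series.
Variable K : fieldType.
Implicit Types (f g h : ser K) (T A B : mono).

Lemma serD f g T : (f + g) T = f T + g T. Proof. by []. Qed.
Lemma serN f T : (- f) T = - f T. Proof. by []. Qed.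
Lemma serZ c f T : (c *: f) T = c * f T. Proof. by []. Qed.
Lemma ser0 T : (0 : ser K) T = 0. Proof. by []. Qed.
Lemma ser_sum (I : Type) (r : seq I) (P : pred I) (F : I -> ser K) T :
  (\sum_(i <- r | P i) F i) T = \sum_(i <- r | P i) F i T.
Proof. by elim/big_rec2: _ => // i a b _ <-. Qed.
Definition serE := (serD, serN, serZ, ser0, ser_sum).

Lemma sgnD a b : sgn K (a + b) = sgn K a * sgn K b. Proof. exact: exprD. Qed.
Lemma sgnS a : sgn K a.+1 = - sgn K a. Proof. by rewrite /sgn exprS mulN1r. Qed.
Lemma sgn0 : sgn K 0 = 1. Proof. exact: expr0. Qed.
Lemma sgn_sqr a : sgn K a * sgn K a = 1.
Proof. by rewrite -sgnD addnn -mul2n /sgn exprM sqrrN expr1n expr1n. Qed.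
Lemma sgn_odd a : sgn K a = sg (odd a). Proof. by rewrite /sg signr_odd. Qed.

Lemma perm_fset_split T A : A `<=` T -> perm_eq T (A ++ T `\` A).
Proof.
move=> AT; apply: uniq_perm; first exact: fset_uniq.
  rewrite cat_uniq !fset_uniq andbT; apply/hasPn => i /=.
  by rewrite in_fsetD => /andP[].
move=> i; rewrite mem_cat in_fsetD; case: (boolP (i \in A)) => //= iA.
exact: (fsubsetP AT).
Qed.

Lemma below_split T A j : A `<=` T -> below T j = (below A j + below (T `\` A) j)%N.
Proof. by move=> AT; rewrite /below (permP (perm_fset_split AT)) count_cat. Qed.

Lemma belowE T j : below T j = (\sum_(t <- T) (t < j)%N)%N.
Proof. by rewrite /below -sum1_count [RHS]big_mkcond /= -big_mkcond. Qed.

Lemma belowU1 T i j : i \notin T -> below (i |` T) j = ((i < j) + below T j)%N.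
Proof. by move=> iT; rewrite !belowE big_fsetU1. Qed.

Lemma belowD1 T i j : i \in T -> below T j = ((i < j) + below (T `\ i) j)%N.
Proof. by move=> iT; rewrite -{1}(fsetD1K iT) belowU1 // !inE eqxx. Qed.

Lemma ninvU1 A B j : j \notin A -> ninv (j |` A) B = (below B j + ninv A B)%N.
Proof. by move=> jA; rewrite /ninv big_fsetU1. Qed.

(** Left multiplication by the generator of index [j], as [gen_mul] confirms. *)
Definition xi (j : nat) f : ser K := fun T =>
  if j \in T then sgn K (below T j) * f (T `\ j) else 0.

Definition islin (Phi : ser K -> ser K) : Prop :=
  forall c f g, Phi (c *: f + g) = c *: Phi f + Phi g.

Lemma islinD Phi f g : islin Phi -> Phi (f + g) = Phi f + Phi g.
Proof. by move=> H; have := H 1 f g; rewrite !scale1r. Qed.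
Lemma islin0 Phi : islin Phi -> Phi 0 = 0.
Proof. by move=> H; have := H (-1) 0 0; rewrite scaler0 addr0 scaleN1r addNr. Qed.
Lemma islinZ Phi c f : islin Phi -> Phi (c *: f) = c *: Phi f.
Proof. by move=> H; have := H c f 0; rewrite (islin0 H) !addr0. Qed.
Lemma islinN Phi f : islin Phi -> Phi (- f) = - Phi f.
Proof. by move=> H; rewrite -scaleN1r (islinZ _ _ H) scaleN1r. Qed.
Lemma islinB Phi f g : islin Phi -> Phi (f - g) = Phi f - Phi g.
Proof. by move=> H; rewrite (islinD _ _ H) (islinN _ H). Qed.
Lemma islin_sum Phi (I : Type) (r : seq I) (P : pred I) (F : I -> ser K) : islin Phi ->
  Phi (\sum_(i <- r | P i) F i) = \sum_(i <- r | P i) Phi (F i).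
Proof.
move=> H; elim/big_rec2: _ => [|i a b _ <-]; first exact: islin0.
exact: islinD.
Qed.

Lemma xi_lin j : islin (xi j).
Proof.
move=> c f g; apply: funext => T; rewrite /xi !serE; case: ifP => _; ring.
Qed.

Lemma gder_lin j : islin (gder j).
Proof.
move=> c f g; apply: funext => T; rewrite /gder !serE; case: ifP => _; ring.
Qed.

Lemma gr_lin : islin (@grade_inv K).
Proof. by move=> c f g; apply: funext => T; rewrite /grade_inv !serE; ring. Qed.

Lemma gmul_linl g : islin (fun f => gmul f g).
Proof.
move=> c f f'; apply: funext => T; rewrite !serE /gmul mulr_sumr -big_split.
by apply: eq_bigr => A _; rewrite !serE /=; ring.
Qed.

Lemma gmul_linr g : islin (gmul g).
Proof.
move=> c f f'; apply: funext => T; rewrite !serE /gmul mulr_sumr -big_split.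
by apply: eq_bigr => A _; rewrite !serE /=; ring.
Qed.

Lemma gmul_locl f f' g T : (forall A, A `<=` T -> f A = f' A) -> gmul f g T = gmul f' g T.
Proof.
by move=> E; apply: eq_big_seq => A; rewrite fpowersetE => AT; rewrite E.
Qed.

Lemma gmul_locr f f' g T : (forall A, A `<=` T -> f A = f' A) -> gmul g f T = gmul g f' T.
Proof.
by move=> E; apply: eq_big_seq => A _; rewrite E // fsubsetDl.
Qed.

Lemma gmul_neq0 f g T : gmul f g T != 0 ->
  exists A, [/\ A `<=` T, f A != 0 & g (T `\` A) != 0].
Proof.
move=> H; apply: contrapT => N; case/eqP: H; rewrite /gmul big_seq big1 // => A.
rewrite fpowersetE => AT; apply/eqP; rewrite !mulf_eq0; apply/negPn/negP.
by rewrite !negb_or => /andP[/andP[_ fA] gA]; apply: N; exists A.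
Qed.

(** A continuity condition: the coefficient at [T] of the image depends on finitely many
    coefficients of the argument. *)
Definition loc (b : mono) (Phi : ser K -> ser K) : Prop := forall T f f',
  (forall A, A `<=` b `|` T -> f A = f' A) -> Phi f T = Phi f' T.

(** By locality [f] may be replaced by a finite sum of monomials from its support. This reduces
    linear identities for infinite series to monomials, and for homogeneous [f] to monomials of the
    right parity. *)
Lemma ser_density b Phi f : islin Phi -> loc b Phi ->
  (forall A, f A != 0 -> Phi (mon K A) = 0) -> Phi f = 0.
Proof.
move=> lin lo H; apply: funext => T.
rewrite (lo T f (\sum_(A <- fpowerset (b `|` T)) f A *: mon K A)).
  rewrite (islin_sum _ _ _ lin) ser_sum big1 // => A _; rewrite (islinZ _ _ lin) serZ.
  by have [->|/H->] := eqVneq (f A) 0; rewrite ?mul0r ?mulr0.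
move=> A AS; rewrite ser_sum (big_fsetD1 A) ?fpowersetE //= big_seq big1.
  by rewrite addr0 serZ /mon eqxx mulr1.
move=> B; rewrite !inE => /andP[BA _].
by rewrite serZ /mon eq_sym (negPf BA) mulr0.
Qed.

Lemma gmul1l g : gmul (mon K fset0) g = g.
Proof.
apply: funext => T; rewrite /gmul (big_fsetD1 fset0) ?fpowersetE ?fsub0set //= big_seq big1.
  by rewrite addr0 /mon eqxx fsetD0 /ninv big_seq_fset0 sgn0 !mul1r.
by move=> B; rewrite !inE => /andP[B0 _]; rewrite /mon (negPf B0) mulr0 mul0r.
Qed.

(** Subsets of [T] that contain [j] correspond to subsets of [T] without [j]; the inversions between
    [j] and the second factor supply the missing part of the sign. *)
Lemma gmul_xi j f g : gmul (xi j f) g = xi j (gmul f g).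
Proof.
apply: funext => T; rewrite /gmul {2}/xi; case: ifP => [jT|/negbT jT]; last first.
  rewrite big_seq big1 // => A; rewrite fpowersetE => /fsubsetP AT.
  by rewrite /xi ifN ?mulr0 ?mul0r //; apply: contra jT => /AT.
rewrite (bigID (fun A : mono => j \in A)) /= [X in _ + X]big1 ?addr0; last first.
  by move=> A jA; rewrite /xi (negPf jA) mulr0 mul0r.
rewrite -big_filter.
have P : perm_eq [seq A : mono <- fpowerset T | j \in A]
    [seq j |` A | A : mono <- fpowerset (T `\ j)].
  apply: uniq_perm; first by rewrite filter_uniq ?fset_uniq.
    rewrite map_inj_in_uniq ?fset_uniq // => A B.
    rewrite !fpowersetE !fsubsetD1 => /andP[_ jA] /andP[_ jB] E.
    by rewrite -(fsetU1K jA) -(fsetU1K jB) E.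
  move=> A; rewrite mem_filter fpowersetE; apply/andP/mapP => [[jA AT]|[B]].
    exists (A `\ j); last by rewrite fsetD1K.
    by rewrite fpowersetE fsubsetD1 !inE eqxx /= andbT (fsubset_trans _ AT) // fsubD1set.
  rewrite fpowersetE fsubsetD1 => /andP[BT jB] ->; split; first by rewrite !inE eqxx.
  by rewrite fsubUset fsub1set jT.
rewrite (perm_big _ P) big_map mulr_sumr; apply: eq_big_seq => A.
rewrite fpowersetE => AT; have := AT; rewrite fsubsetD1 => /andP[_ jA].
have -> : T `\` (j |` A) = (T `\ j) `\` A by rewrite fsetDDl.
rewrite /xi !inE eqxx /= fsetU1K // ninvU1 // belowU1 // ltnn add0n.
rewrite (belowD1 _ jT) ltnn add0n (below_split _ AT) !sgnD.
ring.
Qed.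

Lemma mon_xi j A : (forall i, i \in A -> j < i)%N -> mon K (j |` A) = xi j (mon K A).
Proof.
move=> H; have jA : j \notin A by apply/negP => /H; rewrite ltnn.
apply: funext => T; rewrite /mon /xi; case: ifP => jT; last first.
  by case: eqP => // E; rewrite E !inE eqxx in jT.
have -> : (T == j |` A) = (T `\ j == A).
  apply/eqP/eqP => [->|<-]; [exact: fsetU1K|by rewrite fsetD1K].
case: eqP => [E|_]; rewrite ?mulr0 //.
rewrite (belowD1 _ jT) ltnn add0n E /below (_ : count _ _ = 0%N) ?sgn0 ?mulr1 //.
by rewrite -[RHS](count_pred0 A); apply: eq_in_count => i /H /=; lia.
Qed.

(** Peeling off the least generator makes each step a left multiplication without sign, see
    [mon_xi]. *)
Lemma mono_ind (Q : mono -> Prop) : Q fset0 ->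
  (forall j A, (forall i, i \in A -> j < i)%N -> Q A -> Q (j |` A)) -> forall A, Q A.
Proof.
move=> Q0 QS A; move: {2}#|` A| (erefl #|` A|) => n; elim: n A => [|n IH] A cA.
  by move/eqP: cA; rewrite cardfs_eq0 => /eqP->.
have ex : exists j, j \in A by apply/fset0Pn; rewrite -cardfs_eq0 cA.
case: (ex_minnP ex) => j jA jmin; rewrite -(fsetD1K jA); apply: QS.
  by move=> i; rewrite !inE => /andP[ij /jmin]; rewrite leq_eqVlt eq_sym (negPf ij).
by apply: IH; move: cA; rewrite (cardfsD1 j) jA => -[].
Qed.

Lemma gmulA f g h : gmul (gmul f g) h = gmul f (gmul g h).
Proof.
apply/eqP; rewrite -subr_eq0; apply/eqP.
apply: (@ser_density fset0 (fun f => gmul (gmul f g) h - gmul f (gmul g h))).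
- move=> c f1 f2; rewrite !(gmul_linl _ c).
  by rewrite scalerBr opprD addrACA.
- move=> T f1 f2 E; rewrite !serE.
  have E' A : A `<=` T -> f1 A = f2 A by move=> AT; apply: E; rewrite fset0U.
  congr (_ - _); last exact: gmul_locl.
  by apply: gmul_locl => A AT; apply: gmul_locl => B BA; apply/E'/(fsubset_trans BA).
- move=> A _; apply/eqP; rewrite subr_eq0; apply/eqP.
  elim/mono_ind: A => [|j A H IH]; first by rewrite !gmul1l.
  by rewrite mon_xi // !gmul_xi IH.
Qed.

Lemma gmul1r f : gmul f (mon K fset0) = f.
Proof.
apply/eqP; rewrite -subr_eq0; apply/eqP.
apply: (@ser_density fset0 (fun f => gmul f (mon K fset0) - f)).
- by move=> c f1 f2; rewrite (gmul_linl _ c) scalerBr opprD addrACA.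
- move=> T f1 f2 E; rewrite !serE.
  have E' A : A `<=` T -> f1 A = f2 A by move=> AT; apply: E; rewrite fset0U.
  by congr (_ - _); [apply: gmul_locl|apply: E'].
- move=> A _; apply/eqP; rewrite subr_eq0; apply/eqP.
  elim/mono_ind: A => [|j A H IH]; first by rewrite !gmul1l.
  by rewrite mon_xi // !gmul_xi IH.
Qed.

Lemma xi_sqr j f : xi j (xi j f) = 0.
Proof.
by apply: funext => T; rewrite /xi; case: ifP => // _; rewrite !inE eqxx mulr0.
Qed.

Lemma fsetD1C T i j : (T `\ i) `\ j = (T `\ j) `\ i.
Proof. by rewrite !fsetDDl fsetUC. Qed.

Lemma xiC i j f : xi i (xi j f) = - xi j (xi i f).
Proof.
have [->|ij] := eqVneq i j; first by rewrite xi_sqr oppr0.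
apply: funext => T; rewrite serN /xi !inE ij (eq_sym j) ij /=.
case: (boolP (i \in T)) => iT; case: (boolP (j \in T)) => jT; rewrite ?mulr0 ?oppr0 //.
rewrite (fsetD1C T j i) (belowD1 i jT) (belowD1 j iT).
have iTj : i \in T `\ j by rewrite !inE ij.
have jTi : j \in T `\ i by rewrite !inE eq_sym ij.
rewrite (belowD1 j jTi) (belowD1 i iTj) (fsetD1C T j i) !sgnD !ltnn.
have [lt|lt|E] := ltngtP i j; last by rewrite E eqxx in ij.
- by rewrite sgnS sgn0; ring.
- by rewrite sgnS sgn0; ring.
Qed.

Lemma gder_sqr j f : gder j (gder j f) = 0.
Proof.
by apply: funext => T; rewrite /gder; case: ifP => // _; rewrite !inE eqxx mulr0.
Qed.

Lemma gderC i j f : gder i (gder j f) = - gder j (gder i f).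
Proof.
have [->|ij] := eqVneq i j; first by rewrite gder_sqr oppr0.
apply: funext => T; rewrite serN /gder !inE (eq_sym j) (negPf ij) /=.
case: (boolP (i \in T)) => iT; case: (boolP (j \in T)) => jT; rewrite ?mulr0 ?oppr0 //.
rewrite !belowU1 // (fsetUCA [fset i]) !sgnD.
have [lt|lt|E] := ltngtP i j; last by rewrite E eqxx in ij.
- by rewrite sgnS sgn0; ring.
- by rewrite sgnS sgn0; ring.
Qed.

Lemma gder_xi i j f : gder i (xi j f) = (i == j)%:R *: f - xi j (gder i f).
Proof.
apply: funext => T; rewrite !serE /gder /xi; have [<-{j}|ij] := eqVneq i j.
  rewrite !inE eqxx /=; case: (boolP (i \in T)) => iT.
    rewrite fsetD1K // (belowD1 _ iT) ltnn add0n mulrA sgn_sqr !mul1r.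
    by rewrite subrr.
  by rewrite subr0 fsetU1K // belowU1 // ltnn add0n mulrA sgn_sqr.
rewrite mul0r sub0r !inE (eq_sym j) (negPf ij) /=.
case: (boolP (i \in T)) => iT; case: (boolP (j \in T)) => jT; rewrite ?mulr0 ?oppr0 //.
have -> : (i |` T) `\ j = i |` (T `\ j).
  apply/fsetP => k; rewrite !inE; have [->|] := eqVneq k i; rewrite ?ij //=.
rewrite belowU1 // (belowD1 i jT) !sgnD.
have [lt|lt|E] := ltngtP i j; last by rewrite E eqxx in ij.
- by rewrite sgnS sgn0; ring.
- by rewrite sgnS sgn0; ring.
Qed.

Lemma gr_xi j f : grade_inv (xi j f) = - xi j (grade_inv f).
Proof.
apply: funext => T; rewrite serN /grade_inv /xi; case: ifP => jT; last by rewrite mulr0 oppr0.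
by rewrite (cardfsD1 j) jT /= add1n sgnS; ring.
Qed.

Lemma gr_mon0 : grade_inv (mon K fset0) = mon K fset0.
Proof.
apply: funext => T; rewrite /grade_inv /mon; case: eqP => [->|_]; rewrite ?mulr0 //.
by rewrite cardfs0 sgn0 mul1r.
Qed.

Lemma gmul_xir j f g : gmul f (xi j g) = xi j (gmul (grade_inv f) g).
Proof.
apply/eqP; rewrite -subr_eq0; apply/eqP.
apply: (@ser_density fset0 (fun f => gmul f (xi j g) - xi j (gmul (grade_inv f) g))).
- move=> c f1 f2; rewrite gr_lin !(gmul_linl _ c) xi_lin.
  by rewrite scalerBr opprD addrACA.
- move=> T f1 f2 E; rewrite !serE.
  have E' A : A `<=` T -> f1 A = f2 A by move=> AT; apply: E; rewrite fset0U.
  congr (_ - _); first exact: gmul_locl.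
  rewrite /xi; case: ifP => // jT; congr (_ * _); apply: gmul_locl => A AT.
  by rewrite /grade_inv E' //; apply: fsubset_trans AT (fsubD1set _ _).
- move=> A _; apply/eqP; rewrite subr_eq0; apply/eqP.
  elim/mono_ind: A => [|i A H IH]; first by rewrite gr_mon0 !gmul1l.
  rewrite mon_xi // gr_xi gmul_xi IH (islinN _ (gmul_linl g)) gmul_xi.
  by rewrite (islinN _ (xi_lin j)) xiC.
Qed.

Lemma gder_mul j f g :
  gder j (gmul f g) = gmul (gder j f) g + gmul (grade_inv f) (gder j g).
Proof.
apply/eqP; rewrite -subr_eq0; apply/eqP.
(* The set [[fset j]] is needed because the derivative at [T] reads the coefficient at [T] with [j]
   adjoined. *)
apply: (@ser_density [fset j] (fun f => gder j (gmul f g) -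
  (gmul (gder j f) g + gmul (grade_inv f) (gder j g)))).
- move=> c f1 f2; rewrite gr_lin !(gmul_linl _ c) !gder_lin !(gmul_linl _ c).
  by apply: funext => T; rewrite !serE; ring.
- move=> T f1 f2 E; rewrite !serE.
  have E' A : A `<=` j |` T -> f1 A = f2 A by apply: E.
  congr (_ - (_ + _)).
  + by rewrite /gder; case: ifP => // jT; congr (_ * _); apply: gmul_locl.
  + apply: gmul_locl => A AT; rewrite /gder; case: ifP => // _; rewrite E' //.
    exact: fsetUS.
  + apply: gmul_locl => A AT; rewrite /grade_inv E' //.
    exact: fsubset_trans AT (fsubsetUr _ _).
- move=> A _; apply/eqP; rewrite subr_eq0; apply/eqP.
  elim/mono_ind: A => [|i A H IH].
    rewrite gr_mon0 !gmul1l (_ : gder j (mon K fset0) = 0) ?(islin0 (gmul_linl g)) ?add0r //.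
    apply: funext => T; rewrite /gder /mon; case: ifP => // jT.
    by case: eqP => [E|]; rewrite ?mulr0 //; have : j \in fset0 by rewrite -E !inE eqxx.
  rewrite mon_xi // gr_xi gmul_xi !gder_xi IH (islinN _ (gmul_linl _)) gmul_xi.
  rewrite (islinB _ _ (gmul_linl g)) (islinZ _ _ (gmul_linl g)) gmul_xi.
  by rewrite (islinD _ _ (xi_lin i)) opprD addrA.
Qed.

End Series.

(** * The associative algebra *)

Section MonomialWords.
Variable K : fieldType.
Implicit Types (f g : ser K) (T A : mono).

Definition xiw (a : seq nat) f : ser K := foldr (@xi K) f a.

Lemma xi_loc j f g T : (forall A, A `<=` T -> f A = g A) -> xi j f T = xi j g T.
Proof. by move=> E; rewrite /xi; case: ifP => // _; rewrite E // fsubD1set. Qed.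

Lemma xiw_subset a f T : xiw a f T != 0 -> {subset a <= T}.
Proof.
elim: a T => //= j a IH T; rewrite {1}/xi; case: ifP => [jT|]; last by rewrite eqxx.
rewrite mulf_eq0 negb_or => /andP[_ /IH H] i; rewrite inE => /orP[/eqP->//|/H].
by rewrite !inE => /andP[].
Qed.

Lemma fsetD1_fset_seq T (j : nat) a : j \notin a -> j \in T ->
  (T `\ j) `\` [fset i in a] = T `\` [fset i in j :: a].
Proof.
move=> ja jT; apply/fsetP => i; rewrite !inE negb_or -andbA.
by case: (i == j) => //=; rewrite andbF.
Qed.

Lemma xiwE a f T : uniq a -> {subset a <= T} ->
  exists b : bool, xiw a f T = sg b * f (T `\` [fset i in a]).
Proof.
elim: a T => [|j a IH] T /=.
  move=> _ _; exists false; rewrite /sg expr0 mul1r; congr f.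
  by apply/fsetP => i; rewrite !inE.
case/andP => ja ua sub; have jT : j \in T by apply: sub; rewrite inE eqxx.
have [|b E] := IH (T `\ j) ua.
  move=> i ia; rewrite !inE sub ?inE ?ia ?orbT // andbT.
  by apply: contraNneq ja => <-.
exists (odd (below T j) (+) b); rewrite /xi jT E fsetD1_fset_seq // mulrA sgn_odd.
by congr (_ * _); rewrite /sg -signr_addb.
Qed.

Lemma sg_neq0 b : sg b != 0 :> K. Proof. by rewrite /sg signr_eq0. Qed.

Lemma mon_neq0_inv M g T : gmul (mon K M) g T != 0 -> M `<=` T.
Proof.
move/gmul_neq0 => [A [AT]]; rewrite /mon; have [<-//|_] := eqVneq A M.
by rewrite eqxx.
Qed.

Fixpoint Xw (i k : nat) : seq nat :=
  if k is k'.+1 then [:: i, i.+1 & Xw i.+3 k'] else [::].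

Lemma MkP i k j :
  reflect (exists2 n, (n < k)%N & j = (i + 3 * n)%N \/ j = (i + 3 * n).+1) (j \in Mk i k).
Proof.
rewrite inE; apply: (iffP orP) => [[]/imfsetP[n /=]|[n lt E]].
- by rewrite mem_iota => /andP[_ lt] ->; exists n; [|left].
- by rewrite mem_iota => /andP[_ lt] ->; exists n; [|right].
- by case: E => ->; [left|right]; apply/imfsetP; exists n; rewrite //= mem_iota.
Qed.

Lemma Mk0 i : Mk i 0 = fset0.
Proof. by apply/fsetP => j; rewrite in_fset0; apply/negP => /MkP[]. Qed.

Lemma MkS i k : Mk i k.+1 = i |` (i.+1 |` Mk i.+3 k).
Proof.
apply/fsetP => j; rewrite !in_fset1U; apply/MkP/or3P => [[[|n] lt E]|].
- by case: E => ->; [constructor 1|constructor 2]; apply/eqP; lia.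
- constructor 3; apply/MkP; exists n; first lia.
  by case: E => ->; [left|right]; lia.
case=> [/eqP->|/eqP->|/MkP[n lt E]]; [exists 0%N|exists 0%N|exists n.+1]; try lia.
Qed.

Lemma gmul_Mk i k g : gmul (mon K (Mk i k)) g = xiw (Xw i k) g.
Proof.
elim: k i => [|k IH] i; first by rewrite Mk0 gmul1l.
rewrite MkS !mon_xi ?gmul_xi ?IH //.
- by move=> j /MkP[n _ []]; lia.
- by move=> j; rewrite in_fset1U => /orP[/eqP->//|/MkP[n _ []]]; lia.
Qed.

Lemma leq_bnd T t : t \in T -> (t.+1 < bnd T)%N.
Proof. by move=> tT; rewrite /bnd !ltnS; apply: leq_bigmax_seq. Qed.

Lemma bnd_subset A T : A `<=` T -> (bnd A <= bnd T)%N.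
Proof.
move=> /fsubsetP AT; rewrite /bnd !ltnS; apply/bigmax_leqP_seq => t /AT tT _.
exact: leq_bigmax_seq.
Qed.

(** A late summand contains a letter [x] whose index exceeds everything in [T], so it contributes
    nothing; the cut may be raised at will. *)
Lemma vop_trunc N i f T : (bnd T <= N)%N ->
  vop i f T = \sum_(k < N) xiw (Xw i k) (gder (i + 3 * k) f) T.
Proof.
move=> le; rewrite /vop (big_ord_widen N (fun k => gmul (mon K (Mk i k)) (gder (i + 3 * k) f) T)) //.
rewrite big_mkcond; apply: eq_bigr => k _; rewrite -gmul_Mk; case: ifP => // /negbT.
rewrite -leqNgt => bk; apply/esym/eqP/negPn/negP => /mon_neq0_inv /fsubsetP sub.
have k0 : (0 < k)%N by apply: leq_trans bk.
have /sub/leq_bnd : (i + 3 * k.-1)%N \in Mk i k by apply/MkP; exists k.-1; [lia|left].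
lia.
Qed.

End MonomialWords.

(** * The algebra of linear operators on series *)

Section Operators.
Variable K : fieldType.

Record lop := Lop { lap :> ser K -> ser K; lapP : islin lap }.

Lemma lop_eq (F G : lop) : (forall f, F f = G f) -> F = G.
Proof.
case: F G => [F HF] [G HG] /= E; have {}E : F = G by apply: funext.
by subst G; congr Lop; apply: Prop_irrelevance.
Qed.

HB.instance Definition _ := gen_eqMixin lop.
HB.instance Definition _ := gen_choiceMixin lop.

Lemma ser_linE (f g h k : ser K) (c : K) : c *: (f + h) + (g + k) = (c *: f + g) + (c *: h + k).
Proof. by rewrite scalerDr addrACA. Qed.

Let add_lin (F G : lop) : islin (fun f => F f + G f).
Proof. by move=> c f g; rewrite (lapP F) (lapP G) ser_linE. Qed.
Let opp_lin (F : lop) : islin (fun f => - F f).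
Proof. by move=> c f g; rewrite (lapP F) opprD scalerN. Qed.
Let zero_lin : islin (fun _ : ser K => 0).
Proof. by move=> c f g; rewrite scaler0 addr0. Qed.
Let one_lin : islin (fun f : ser K => f). Proof. by []. Qed.
Let mul_lin (F G : lop) : islin (fun f => F (G f)).
Proof. by move=> c f g; rewrite (lapP G) (lapP F). Qed.
Let scale_lin (a : K) (F : lop) : islin (fun f => a *: F f).
Proof. by move=> c f g; rewrite (lapP F) scalerDr !scalerA mulrC. Qed.

Let addF F G := Lop (add_lin F G).
Let oppF F := Lop (opp_lin F).
Let mulF F G := Lop (mul_lin F G).
Let scaleF a F := Lop (scale_lin a F).
Let zeroF := Lop zero_lin.
Let oneF := Lop one_lin.

Let addFA : associative addF. Proof. by move=> F G H; apply: lop_eq => f; apply: addrA. Qed.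
Let addFC : commutative addF. Proof. by move=> F G; apply: lop_eq => f; apply: addrC. Qed.
Let add0F : left_id zeroF addF. Proof. by move=> F; apply: lop_eq => f; apply: add0r. Qed.
Let addNF : left_inverse zeroF oppF addF.
Proof. by move=> F; apply: lop_eq => f; apply: addNr. Qed.
HB.instance Definition _ := GRing.isZmodule.Build lop addFA addFC add0F addNF.

Let mulFA : associative mulF. Proof. by move=> F G H; apply: lop_eq. Qed.
Let mul1F : left_id oneF mulF. Proof. by move=> F; apply: lop_eq. Qed.
Let mulF1 : right_id oneF mulF. Proof. by move=> F; apply: lop_eq. Qed.
Let mulFDl : left_distributive mulF addF. Proof. by move=> F G H; apply: lop_eq. Qed.
Let mulFDr : right_distributive mulF addF.
Proof. by move=> F G H; apply: lop_eq => f; apply: (islinD _ _ (lapP F)). Qed.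
Let oneF_neq0 : oneF != 0.
Proof.
apply/eqP => /(congr1 (fun F : lop => F (mon K fset0) fset0)) /= /eqP.
by rewrite /mon eqxx oner_eq0.
Qed.
HB.instance Definition _ := GRing.Zmodule_isNzRing.Build lop
  mulFA mul1F mulF1 mulFDl mulFDr oneF_neq0.

Let scFA (a b : K) F : scaleF a (scaleF b F) = scaleF (a * b) F.
Proof. by apply: lop_eq => f; apply: scalerA. Qed.
Let sc1F : left_id 1 scaleF. Proof. by move=> F; apply: lop_eq => f; apply: scale1r. Qed.
Let scFDr : right_distributive scaleF +%R.
Proof. by move=> c F G; apply: lop_eq => f; apply: scalerDr. Qed.
Let scFDl F : {morph scaleF^~ F : a b / a + b}.
Proof. by move=> a b; apply: lop_eq => f; apply: scalerDl. Qed.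
HB.instance Definition _ := GRing.Zmodule_isLmodule.Build K lop scFA sc1F scFDr scFDl.

Let scFAl (c : K) (F G : lop) : c *: (F * G) = (c *: F) * G. Proof. by apply: lop_eq. Qed.
HB.instance Definition _ := GRing.Lmodule_isLalgebra.Build K lop scFAl.
Let scFAr (c : K) (F G : lop) : c *: (F * G) = F * (c *: G).
Proof. by apply: lop_eq => f; symmetry; apply: (islinZ _ _ (lapP F)). Qed.
HB.instance Definition _ := GRing.Lalgebra_isAlgebra.Build K lop scFAr.

Lemma lopD (F G : lop) f : (F + G) f = F f + G f. Proof. by []. Qed.
Lemma lopN (F : lop) f : (- F) f = - F f. Proof. by []. Qed.
Lemma lopM (F G : lop) f : (F * G) f = F (G f). Proof. by []. Qed.
Lemma lopZ c (F : lop) f : (c *: F) f = c *: F f. Proof. by []. Qed.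
Lemma lop_sum (I : Type) (r : seq I) (P : pred I) (E : I -> lop) f :
  (\sum_(i <- r | P i) E i) f = \sum_(i <- r | P i) E i f.
Proof. by elim/big_rec2: _ => // i a b _ <-. Qed.

Definition Xi j : lop := Lop (@xi_lin K j).
Definition Dr j : lop := Lop (@gder_lin K j).

Lemma vop_lin i : islin (@vop K i).
Proof.
move=> c f g; apply: funext => T; rewrite !serE /vop mulr_sumr -big_split.
apply: eq_bigr => k _ /=; rewrite (gder_lin _ c) (gmul_linr _ c) !serE; ring.
Qed.
Definition Vo i : lop := Lop (@vop_lin i).

Lemma XiC i j : Xi i * Xi j = - (Xi j * Xi i).
Proof. by apply: lop_eq => f; apply: xiC. Qed.
Lemma Xi_sqr i : Xi i * Xi i = 0. Proof. by apply: lop_eq => f; apply: xi_sqr. Qed.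
Lemma DrC i j : Dr i * Dr j = - (Dr j * Dr i).
Proof. by apply: lop_eq => f; apply: gderC. Qed.
Lemma Dr_sqr i : Dr i * Dr i = 0. Proof. by apply: lop_eq => f; apply: gder_sqr. Qed.
Lemma DrXi i j : Dr i * Xi j = (i == j)%:R - Xi j * Dr i.
Proof.
apply: lop_eq => f; rewrite lopD lopN !lopM /= gder_xi; congr (_ - _).
by case: (i == j); rewrite ?scale1r ?scale0r.
Qed.
Lemma DrXi_neq i j : i != j -> Dr i * Xi j = - (Xi j * Dr i).
Proof. by move=> ij; rewrite DrXi (negPf ij) sub0r. Qed.

Definition XW a : lop := \prod_(i <- a) Xi i.
Lemma XWE a f : XW a f = xiw a f.
Proof. by elim: a => [|i a IH]; rewrite /XW ?big_nil // big_cons lopM -/(XW a) IH. Qed.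

Definition VN N i : lop := \sum_(k < N) XW (Xw i k) * Dr (i + 3 * k).

Lemma Vo_trunc N i f T : (bnd T <= N)%N -> Vo i f T = VN N i f T.
Proof.
move=> le; rewrite /= (vop_trunc _ _ le) /VN lop_sum ser_sum.
by apply: eq_bigr => k _; rewrite lopM XWE.
Qed.

Lemma Vo_rec i : Vo i = Dr i + Xi i * Xi i.+1 * Vo i.+3.
Proof.
apply: lop_eq => f; apply: funext => T.
(* One extra term: the summand [k = 0] is [Dr i], and the others form the truncation of [Vo i.+3] at
   [bnd T]. *)
rewrite (@Vo_trunc (bnd T).+1) // lopD serD !lopM.
rewrite [X in _ = _ + X](_ : _ = Xi i (Xi i.+1 (VN (bnd T) i.+3 f)) T); last first.
  apply: xi_loc => A AT; apply: xi_loc => B BA; apply: Vo_trunc.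
  by apply/bnd_subset/(fsubset_trans BA).
rewrite -!lopM -serD -lopD; congr (lap _ f T).
rewrite /VN big_ord_recl /= muln0 addn0 {1}/XW big_nil mul1r; congr (_ + _).
rewrite mulr_sumr; apply: eq_bigr => k _.
rewrite /XW !big_cons !mulrA; congr (_ * Dr _); rewrite /bump; lia.
Qed.

(** The word [Xw i k] has even length, so the signs cancel. *)
Lemma XWcomm (z : lop) i k : (forall m, (i <= m)%N -> z * Xi m = - (Xi m * z)) ->
  z * XW (Xw i k) = XW (Xw i k) * z.
Proof.
elim: k i => [|k IH] i H; first by rewrite /XW big_nil mulr1 mul1r.
rewrite /XW /= !big_cons -/(XW _) !mulrA H // mulNr -(mulrA _ z) H //.
rewrite mulrN opprK -!mulrA IH // => m im; apply: H; lia.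
Qed.

Lemma VN_anti (z : lop) N i : (forall m, (i <= m)%N -> z * Xi m = - (Xi m * z)) ->
  (forall m, (i <= m)%N -> z * Dr m = - (Dr m * z)) -> z * VN N i = - (VN N i * z).
Proof.
move=> Hx Hd; rewrite /VN mulr_sumr mulr_suml -sumrN; apply: eq_bigr => k _.
rewrite mulrA XWcomm // -mulrA Hd ?mulrN ?mulrA //; lia.
Qed.

Lemma XiVo i j : (i < j)%N -> Xi i * Vo j = - (Vo j * Xi i).
Proof.
move=> ij; apply: lop_eq => f; apply: funext => T; rewrite lopN serN !lopM.
rewrite (@Vo_trunc (bnd T)) //.
rewrite [LHS](_ : _ = Xi i (VN (bnd T) j f) T); last first.
  by apply: xi_loc => A AT; apply/Vo_trunc/bnd_subset.
rewrite -!lopM -serN -lopN; congr (lap _ f T); apply: VN_anti => m jm; first exact: XiC.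
by rewrite DrXi_neq ?opprK //; lia.
Qed.

Lemma DrVo i j : (i < j)%N -> Dr i * Vo j = - (Vo j * Dr i).
Proof.
move=> ij; apply: lop_eq => f; apply: funext => T; rewrite lopN serN !lopM.
pose N := bnd (i |` T).
rewrite (@Vo_trunc N) ?bnd_subset ?fsubsetUr //.
rewrite [LHS](_ : _ = Dr i (VN N j f) T); last first.
  rewrite -[LHS]/(gder i (Vo j f) T) -[RHS]/(gder i (VN N j f) T) /gder.
  by case: ifP => // _; rewrite (@Vo_trunc N).
rewrite -!lopM -serN -lopN; congr (lap _ f T); apply: VN_anti => m jm; last exact: DrC.
by rewrite DrXi_neq //; lia.
Qed.

(** Both summands of the recursion square to zero, and their anticommutator is the right-hand side.
    No division by 2 occurs, so this holds in every characteristic. *)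
Lemma Vo_sqr n : Vo n * Vo n = Xi n.+1 * Vo n.+3.
Proof.
have n3 : (n < n.+3)%N by lia.
have n13 : (n.+1 < n.+3)%N by lia.
have nn : n != n.+1 by lia.
rewrite {1 2}Vo_rec mulrDl !mulrDr Dr_sqr add0r.
have -> : Xi n * Xi n.+1 * Vo n.+3 * (Xi n * Xi n.+1 * Vo n.+3) = 0.
  have e : Xi n * Xi n.+1 * Vo n.+3 * Xi n = 0.
    rewrite -(mulrA _ (Vo _)) -[Vo n.+3 * Xi n]opprK -XiVo // mulrN mulrA.
    rewrite -(mulrA (Xi n) (Xi n.+1) (Xi n)) (XiC n.+1 n) mulrN mulrA Xi_sqr.
    by rewrite mul0r oppr0 mul0r oppr0.
  by rewrite !mulrA e !mul0r.
rewrite addr0 !mulrA DrXi eqxx mulrBl mul1r -(mulrA (Xi n) (Dr n)) DrXi_neq // mulrN opprK.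
rewrite mulrDl -!mulrA DrVo // !mulrN !mulrA.
by rewrite -addrA addNr addr0.
Qed.

Definition sbr (p q : bool) (F G : lop) : lop := F * G - sg (p && q) *: (G * F).

Lemma sg_addb_and (p q r : bool) : sg ((p (+) q) && r) = sg (p && r) * sg (q && r) :> K.
Proof. by rewrite /sg -signr_addb andb_addl. Qed.

Lemma sg_andb_add (p q r : bool) : sg (p && (q (+) r)) = sg (p && q) * sg (p && r) :> K.
Proof. by rewrite /sg -signr_addb andb_addr. Qed.

Lemma sbrMl p q r s (f g h : lop) : s = p (+) q ->
  sbr s r (f * g) h = f * sbr q r g h + sg (q && r) *: (sbr p r f h * g).
Proof.
move=> ->; rewrite /sbr sg_addb_and mulrBr mulrBl scalerBr addrA -scalerAr -scalerAl.
by rewrite !mulrA subrK scalerA [sg (q && r) * _]mulrC.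
Qed.

Lemma sbrMr p q r s (f g h : lop) : s = q (+) r ->
  sbr p s f (g * h) = sbr p q f g * h + sg (p && q) *: (g * sbr p r f h).
Proof.
move=> ->; rewrite /sbr sg_andb_add mulrBr mulrBl scalerBr addrA -scalerAr -scalerAl.
by rewrite !mulrA subrK scalerA.
Qed.

Lemma VoB i : Vo i - Xi i * Xi i.+1 * Vo i.+3 = Dr i.
Proof. by rewrite {1}Vo_rec addrK. Qed.

Lemma sbr_odd (F G : lop) : sbr true true F G = F * G + G * F.
Proof. by rewrite /sbr /sg expr1 scaleN1r opprK. Qed.

(** Every operator counts as homogeneous of both parities: [sbr] carries its parities as labels, and
    its laws are formal identities in them. *)
Definition superA : superalg lop.
Proof.
refine (@SuperAlg K lop (fun _ _ => True) sbr Xi Vo _ _ _ _ _ _ _ _ _ _ _ _ _ XiC Xi_sqr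
  _ _ _ _ _ _) => //.
- move=> p q f f' g _ _ _; rewrite /sbr mulrDl mulrDr scalerDr opprD.
  exact: addrACA.
- move=> p q c f g _ _; rewrite /sbr -scalerAl -scalerAr scalerBr !scalerA.
  by rewrite [c * _]mulrC.
- move=> p q f g _ _; rewrite /sbr scalerBr opprB scalerA andbC.
  by rewrite /sg -expr2 -exprM mulnC exprM sqrrN expr1n expr1n scale1r.
- by move=> p q r s f g h sE _ _ _; apply: sbrMl.
- by move=> p q r s f g h sE _ _ _; apply: sbrMr.
- by move=> i j ij; rewrite XiVo ?opprK.
- by move=> i j; rewrite sbr_odd XiC addNr.
- by move=> i j ij; rewrite sbr_odd XiVo // addNr.
- by move=> i j; rewrite VoB sbr_odd DrXi subrK.
- by move=> i j ij; rewrite VoB sbr_odd DrVo // addNr.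
- by move=> i; rewrite VoB sbr_odd Dr_sqr addr0.
Defined.

End Operators.

Section Selection.
Variable m : nat.
Implicit Types t : m.-tuple bool.

(** Subsets of [[0, m)] are encoded by tuples of booleans, whose number is immediate. *)
Definition sel t : seq nat := [seq i <- iota 0 m | nth false t i].

Lemma sel_uniq t : uniq (sel t). Proof. by rewrite filter_uniq // iota_uniq. Qed.

Lemma mem_sel t i : (i \in sel t) = (i < m)%N && nth false t i.
Proof. by rewrite mem_filter mem_iota andbC. Qed.

Lemma sel_lt t : {in sel t, forall i, i < m}%N.
Proof. by move=> i; rewrite mem_sel => /andP[]. Qed.

Lemma eq_mem_sel t t' : sel t =i sel t' -> t = t'.
Proof.
move=> E; apply: eq_from_tnth => i; rewrite !(tnth_nth false).
by have := E i; rewrite !mem_sel ltn_ord.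
Qed.

Lemma subset_sel t t' : {subset sel t' <= sel t} ->
  t' = t \/ (size (sel t') < size (sel t))%N.
Proof.
move=> sub; have [lt|le] := ltnP (size (sel t')) (size (sel t)); [by right|left].
by apply: eq_mem_sel; have [] := uniq_min_size (sel_uniq t') sub le.
Qed.

End Selection.

Lemma lspan_finite (K : fieldType) (R : algType K) (P : R -> Prop) f : lspan P f ->
  exists l : seq R, List.Forall P l /\ lspan (fun g => g \in l) f.
Proof.
elim=> [g Pg||g h _ [l [Pl Ll]] _ [l' [Pl' Ll']]|c g _ [l [Pl Ll]]].
- by exists [:: g]; split; [repeat constructor|apply: lspan_in; rewrite inE].
- by exists [::]; split; [constructor|apply: lspan0].
- exists (l ++ l'); split; first by apply/List.Forall_app.
  by apply: lspanD; [apply: lspan_trans Ll|apply: lspan_trans Ll'] => h' hl;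
    apply: lspan_in; rewrite mem_cat hl ?orbT.
- by exists l; split; [|apply: lspanZ].
Qed.

(** * Growth bounds for the operator algebra *)

Section GrowthA.
Variables (K : fieldType) (F : realFieldType) (lam : F).
Hypotheses (lam3 : lam ^+ 3 = lam + 2%:R) (lam_gt : 3%:R / 2%:R < lam).
Local Notation pw n := (lam ^+ n).
Local Notation SA := (superA K).
Local Notation evA := (fun (F : ser K -> ser K) (p : ser K * mono) => F p.1 p.2).
Local Notation spanA := (evspan (fun p : ser K * mono => Defs.finsupp p.1) evA).

(** Stated for left multiplication, so that products of monomials compose; a generator costs at most
    [lam ^ 2], the weight of [v 2]. *)
Lemma amon_sortspan k G : amon k G -> exists L : lop K, lap L = G /\
  forall w h, sortspan SA lam 0 w h -> sortspan SA lam 0 (lam ^+ 2 * k%:R + w) (L * h).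
Proof.
have brE p q f g : br SA p q f g = f * g - sg (p && q) *: (g * f) by [].
elim=> {k G} [i i3|a b G H _ [L [<- IL]] _ [M [<- IM]]].
  exists (Vo K i); split=> // w h Hh; rewrite mulr1.
  exact: (sortspan_gen lam3 lam_gt brE (@Vo_sqr K) i3 Hh).
exists (L * M); split=> // w h Hh; rewrite -mulrA natrD mulrDr -addrA.
by apply: IL; apply: IM.
Qed.

Lemma lspan_evspan (P : ser K * mono -> Prop) (l : seq (lop K)) (G : lop K) :
  lspan (fun g => g \in l) G -> evspan P evA [seq lap g | g <- l] G.
Proof.
move=> /lspan_seq[c ->]; exists c => -[f T] _; rewrite size_map lop_sum ser_sum /=.
by apply: eq_bigr => k _; rewrite (nth_map 0).
Qed.

Lemma A_upper_span N n : lam ^+ 2 * n%:R < wconst lam * pw N.+1 ->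
  exists l : seq (ser K -> ser K), size l = (4 ^ N.+1)%N /\
    forall G, (exists k, (k <= n)%N /\ amon k G) -> spanA l G.
Proof.
move=> lt; have brE p q f g : br SA p q f g = f * g - sg (p && q) *: (g * f) by [].
have [l [sl Hl]] := sortspan_list lam3 lam_gt brE N.
exists [seq lap g | g <- l]; split; first by rewrite size_map.
move=> G [k [kn /amon_sortspan[L [<- HL]]]]; apply: lspan_evspan.
have := HL 0 1 (sortspan1 SA lam 0 (lexx 0)); rewrite addr0 mulr1; apply: Hl.
apply: le_lt_trans lt; rewrite ler_wpM2l ?ler_nat //.
by rewrite exprn_ge0 // ltW // (lam_gt0 lam_gt).
Qed.

Lemma deg_lspanA p (t : F) G : deg SA p t G ->
  lspan (fun H : lop K => exists k, k%:R <= t /\ amon k H) G.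
Proof.
have M (t1 t2 t' : F) (f g : lop K) : t1 + t2 <= t' ->
    lspan (fun H : lop K => exists k, k%:R <= t1 /\ amon k H) f ->
    lspan (fun H : lop K => exists k, k%:R <= t2 /\ amon k H) g ->
    lspan (fun H : lop K => exists k, k%:R <= t' /\ amon k H) (f * g).
  move=> le Hf Hg; apply: lspan_mulr Hf => f' [k [kt Hk]].
  apply: lspan_map Hg => g' [k' [kt' Hk']]; apply: lspan_in; exists (k + k')%N; split.
    by rewrite natrD; apply: le_trans le; apply: lerD.
  exact: amon_mul.
elim=> {p t G} [i t i3 t1|p q s t t' t'' f g _ le _ If _ Ig|p q s t t' t'' f g _ le _ If _ Ig|p t f _ If].
- by apply: lspan_in; exists 1%N; split=> //; apply: amon_gen.
- exact: M le If Ig.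
- apply: lspanD; first exact: M le If Ig.
  apply/lspan_opp/lspanZ; apply: M Ig If; by rewrite addrC.
- exact: lspan_opp.
Qed.

Definition DW (c : seq nat) : lop K := \prod_(i <- c) Dr K i.

Lemma DWE c f T : uniq c -> {in c, forall i, i \notin T} ->
  exists b : bool, DW c f T = sg b * f ([fset i in c] `|` T).
Proof.
elim: c T => [|j c IH] T; rewrite /DW ?big_nil ?big_cons.
  move=> _ _; exists false; rewrite /sg expr0 mul1r; congr f.
  by apply/fsetP => i; rewrite !inE.
move=> /= /andP[jc uc] H; have jT : j \notin T by apply: H; rewrite inE eqxx.
have [|b E] := IH (j |` T) uc.
  move=> i ic; rewrite !inE negb_or H ?inE ?ic ?orbT // andbT.
  by apply: contraNneq jc => <-.
exists (odd (below T j) (+) b); rewrite -/(DW c) -[LHS]/(gder j (DW c f) T) /gder (negPf jT).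
rewrite E mulrA sgn_odd; congr (_ * f _); first by rewrite /sg -signr_addb.
by apply/fsetP => i; rewrite !inE orbCA orbA.
Qed.

Lemma DW_Xi c k : k \notin c -> DW c * Xi K k = sg (odd (size c)) *: (Xi K k * DW c).
Proof.
elim: c => [|j c IH]; rewrite /DW ?big_nil ?big_cons -?/(DW _).
  by rewrite mulr1 mul1r /sg expr0 scale1r.
rewrite inE negb_or => /andP[kj kc]; rewrite -mulrA IH // -scalerAr [in RHS]mulrA.
rewrite [Dr K j * _]mulrA DrXi_neq 1?eq_sym // mulNr scalerN -scaleNr /=; congr (_ *: _).
by rewrite /sg; case: odd; rewrite ?expr0 ?expr1 ?opprK.
Qed.

(* In the constant term, only the summands [d_i] of the factors [v_i] survive,
   because [x_i] can be moved to the far left. *)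
Lemma vw_const_term pre c f : uniq (pre ++ c) ->
  (DW pre * vw SA c) f fset0 = DW (pre ++ c) f fset0.
Proof.
elim: c pre => [|k c IH] pre u; first by rewrite cats0 /vw big_nil mulr1.
have kpre : k \notin pre.
  by move: u; rewrite cat_uniq /= negb_or => /andP[_ /andP[/andP[]]].
rewrite vw_cons -[v SA k]/(Vo K k) Vo_rec mulrDl mulrDr lopD serD.
rewrite [X in _ + X](_ : _ = 0) ?addr0.
  rewrite mulrA; have -> : DW pre * Dr K k = DW (rcons pre k).
    by rewrite -cats1 /DW big_cat big_seq1.
  by rewrite IH cat_rcons.
rewrite -!mulrA (mulrA (DW pre)) DW_Xi // -scalerAl lopZ serZ.
have xi0 h : Xi K k h fset0 = 0 by rewrite /= /xi in_fset0.
by rewrite -(mulrA (Xi K k)) lopM xi0 mulr0.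
Qed.

(** The operator for [(a, b)] is tested on the monomial with indices [N] and [b'], at the
    coefficient [a']. A nonzero value forces [a] to lie in [a']; if [a = a'], what remains is a
    constant term, nonzero only for [b = b']. The rank is the size of [a]. *)
Lemma A_lower q n d : 3%:R * pw (3 * q).+3 <= n%:R -> growthA K n d ->
  (2 ^ (3 * q).+1 * 2 ^ (3 * q).+3 <= d)%N.
Proof.
set m := (3 * q).+1; set N := (3 * q).+3 => le; rewrite /growthA.
pose J := (m.-tuple bool * N.-tuple bool)%type.
pose E (j : J) : lop K := xw SA (sel j.1) * v SA N * vw SA (sel j.2).
pose th (j : J) : ser K * mono :=
  (mon K [fset i in N :: sel j.2], [fset i in sel j.1]).
have uN (u : N.-tuple bool) : uniq (N :: sel u).
  by rewrite /= sel_uniq andbT; apply/negP => /sel_lt; rewrite ltnn.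
have evE (i j : J) : {subset sel j.1 <= sel i.1} -> exists b : bool,
    E j (th i).1 (th i).2 = sg b * vw SA (N :: sel j.2) (th i).1
      ([fset k in sel i.1] `\` [fset k in sel j.1]).
  move=> sub; rewrite /E -mulrA -vw_cons lopM.
  have [|b Eb] := @xiwE K (sel j.1) (vw SA (N :: sel j.2) (th i).1) (th i).2 (sel_uniq _).
    by move=> k /sub; rewrite !inE.
  by exists b; rewrite -Eb -XWE.
have evE1 (i j : J) : i.1 = j.1 -> exists b : bool,
    E j (th i).1 (th i).2 = sg b * ([fset k in N :: sel j.2] == [fset k in N :: sel i.2])%:R.
  move=> ij; have [|b ->] := evE i j; first by rewrite ij.
  rewrite ij fsetDv -[vw _ _]mul1r.
  have -> : (1 : lop K) = DW [::] by rewrite /DW big_nil.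
  rewrite vw_const_term; last exact: uN.
  rewrite cat0s; have [//|b' ->] := @DWE (N :: sel j.2) (th i).1 fset0 (uN _).
  by exists (b (+) b'); rewrite fsetU0 mulrA /sg -signr_addb.
move=> dim.
have -> : (2 ^ m * 2 ^ N)%N = size [seq lap (E j) | j <- enum {: J}].
  by rewrite size_map -cardE card_prod !card_tuple card_bool.
apply: dim_span_ge dim => [k x0|].
  rewrite size_map => lk; rewrite (nth_map (nseq_tuple m false, nseq_tuple N false)) //.
  set j := nth _ _ _.
  have [p Hp] := deg_basis SA lam3 lam_gt (nth false j.1) (sel_uniq j.2) (@sel_lt _ j.2).
  have [l [Pl Ll]] := lspan_finite (deg_lspanA Hp).
  exists [seq lap g | g <- l]; split; last exact: lspan_evspan Ll.
  apply/List.Forall_map; apply: List.Forall_impl Pl => g [k' [kt gk]]; exists k'; split=> //.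
  by rewrite -(ler_nat F); apply: le_trans le.
apply: (triangular_indep (J := J) (E := fun j => lap (E j)) (th := th)
  (rk := fun j => size (sel j.1))) => [|j _|j _|i j _ _].
- exact: enum_uniq.
- exists [:: [fset i in N :: sel j.2]] => T; rewrite [(th j).1]/= /mon inE.
  by case: (T == _) => // /negP[]; apply/eqP.
- by have [b ->] := evE1 j j erefl; rewrite eqxx mulr1 sg_neq0.
- move=> ne; have sub : {subset sel j.1 <= sel i.1}.
    move: ne; rewrite /E -mulrA lopM -[xw SA _]/(XW K _) XWE => /xiw_subset sub k /sub.
    by rewrite !inE.
  have [E1|] := subset_sel sub; [left|by right].
  have [b Eb] := evE1 i j (esym E1); move: ne; rewrite Eb.
  have [E2 _|_] := eqVneq [fset k in N :: sel j.2] [fset k in N :: sel i.2];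
    last by rewrite mulr0 eqxx.
  case: i j E1 E2 {Eb sub} => [i1 i2] [j1 j2] /= -> E2; congr (_, _).
  apply: eq_mem_sel => k; move/fsetP/(_ k): E2; rewrite !inE.
  case: (eqVneq k N) => [->|//] _.
  by apply/idP/idP => /sel_lt; rewrite ltnn.
Qed.

End GrowthA.

(** * The Poisson superalgebra *)

Section SeriesAlgebra.
Variable K : fieldType.

Let mulA : associative (@gmul K). Proof. by move=> f g h; rewrite gmulA. Qed.
Let mulDl : left_distributive (@gmul K) +%R.
Proof. by move=> f g h; apply: (islinD _ _ (gmul_linl h)). Qed.
Let mulDr : right_distributive (@gmul K) +%R.
Proof. by move=> f g h; apply: (islinD _ _ (gmul_linr f)). Qed.
Let one_neq0 : mon K fset0 != 0.
Proof.
apply/eqP => /(congr1 (fun f : ser K => f fset0)) /eqP.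
by rewrite /mon eqxx oner_eq0.
Qed.
HB.instance Definition _ := GRing.Zmodule_isNzRing.Build (ser K)
  mulA (@gmul1l K) (@gmul1r K) mulDl mulDr one_neq0.

Let scAl (c : K) (f g : ser K) : c *: (f * g) = (c *: f) * g.
Proof. by symmetry; apply: (islinZ _ _ (gmul_linl g)). Qed.
HB.instance Definition _ := GRing.Lmodule_isLalgebra.Build K (ser K) scAl.
Let scAr (c : K) (f g : ser K) : c *: (f * g) = f * (c *: g).
Proof. by symmetry; apply: (islinZ _ _ (gmul_linr f)). Qed.
HB.instance Definition _ := GRing.Lalgebra_isAlgebra.Build K (ser K) scAr.
End SeriesAlgebra.

Section EventualValue.
Variable K : fieldType.

(** The eventual value of a sequence; 0 is a default when there is none, a case excluded by
    [evlimE]. *)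
Definition evlim (u : nat -> K) : K :=
  match pselect (exists n, `[< forall N, (n <= N)%N -> u N = u n >]) with
  | left H => u (xchoose H)
  | right _ => 0
  end.

Lemma evlimE u n : (forall N, (n <= N)%N -> u N = u n) -> evlim u = u n.
Proof.
move=> H; rewrite /evlim; case: pselect => [ex|[]]; last by exists n; apply/asboolP.
have /asboolP E := xchooseP ex; rewrite -(E (maxn n (xchoose ex))) ?leq_maxr //.
by rewrite H // leq_maxl.
Qed.
End EventualValue.

(** * The bracket beyond the completion *)

Section Poisson.
Variable K : fieldType.
Implicit Types (f g h : ser K) (T A B : mono).
Local Notation gr := (@grade_inv K).

Definition ishom (p : bool) f : Prop := forall T, f T != 0 -> odd #|` T| = p.

(* Every monomial involving [x_i] with [i >= c] also involves some [y_j] with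
   [i <= j]; this makes the sum over all [i] in the bracket locally finite. *)
Definition inB (c : nat) f : Prop := forall T, f T != 0 -> forall i, xg i \in T ->
  (i < c)%N \/ exists2 j, yg j \in T & (i <= j)%N.

Lemma inB_weaken c c' f : (c <= c')%N -> inB c f -> inB c' f.
Proof.
by move=> le H T fT i iT; have [lt|] := H T fT i iT; [left; lia|right].
Qed.

Lemma card_split T A : A `<=` T -> #|` T| = (#|` A| + #|` T `\` A|)%N.
Proof. by move=> AT; rewrite -size_cat; apply/perm_size/perm_fset_split. Qed.

Lemma ishomM p q f g : ishom p f -> ishom q g -> ishom (p (+) q) (f * g).
Proof.
move=> hf hg T /gmul_neq0[A [AT fA gA]].
by rewrite (card_split AT) oddD (hf _ fA) (hg _ gA).
Qed.

Lemma inBM c f g : inB c f -> inB c g -> inB c (f * g).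
Proof.
move=> hf hg T /gmul_neq0[A [AT fA gA]] i iT.
have : (i < c)%N \/ exists2 j, (yg j \in A) || (yg j \in T `\` A) & (i <= j)%N.
  have [iA|iA] := boolP (xg i \in A).
    by have [|[j jA ij]] := hf A fA i iA; [left|right; exists j; rewrite ?jA].
  have [||[j jA ij]] := hg _ gA i; first by rewrite inE iA.
    by left.
  by right; exists j; rewrite ?jA ?orbT.
case=> [|[j jA ij]]; [by left|right; exists j => //].
by case/orP: jA => [/(fsubsetP AT)//|]; rewrite inE => /andP[].
Qed.

Lemma add_neq0 (a b : K) : a + b != 0 -> a != 0 \/ b != 0.
Proof.
by move=> H; have [a0|] := eqVneq a 0; [right; rewrite a0 add0r in H|left].
Qed.

Lemma ishomD p f g : ishom p f -> ishom p g -> ishom p (f + g).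
Proof. by move=> hf hg T; rewrite serD => /add_neq0[/hf|/hg]. Qed.
Lemma inBD c f g : inB c f -> inB c g -> inB c (f + g).
Proof. by move=> hf hg T; rewrite serD => /add_neq0[/hf|/hg]. Qed.

Lemma Z_neq0 c f T : (c *: f) T != 0 -> f T != 0.
Proof. by rewrite serZ mulf_eq0 negb_or => /andP[]. Qed.
Lemma ishomZ p c f : ishom p f -> ishom p (c *: f).
Proof. by move=> hf T /Z_neq0/hf. Qed.
Lemma inBZ b c f : inB b f -> inB b (c *: f).
Proof. by move=> hf T /Z_neq0/hf. Qed.

Lemma gr_hom p f : ishom p f -> gr f = sg p *: f.
Proof.
move=> hf; apply: funext => T; rewrite /grade_inv serZ.
by have [->|/hf E] := eqVneq (f T) 0; rewrite ?mulr0 // sgn_odd E.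
Qed.

Lemma gr_neq0 f T : gr f T != 0 -> f T != 0.
Proof. by rewrite /grade_inv mulf_eq0 negb_or => /andP[]. Qed.

Lemma gr_ishom p f : ishom p f -> ishom p (gr f).
Proof. by move=> hf T /gr_neq0/hf. Qed.

Lemma grK f : gr (gr f) = f.
Proof. by apply: funext => T; rewrite /grade_inv mulrA sgn_sqr mul1r. Qed.

Lemma gr_mul f g : gr (f * g) = gr f * gr g.
Proof.
apply: funext => T; rewrite /grade_inv [LHS]mulr_sumr; apply: eq_big_seq => A.
rewrite fpowersetE => AT; rewrite (card_split AT) sgnD; ring.
Qed.

Lemma gder_neq0 j f T : gder j f T != 0 -> j \notin T /\ f (j |` T) != 0.
Proof.
rewrite /gder; case: ifP => [|_]; first by rewrite eqxx.
by rewrite mulf_eq0 negb_or => /andP[].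
Qed.

Lemma gder_ishom p j f : ishom p f -> ishom (~~ p) (gder j f).
Proof.
move=> hf T /gder_neq0[jT /hf]; rewrite cardfsU1 jT /= => <-.
by rewrite negbK.
Qed.

Lemma ser_mulC p q f g : ishom p f -> ishom q g -> f * g = sg (p && q) *: (g * f).
Proof.
move=> hf hg; apply/eqP; rewrite -subr_eq0; apply/eqP.
apply: (@ser_density K fset0 (fun f => f * g - sg (p && q) *: (g * f))).
- move=> c f1 f2; rewrite mulrDl mulrDr -scalerAl -scalerAr scalerBr scalerDr.
  by rewrite !scalerA mulrC opprD addrACA.
- move=> T f1 f2 E; rewrite !serE.
  have E' A : A `<=` T -> f1 A = f2 A by move=> AT; apply: E; rewrite fset0U.
  by congr (_ - _ * _); [apply: gmul_locl|apply: gmul_locr].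
(* Only monomials in the support of [f] occur, all of parity [p], so one sign serves for all of
   them. *)
move=> A /hf pA; apply/eqP; rewrite subr_eq0 -{}pA; apply/eqP.
elim/mono_ind: A => [|j A H IH].
  by rewrite cardfs0 /sg expr0 scale1r mul1r mulr1.
have jA : j \notin A by apply/negP => /H; rewrite ltnn.
rewrite mon_xi // -[LHS]/(gmul (xi j _) g) -[X in _ *: X]/(gmul g (xi j _)).
rewrite gmul_xi gmul_xir (gr_hom hg) -[gmul (mon K A) g]/(mon K A * g) IH.
rewrite (islinZ _ _ (xi_lin j)) (islinZ _ _ (gmul_linl _)) (islinZ _ _ (xi_lin j)) scalerA.
congr (_ *: _); rewrite cardfsU1 jA add1n /= /sg -signr_addb.
by congr (_ ^+ nat_of_bool _); case: odd; case: q {hg IH}.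
Qed.

Lemma gder_ring_mul j f g : gder j (f * g) = gder j f * g + gr f * gder j g.
Proof. exact: gder_mul. Qed.

(** The bracket is a sum of such terms over the pairs [(y_i, x_i)] and [(x_i, y_i)]. Each satisfies
    the Leibniz rules separately; antisymmetry exchanges the two kinds. *)
Definition half u w f g : ser K := gr (gder u f) * gder w g.

Lemma half_Mr u w p q f g h : ishom p f -> ishom q g ->
  half u w f (g * h) = half u w f g * h + sg (p && q) *: (g * half u w f h).
Proof.
move=> hf hg; rewrite /half gder_ring_mul mulrDr mulrA; congr (_ + _).
have hd := gr_ishom (gder_ishom (j := u) hf).
rewrite (gr_hom hg) -scalerAl -scalerAr (mulrA _ g) (ser_mulC hd hg) -scalerAl scalerA -mulrA.
by congr (_ *: _); rewrite /sg -signr_addb; case: p {hf hd}; case: q {hg}.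
Qed.

Lemma half_Ml u w p q r f g h : ishom p f -> ishom q g -> ishom r h ->
  half u w (f * g) h = f * half u w g h + sg (q && r) *: (half u w f h * g).
Proof.
move=> hf hg hh; rewrite /half gder_ring_mul (islinD _ _ (@gr_lin K)) !gr_mul grK mulrDl addrC.
rewrite -mulrA; congr (_ + _).
have hd := gder_ishom (j := w) hh.
rewrite (gr_hom hg) -scalerAr -scalerAl -(mulrA _ g) (ser_mulC hg hd) -scalerAr scalerA mulrA.
by congr (_ *: _); rewrite /sg -signr_addb; case: r {hh hd}; case: q {hg}.
Qed.

Lemma half_C u w p q f g : ishom p f -> ishom q g ->
  half u w f g = - (sg (p && q) *: half w u g f).
Proof.
move=> hf hg; have hu := gder_ishom (j := u) hf; have hw := gder_ishom (j := w) hg.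
rewrite /half (gr_hom hu) (gr_hom hw) -!scalerAl (ser_mulC hu hw) !scalerA -scaleNr.
congr (_ *: _); rewrite /sg.
by case: p {hf hu}; case: q {hg hw}; rewrite /= ?expr0 ?expr1; ring.
Qed.

Lemma half_neq0 u w f g T : half u w f g T != 0 -> exists A, [/\ A `<=` T,
  u \notin A /\ f (u |` A) != 0 & w \notin T `\` A /\ g (w |` (T `\` A)) != 0].
Proof.
by move=> /gmul_neq0[A [AT /gr_neq0/gder_neq0 ? /gder_neq0 ?]]; exists A.
Qed.

Lemma half_linl u w g : islin (fun f => half u w f g).
Proof.
by move=> c f1 f2; rewrite /half gder_lin gr_lin mulrDl -scalerAl.
Qed.

Lemma half_ishom u w p q f g : ishom p f -> ishom q g -> ishom (p (+) q) (half u w f g).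
Proof.
move=> hf hg; have := ishomM (gr_ishom (gder_ishom (j := u) hf)) (gder_ishom (j := w) hg).
by rewrite addbN addNb negbK.
Qed.

Definition tm i f g : ser K := half (yg i) (xg i) f g + half (xg i) (yg i) f g.
Definition pbrN N f g : ser K := \sum_(i < N) tm i f g.

Lemma pbr_trunc f g T : pbr f g T = pbrN (bnd T) f g T.
Proof. by rewrite /pbrN ser_sum. Qed.

Lemma xg_neq_yg i j : xg i != yg j. Proof. by rewrite /xg /yg; lia. Qed.

(** Removing [y_i] from the monomial of [f] may leave some [x_k] without a dominating [y]. But [x_i]
    occurs in the monomial of [g], so either [i < c] or some [y_j] with [i <= j] remains there and
    takes over. *)
Lemma supp_yx c f g i A C : inB c f -> inB c g ->
  f (yg i |` A) != 0 -> g (xg i |` C) != 0 ->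
  ((i < c)%N \/ exists2 j, (yg j \in A) || (yg j \in C) & (i <= j)%N) /\
  (forall k, (xg k \in A) || (xg k \in C) ->
    (k < c)%N \/ exists2 j, (yg j \in A) || (yg j \in C) & (k <= j)%N).
Proof.
move=> hf hg fA gC.
have I : (i < c)%N \/ exists2 j, (yg j \in A) || (yg j \in C) & (i <= j)%N.
  have [||[j]] := hg _ gC i; first by rewrite in_fset1U eqxx.
    by left.
  rewrite in_fset1U eq_sym (negPf (xg_neq_yg _ _)) /= => jC ij.
  by right; exists j; rewrite ?jC ?orbT.
split=> // k /orP[kA|kC].
  have [||[j]] := hf _ fA k; first by rewrite in_fset1U kA orbT.
    by left.
  rewrite in_fset1U => /orP[/eqP E|jA] kj; last by right; exists j; rewrite ?jA.
  have {E}ji : j = i by move: E; rewrite /yg; lia.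
  subst j; case: I => [ic|[j' jAC ij]]; first by left; lia.
  by right; exists j' => //; lia.
have [||[j]] := hg _ gC k; first by rewrite in_fset1U kC orbT.
  by left.
rewrite in_fset1U eq_sym (negPf (xg_neq_yg _ _)) /= => jC kj.
by right; exists j; rewrite ?jC ?orbT.
Qed.

Lemma split_mem T A (a : nat) : A `<=` T -> (a \in A) || (a \in T `\` A) = (a \in T).
Proof.
move=> AT; rewrite inE; case: (boolP (a \in A)) => //= aA.
by rewrite (fsubsetP AT).
Qed.

Lemma supp_half c f g i (b : bool) T : inB c f -> inB c g ->
  half (if b then yg i else xg i) (if b then xg i else yg i) f g T != 0 ->
  ((i < c)%N \/ exists2 j, yg j \in T & (i <= j)%N) /\
  (forall k, xg k \in T -> (k < c)%N \/ exists2 j, yg j \in T & (k <= j)%N).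
Proof.
move=> hf hg /half_neq0[A [AT [_ fA] [_ gA]]].
have M a := split_mem a AT.
case: b fA gA => fA gA.
  have [H1 H2] := supp_yx hf hg fA gA; split.
    by case: H1 => [|[j]]; [left|rewrite M; right; exists j].
  by move=> k; rewrite -M => /H2[|[j]]; [left|rewrite M; right; exists j].
have [H1 H2] := supp_yx hg hf gA fA; split.
  by case: H1 => [|[j]]; [left|rewrite orbC M; right; exists j].
by move=> k; rewrite -M orbC => /H2[|[j]]; [left|rewrite orbC M; right; exists j].
Qed.

Lemma supp_tm c f g i T : inB c f -> inB c g -> tm i f g T != 0 ->
  ((i < c)%N \/ exists2 j, yg j \in T & (i <= j)%N) /\
  (forall k, xg k \in T -> (k < c)%N \/ exists2 j, yg j \in T & (k <= j)%N).
Proof.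
move=> hf hg; rewrite /tm serD => /add_neq0[]; first exact: (@supp_half c f g i true).
exact: (@supp_half c f g i false).
Qed.

Lemma sum_stable (u : nat -> ser K) c T N :
  (forall i, u i T != 0 -> (i < c)%N \/ exists2 j, yg j \in T & (i <= j)%N) ->
  (maxn c (bnd T) <= N)%N ->
  (\sum_(i < N) u i) T = (\sum_(i < maxn c (bnd T)) u i) T.
Proof.
move=> H le; rewrite !ser_sum [RHS](big_ord_widen N (fun i => u i T) le).
rewrite [RHS]big_mkcond; apply: eq_bigr => i _; case: ifP => // /negbT.
rewrite -leqNgt geq_max => /andP[ci bi]; apply/eqP/negPn/negP => /H[|[j /leq_bnd]]; first lia.
by rewrite /yg; lia.
Qed.

(** The cut at [bnd T] in [pbr] is correct on the completion but not for single letters: at the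
    empty monomial it keeps only [i < 2] and misses the pairing of [y_i] with [x_i] for larger [i].
    Since the argument brackets with single letters, the limit of all truncations is used. *)
Definition PB f g : ser K := fun T => evlim (fun N => pbrN N f g T).

Lemma PBE c f g T N : inB c f -> inB c g -> (maxn c (bnd T) <= N)%N ->
  PB f g T = pbrN N f g T.
Proof.
move=> hf hg le.
have St N' := @sum_stable (fun i => tm i f g) c T N' (fun i H => (supp_tm hf hg H).1).
rewrite /PB (evlimE (n := maxn c (bnd T))) ?[RHS]St // => N' le'; exact: St.
Qed.

Lemma pbr_PB f g : inB 0 f -> inB 0 g -> pbr f g = PB f g.
Proof.
by move=> hf hg; apply: funext => T; rewrite pbr_trunc (PBE hf hg (N := bnd T)) ?max0n.
Qed.

Lemma sum_ser_neq0 (n : nat) (u : nat -> ser K) T :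
  (\sum_(i < n) u i) T != 0 -> exists i, u i T != 0.
Proof.
move=> H; apply: contrapT => N; case/eqP: H; rewrite ser_sum big1 // => i _.
by apply/eqP/negPn/negP => H; apply: N; exists i.
Qed.

Lemma PB_neq0 c f g T : inB c f -> inB c g -> PB f g T != 0 -> exists i, tm i f g T != 0.
Proof.
by move=> hf hg; rewrite (PBE hf hg (leqnn _)) => /(sum_ser_neq0 (u := fun i => tm i f g)).
Qed.

Lemma inB_PB c f g : inB c f -> inB c g -> inB c (PB f g).
Proof. by move=> hf hg T /(PB_neq0 hf hg)[i /(supp_tm hf hg)[]]. Qed.

Lemma PB_ishom c p q f g : inB c f -> inB c g -> ishom p f -> ishom q g ->
  ishom (p (+) q) (PB f g).
Proof.
move=> bf bg hf hg T /(PB_neq0 bf bg)[i].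
by have := ishomD (@half_ishom (yg i) (xg i) _ _ _ _ hf hg) (@half_ishom (xg i) (yg i) _ _ _ _ hf hg); apply.
Qed.

Lemma pbrN_Mr N p q f g h : ishom p f -> ishom q g ->
  pbrN N f (g * h) = pbrN N f g * h + sg (p && q) *: (g * pbrN N f h).
Proof.
move=> hf hg; rewrite /pbrN mulr_suml mulr_sumr scaler_sumr -big_split.
apply: eq_bigr => i _; rewrite /tm !(@half_Mr _ _ p q f g h hf hg) /= mulrDl mulrDr scalerDr.
exact: addrACA.
Qed.

Lemma pbrN_Ml N p q r f g h : ishom p f -> ishom q g -> ishom r h ->
  pbrN N (f * g) h = f * pbrN N g h + sg (q && r) *: (pbrN N f h * g).
Proof.
move=> hf hg hh; rewrite /pbrN mulr_suml mulr_sumr scaler_sumr -big_split.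
apply: eq_bigr => i _; rewrite /tm !(@half_Ml _ _ p q r f g h hf hg hh) /= mulrDl mulrDr scalerDr.
exact: addrACA.
Qed.

Lemma pbrN_C N p q f g : ishom p f -> ishom q g ->
  pbrN N f g = - (sg (p && q) *: pbrN N g f).
Proof.
move=> hf hg; rewrite /pbrN scaler_sumr -sumrN; apply: eq_bigr => i _.
by rewrite /tm !(@half_C _ _ p q f g hf hg) -opprD -scalerDr addrC.
Qed.

Lemma pbrN_lin N g : islin (fun f => pbrN N f g).
Proof.
move=> c f1 f2; rewrite /pbrN scaler_sumr -big_split; apply: eq_bigr => i _ /=.
by rewrite /tm !half_linl scalerDr addrACA.
Qed.

Definition phom p f : Prop := ishom p f /\ exists c, inB c f.

Lemma phom2 p q f g : phom p f -> phom q g -> exists c, inB c f /\ inB c g.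
Proof.
move=> [_ [c hf]] [_ [c' hg]]; exists (maxn c c'); split.
  exact: inB_weaken (leq_maxl _ _) hf.
exact: inB_weaken (leq_maxr _ _) hg.
Qed.

Lemma phom3 p q r f g h : phom p f -> phom q g -> phom r h ->
  exists c, [/\ inB c f, inB c g & inB c h].
Proof.
move=> hf hg [_ [c' hh]]; have [c [bf bg]] := phom2 hf hg.
exists (maxn c c'); split; first exact: inB_weaken (leq_maxl _ _) bf.
  exact: inB_weaken (leq_maxl _ _) bg.
exact: inB_weaken (leq_maxr _ _) hh.
Qed.

(** One truncation level serves all subsets of [T], and a product at [T] involves no other
    monomials. So the Leibniz rules pass from [pbrN] to [PB]. *)
Lemma PB_locE c f g T : inB c f -> inB c g ->
  forall A, A `<=` T -> PB f g A = pbrN (maxn c (bnd T)) f g A.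
Proof.
move=> bf bg A AT; apply: PBE bf bg _; have := bnd_subset AT; lia.
Qed.

Lemma PB_Mr p q r f g h : phom p f -> phom q g -> phom r h ->
  PB f (g * h) = PB f g * h + sg (p && q) *: (g * PB f h).
Proof.
move=> hf hg hh; have [c [bf bg bh]] := phom3 hf hg hh; apply: funext => T.
rewrite (PBE bf (inBM bg bh) (leqnn _)) (@pbrN_Mr _ p q f g h hf.1 hg.1) !serE.
by congr (_ + _ * _); symmetry; [apply: gmul_locl|apply: gmul_locr]; apply: PB_locE.
Qed.

Lemma PB_Ml p q r f g h : phom p f -> phom q g -> phom r h ->
  PB (f * g) h = f * PB g h + sg (q && r) *: (PB f h * g).
Proof.
move=> hf hg hh; have [c [bf bg bh]] := phom3 hf hg hh; apply: funext => T.
rewrite (PBE (inBM bf bg) bh (leqnn _)) (@pbrN_Ml _ p q r f g h hf.1 hg.1 hh.1) !serE.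
by congr (_ + _ * _); symmetry; [apply: gmul_locr|apply: gmul_locl]; apply: PB_locE.
Qed.

Lemma PB_C p q f g : phom p f -> phom q g -> PB f g = - (sg (p && q) *: PB g f).
Proof.
move=> hf hg; have [c [bf bg]] := phom2 hf hg; apply: funext => T.
by rewrite !serE (PBE bf bg (leqnn _)) (PBE bg bf (leqnn _)) (@pbrN_C _ p q f g hf.1 hg.1) !serE.
Qed.

Lemma PB_Dl p q f f' g : phom p f -> phom p f' -> phom q g ->
  PB (f + f') g = PB f g + PB f' g.
Proof.
move=> hf hf' hg; have [c [bf bf' bg]] := phom3 hf hf' hg; apply: funext => T.
rewrite serD !(PBE _ bg (leqnn _)) //; last exact: inBD.
by rewrite (islinD _ _ (pbrN_lin _ g)) serD.
Qed.

Lemma PB_Zl p q c f g : phom p f -> phom q g -> PB (c *: f) g = c *: PB f g.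
Proof.
move=> hf hg; have [b [bf bg]] := phom2 hf hg; apply: funext => T.
rewrite serZ !(PBE _ bg (leqnn _)) //; last exact: inBZ.
by rewrite (islinZ _ _ (pbrN_lin _ g)) serZ.
Qed.
End Poisson.

Section PoissonGenerators.
Variable K : fieldType.
Implicit Types (f g h : ser K) (T A B : mono).

Definition gen (j : nat) : ser K := xi j 1.
Definition xP j := gen (xg j).
Definition yP j := gen (yg j).

Lemma gen_mul j f : gen j * f = xi j f.
Proof. by rewrite -[LHS]/(gmul _ f) /gen gmul_xi -[gmul _ f]/(1 * f) mul1r. Qed.

Lemma genE j : gen j = mon K [fset j].
Proof.
have -> : [fset j] = j |` fset0 :> mono by rewrite fsetU0.
by rewrite mon_xi // => i; rewrite in_fset0.
Qed.

Lemma gen_neq0 j T : gen j T != 0 -> T = [fset j].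
Proof. by rewrite genE /mon; have [->|_] := eqVneq T [fset j]; rewrite ?eqxx. Qed.

Lemma ishom_gen j : ishom true (gen j).
Proof. by move=> T /gen_neq0->; rewrite cardfs1. Qed.

Lemma phom_gen j : phom true (gen j).
Proof.
split; first exact: ishom_gen.
exists j.+1 => T /gen_neq0-> i; rewrite in_fset1 => /eqP <-; left; rewrite /xg; lia.
Qed.

Lemma ishom1 : ishom false (1 : ser K).
Proof.
move=> T; rewrite -[(1 : ser K) T]/(mon K fset0 T) /mon.
by have [->|_] := eqVneq T fset0; rewrite ?eqxx // cardfs0.
Qed.

Lemma phom1 : phom false (1 : ser K).
Proof.
split; first exact: ishom1.
exists 0%N => T; rewrite -[(1 : ser K) T]/(mon K fset0 T) /mon.
by have [->|_] := eqVneq T fset0; rewrite ?eqxx // => _ i; rewrite in_fset0.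
Qed.

Lemma gder1 u : gder u (1 : ser K) = 0.
Proof.
apply: funext => T; rewrite /gder; case: ifP => // uT.
rewrite -[(1 : ser K) _]/(mon K fset0 _) /mon; have [E|_] := eqVneq (u |` T) fset0; rewrite ?mulr0 //.
by have : u \in (fset0 : mono); [rewrite -E in_fset1U eqxx|rewrite in_fset0].
Qed.

Lemma gder_gen u w : gder u (gen w) = (u == w)%:R.
Proof.
rewrite /gen gder_xi gder1 (islin0 (xi_lin w)) subr0.
by case: (u == w); rewrite ?scale1r ?scale0r.
Qed.

Lemma VmonP0 i k j : j \in Vmon i k -> (2 * i <= j)%N.
Proof.
rewrite !inE -orbA => /or3P[/imfsetP[n _ ->]|/imfsetP[n _ ->]|/eqP->]; rewrite /= /xg /yg; lia.
Qed.

Lemma Vmon0 i : Vmon i 0 = [fset yg i].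
Proof.
apply/fsetP => j; rewrite !inE muln0 addn0; case: eqP => [_|_]; rewrite ?orbT ?orbF //.
by apply/negP => /orP[] /imfsetP[n].
Qed.

Lemma VmonS i k : Vmon i k.+1 = xg i |` (xg i.+1 |` Vmon i.+3 k).
Proof.
apply/fsetP => j; rewrite !in_fset1U !inE -orbA.
have -> : (yg (i + 3 * k.+1) = yg (i.+3 + 3 * k))%N by congr yg; lia.
apply/or3P/idP => [[/imfsetP[[|n] /=]|/imfsetP[[|n] /=]|->]|].
- by move=> _ ->; rewrite muln0 addn0 eqxx.
- rewrite inE mem_iota => lt ->; apply/or3P; constructor 3.
  apply/orP; left; apply/orP; left; apply/imfsetP; exists n; first by rewrite /= mem_iota; lia.
  by congr xg; lia.
- by move=> _ ->; rewrite muln0 addn0 eqxx orbT.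
- rewrite inE mem_iota => lt ->; apply/or3P; constructor 3.
  apply/orP; left; apply/orP; right; apply/imfsetP; exists n; first by rewrite /= mem_iota; lia.
  by congr xg; lia.
- by rewrite !orbT.
case/or3P => [/eqP->|/eqP->|/orP[/orP[]|->]].
- constructor 1; apply/imfsetP; exists 0%N => //=; by rewrite muln0 addn0.
- constructor 2; apply/imfsetP; exists 0%N => //=; by rewrite muln0 addn0.
- move=> /imfsetP[n /=]; rewrite mem_iota => lt ->; constructor 1.
  apply/imfsetP; exists n.+1; first by rewrite /= inE mem_iota; lia.
  by congr xg; lia.
- move=> /imfsetP[n /=]; rewrite mem_iota => lt ->; constructor 2.
  apply/imfsetP; exists n.+1; first by rewrite /= inE mem_iota; lia.
  by congr xg; lia.
- by constructor 3.
Qed.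

Lemma mon_VmonS i k :
  mon K (Vmon i k.+1) = xP i * (xP i.+1 * mon K (Vmon i.+3 k)).
Proof.
rewrite VmonS !mon_xi ?gen_mul //.
- by move=> j /VmonP0; rewrite /xg; lia.
- by move=> j; rewrite in_fset1U => /orP[/eqP->|/VmonP0]; rewrite /xg; lia.
Qed.

Lemma Vmon_card i k : odd #|` Vmon i k|.
Proof.
elim: k i => [|k IH] i; first by rewrite Vmon0 cardfs1.
rewrite VmonS !cardfsU1 oddD [odd (_ + _)]oddD IH.
have -> : xg i.+1 \notin Vmon i.+3 k by apply/negP => /VmonP0; rewrite /xg; lia.
have -> // : xg i \notin xg i.+1 |` Vmon i.+3 k.
by apply/negP; rewrite in_fset1U => /orP[/eqP|/VmonP0]; rewrite /xg; lia.
Qed.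

Lemma Vmon_y i k : yg (i + 3 * k) \in Vmon i k.
Proof. by rewrite !inE eqxx !orbT. Qed.

Lemma Vmon_x i k a : xg a \in Vmon i k -> (a <= i + 3 * k)%N.
Proof.
rewrite !inE -orbA => /or3P[/imfsetP[n /=]|/imfsetP[n /=]|/eqP].
- by rewrite mem_iota /xg; lia.
- by rewrite mem_iota /xg; lia.
- by rewrite /xg /yg; lia.
Qed.

Lemma Vgen_neq0 i T : Vgen K i T != 0 -> exists k, T = Vmon i k.
Proof.
move=> H; apply: contrapT => N; case/eqP: H; rewrite /Vgen big1 // => k _.
by have [E|//] := eqVneq T (Vmon i k); case: N; exists (k : nat).
Qed.

Lemma Vgen_trunc N i T : (bnd T <= N)%N ->
  Vgen K i T = (\sum_(k < N) mon K (Vmon i k)) T.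
Proof.
move=> le; rewrite ser_sum /Vgen (big_ord_widen N (fun k => (T == Vmon i k)%:R : K) le).
rewrite big_mkcond; apply: eq_bigr => k _; case: ifP => // /negbT; rewrite -leqNgt => bk.
rewrite /mon; have [E|//] := eqVneq T (Vmon i k).
by have := leq_bnd (Vmon_y i k); rewrite -E /yg; lia.
Qed.

Lemma Vgen_rec i : Vgen K i = yP i + xP i * xP i.+1 * Vgen K i.+3.
Proof.
apply: funext => T; rewrite (@Vgen_trunc (bnd T).+1) // serD -mulrA.
rewrite [X in _ = _ + X](_ : _ =
  (xP i * (xP i.+1 * \sum_(k < bnd T) mon K (Vmon i.+3 k))) T); last first.
  rewrite !gen_mul; apply: xi_loc => A AT; apply: xi_loc => B BA; apply: Vgen_trunc.
  by apply/bnd_subset/(fsubset_trans BA).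
rewrite -serD big_ord_recl Vmon0 -genE !mulr_sumr; congr (fun f : ser K => f T).
by congr (_ + _); apply: eq_bigr => k _; rewrite lift0 mon_VmonS.
Qed.

Lemma ishom_Vgen i : ishom true (Vgen K i).
Proof. by move=> T /Vgen_neq0[k ->]; apply: Vmon_card. Qed.

Lemma inB_Vgen i : inB 0 (Vgen K i).
Proof.
move=> T /Vgen_neq0[k ->] a /Vmon_x ak; right.
by exists (i + 3 * k)%N => //; apply: Vmon_y.
Qed.

Lemma phom_Vgen i : phom true (Vgen K i).
Proof. by split; [apply: ishom_Vgen|exists 0%N; apply: inB_Vgen]. Qed.

Lemma gder_Vgen u i : (u < 2 * i)%N -> gder u (Vgen K i) = 0.
Proof.
move=> lt; apply: funext => T; apply/eqP/negPn/negP => /gder_neq0[_ /Vgen_neq0[k E]].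
have /VmonP0 : u \in Vmon i k by rewrite -E in_fset1U eqxx.
by lia.
Qed.

Lemma gr1 : grade_inv (1 : ser K) = 1. Proof. exact: gr_mon0. Qed.

Lemma pbrN_y N i f : (i < N)%N -> pbrN N (yP i) f = gder (xg i) f.
Proof.
move=> iN; rewrite /pbrN (bigD1 (Ordinal iN)) //= big1 ?addr0.
  rewrite /tm /half !gder_gen eqxx (negPf (xg_neq_yg _ _)) gr1 mul1r.
  by rewrite (islin0 (@gr_lin K)) mul0r addr0.
move=> k ki; rewrite /tm /half !gder_gen (negPf (xg_neq_yg _ _)).
have -> : (yg k == yg i) = false.
  by apply/negbTE; apply: contraNneq ki => E; apply/eqP/val_inj; move: E; rewrite /yg /=; lia.
by rewrite (islin0 (@gr_lin K)) !mul0r addr0.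
Qed.

Lemma pbrN_x N i f : (i < N)%N -> pbrN N (xP i) f = gder (yg i) f.
Proof.
move=> iN; rewrite /pbrN (bigD1 (Ordinal iN)) //= big1 ?addr0.
  rewrite /tm /half !gder_gen eqxx eq_sym (negPf (xg_neq_yg _ _)) gr1 mul1r.
  by rewrite (islin0 (@gr_lin K)) mul0r add0r.
move=> k ki; rewrite /tm /half !gder_gen eq_sym (negPf (xg_neq_yg _ _)).
have -> : (xg k == xg i) = false.
  by apply/negbTE; apply: contraNneq ki => E; apply/eqP/val_inj; move: E; rewrite /xg /=; lia.
by rewrite (islin0 (@gr_lin K)) !mul0r addr0.
Qed.

Lemma PB_y p i f : phom p f -> PB (yP i) f = gder (xg i) f.
Proof.
move=> hf; have [c [b1 b2]] := phom2 (phom_gen (yg i)) hf; apply: funext => T.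
have le : (maxn c (bnd T) <= maxn i.+1 (maxn c (bnd T)))%N by rewrite leq_maxr.
by rewrite (PBE b1 b2 le) pbrN_y // leq_maxl.
Qed.

Lemma PB_x p i f : phom p f -> PB (xP i) f = gder (yg i) f.
Proof.
move=> hf; have [c [b1 b2]] := phom2 (phom_gen (xg i)) hf; apply: funext => T.
have le : (maxn c (bnd T) <= maxn i.+1 (maxn c (bnd T)))%N by rewrite leq_maxr.
by rewrite (PBE b1 b2 le) pbrN_x // leq_maxl.
Qed.

Lemma VgenB i : Vgen K i - xP i * xP i.+1 * Vgen K i.+3 = yP i.
Proof. by rewrite {1}Vgen_rec addrK. Qed.

Definition superP : superalg (ser K).
Proof.
refine (@SuperAlg K (ser K) (@phom K) (fun _ _ => @PB K) xP (Vgen K)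
  _ _ _ _ phom1 (fun i => phom_gen (xg i)) phom_Vgen
  _ _ _ _ _ _ _ _ _ _ _ _ _ _).
- by move=> p; split; [|exists 0%N] => T; rewrite ser0 eqxx.
- move=> p f g hf hg; split; first exact: ishomD hf.1 hg.1.
  by have [c [? ?]] := phom2 hf hg; exists c; apply: inBD.
- by move=> p c f [hf [b bf]]; split; [apply: ishomZ|exists b; apply: inBZ].
- move=> p q f g hf hg; split; first exact: ishomM hf.1 hg.1.
  by have [c [? ?]] := phom2 hf hg; exists c; apply: inBM.
- move=> p q f g hf hg; have [c [b1 b2]] := phom2 hf hg.
  split; first exact: (PB_ishom b1 b2 hf.1 hg.1).
  by exists c; apply: inB_PB.
- by move=> p q f f' g; apply: PB_Dl.
- by move=> p q c f g; apply: PB_Zl.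
- by move=> p q f g; apply: PB_C.
- by move=> p q r s f g h _; apply: PB_Ml.
- by move=> p q r s f g h _; apply: PB_Mr.
- by move=> i j; rewrite (ser_mulC (@ishom_gen _) (@ishom_gen _)) /sg expr1 scaleN1r.
- by move=> i; rewrite gen_mul xi_sqr.
- by move=> i j _; rewrite (ser_mulC (@ishom_Vgen _) (@ishom_gen _)) /sg expr1 scaleN1r.
- move=> i j; rewrite (PB_x _ (phom_gen _)) gder_gen.
  by rewrite eq_sym (negPf (xg_neq_yg _ _)).
- by move=> i j ij; rewrite (PB_x _ (phom_Vgen _)) gder_Vgen // /yg; lia.
- move=> i j; rewrite VgenB (PB_y _ (phom_gen _)) gder_gen; congr (nat_of_bool _)%:R.
  by rewrite /xg; lia.
- by move=> i j ij; rewrite VgenB (PB_y _ (phom_Vgen _)) gder_Vgen // /xg; lia.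
- by move=> i; rewrite VgenB (PB_y _ (phom_gen _)) gder_gen (negPf (xg_neq_yg _ _)).
Defined.

Lemma phom_mulC p q f g : hom superP p f -> hom superP q g ->
  f * g = sg (p && q) *: (g * f).
Proof. by move=> hf hg; apply: ser_mulC hf.1 hg.1. Qed.

Lemma xP_mul_sqr j f : xP j * f * (xP j * f) = 0.
Proof.
rewrite -mulrA /xP (gen_mul _ f) -[f * _]/(gmul f _) gmul_xir.
by rewrite gen_mul xi_sqr.
Qed.

(** In characteristic 2 anticommutation alone does not give this; the two summands of the recursion
    square to zero because each begins with a single generator. *)
Lemma Vgen_sqr n : Vgen K n * Vgen K n = 0.
Proof.
have hu := homM (homx superP n) (homM (homx superP n.+1) (homv superP n.+3)).
have hy := phom_gen (yg n).
rewrite Vgen_rec -mulrA; set u := xP n * _ in hu *; rewrite mulrDl !mulrDr.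
have -> : u * u = 0 by apply: xP_mul_sqr.
have -> : yP n * yP n = 0 by rewrite gen_mul xi_sqr.
by rewrite (ser_mulC hy.1 hu.1) /= /sg expr1 scaleN1r add0r addr0 addNr.
Qed.

End PoissonGenerators.

(** * Formal squares in characteristic 2 *)

Section FormalSquare.
Variable K : fieldType.
Hypothesis two0 : 2%:R = 0 :> K.
Implicit Types (f g h : ser K) (T A B : mono).
Local Notation gr := (@grade_inv K).

Lemma char2_opp1 : -1 = 1 :> K.
Proof. by apply/eqP; rewrite eq_sym -subr_eq0 opprK -[_ + _]/(2%:R) two0. Qed.

Lemma char2_addrr f : f + f = 0.
Proof. by rewrite -mulr2n -scaler_nat two0 scale0r. Qed.

Lemma char2_gr f : gr f = f.
Proof. by apply: funext => T; rewrite /grade_inv /sgn char2_opp1 expr1n mul1r. Qed.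

Lemma char2_mulC f g : f * g = g * f.
Proof.
apply/eqP; rewrite -subr_eq0; apply/eqP.
apply: (@ser_density K fset0 (fun f => f * g - g * f)).
- move=> c f1 f2; rewrite mulrDl mulrDr -scalerAl -scalerAr scalerBr.
  by rewrite opprD addrACA.
- move=> T f1 f2 E; rewrite !serE.
  have E' A : A `<=` T -> f1 A = f2 A by move=> AT; apply: E; rewrite fset0U.
  by congr (_ - _); [apply: gmul_locl|apply: gmul_locr].
move=> A _; apply/eqP; rewrite subr_eq0; apply/eqP.
elim/mono_ind: A => [|j A H IH]; first by rewrite mul1r mulr1.
rewrite mon_xi // -[LHS]/(gmul (xi j _) g) -[RHS]/(gmul g (xi j _)).
by rewrite gmul_xi gmul_xir char2_gr -[gmul (mon K A) g]/(mon K A * g) IH.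
Qed.

Lemma char2_mulACA f g h k : f * g * (h * k) = f * h * (g * k).
Proof. by rewrite -!mulrA; congr (_ * _); rewrite !mulrA (char2_mulC g h). Qed.

Definition fsqN N f : ser K := \sum_(i < N) gder (yg i) f * gder (xg i) f.
Definition FS f : ser K := fun T => evlim (fun N => fsqN N f T).

Lemma fsq_trunc f T : fsq f T = fsqN (bnd T) f T.
Proof. by rewrite /fsqN ser_sum. Qed.

Lemma supp_fsq c f i T : inB c f -> (gder (yg i) f * gder (xg i) f) T != 0 ->
  ((i < c)%N \/ exists2 j, yg j \in T & (i <= j)%N) /\
  (forall k, xg k \in T -> (k < c)%N \/ exists2 j, yg j \in T & (k <= j)%N).
Proof.
move=> hf; rewrite -{1}[gder (yg i) f]char2_gr.
exact: (@supp_half K c f f i true T hf hf).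
Qed.

Lemma FSE c f T N : inB c f -> (maxn c (bnd T) <= N)%N -> FS f T = fsqN N f T.
Proof.
move=> hf le.
have St N' := @sum_stable K (fun i => gder (yg i) f * gder (xg i) f) c T N'
  (fun i H => (supp_fsq hf H).1).
rewrite /FS (evlimE (n := maxn c (bnd T))) ?[RHS]St // => N' le'; exact: St.
Qed.

Lemma fsq_FS f : inB 0 f -> fsq f = FS f.
Proof. by move=> hf; apply: funext => T; rewrite fsq_trunc (FSE hf (N := bnd T)) ?max0n. Qed.

Lemma inB_FS c f : inB c f -> inB c (FS f).
Proof.
move=> hf T; rewrite (FSE hf (leqnn _)).
by move=> /(sum_ser_neq0 (u := fun i => gder (yg i) f * gder (xg i) f))[i /(supp_fsq hf)[]].
Qed.

Lemma char2_tm i f g :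
  tm i f g = gder (yg i) f * gder (xg i) g + gder (xg i) f * gder (yg i) g.
Proof. by rewrite /tm /half !char2_gr. Qed.

Lemma fsqN_D N f g : fsqN N (f + g) = fsqN N f + fsqN N g + pbrN N f g.
Proof.
rewrite /fsqN /pbrN -!big_split; apply: eq_bigr => i _ /=; rewrite char2_tm.
rewrite !(islinD _ _ (@gder_lin K _)) mulrDl !mulrDr -!addrA; congr (_ + _).
by rewrite (char2_mulC (gder (xg i) f)) [RHS]addrC -!addrA.
Qed.

Lemma fsqN_Z N c f : fsqN N (c *: f) = (c * c) *: fsqN N f.
Proof.
rewrite /fsqN scaler_sumr; apply: eq_bigr => i _.
by rewrite !(islinZ _ _ (@gder_lin K _)) -scalerAl -scalerAr scalerA.
Qed.

(** After expansion by the Leibniz rule, the terms with [f * f] or [g * g] drop out and the two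
    mixed ones are those of the bracket. *)
Lemma fsqN_M N f g : f * f = 0 -> g * g = 0 -> fsqN N (f * g) = pbrN N f g * (f * g).
Proof.
move=> f0 g0; rewrite /fsqN /pbrN mulr_suml; apply: eq_bigr => i _.
rewrite char2_tm !gder_ring_mul !char2_gr mulrDl !mulrDr.
rewrite (char2_mulACA (gder _ f) g (gder _ f)) g0 mulr0 add0r.
rewrite (char2_mulACA f _ f) f0 mul0r addr0 mulrDl; congr (_ + _).
  by rewrite (char2_mulC f (gder _ g)) char2_mulACA (char2_mulC g f).
rewrite (char2_mulC f (gder _ g)) char2_mulACA.
by rewrite (char2_mulC (gder (yg i) g)).
Qed.

Lemma FS_D p q f g : phom p f -> phom q g -> FS (f + g) = FS f + FS g + PB f g.
Proof.
move=> hf hg; have [c [bf bg]] := phom2 hf hg; apply: funext => T.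
rewrite !serD (FSE (inBD bf bg) (leqnn _)) (FSE bf (leqnn _)) (FSE bg (leqnn _)).
by rewrite (PBE bf bg (leqnn _)) fsqN_D.
Qed.

Lemma FS_Z p c f : phom p f -> FS (c *: f) = (c * c) *: FS f.
Proof.
move=> [_ [b bf]]; apply: funext => T.
by rewrite serZ (FSE (inBZ (c := c) bf) (leqnn _)) (FSE bf (leqnn _)) fsqN_Z.
Qed.

Lemma FS_M p q f g : phom p f -> phom q g -> f * f = 0 -> g * g = 0 ->
  FS (f * g) = PB f g * (f * g).
Proof.
move=> hf hg f0 g0; have [c [bf bg]] := phom2 hf hg; apply: funext => T.
rewrite (FSE (inBM bf bg) (leqnn _)) fsqN_M //; apply: gmul_locl => A AT.
by symmetry; apply: (PB_locE bf bg AT).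
Qed.

Lemma FS_gen j : FS (gen K j) = 0.
Proof.
have [_ [c bf]] := phom_gen K j; apply: funext => T; rewrite (FSE bf (leqnn _)) /fsqN.
rewrite big1 // => i _; rewrite !gder_gen; case: (eqVneq (yg i) j) => [<-|_]; last by rewrite mul0r.
by rewrite (negPf (xg_neq_yg _ _)) mulr0.
Qed.

Local Notation SP := (superP K).
Local Notation xw := (xw SP).

Lemma xw_Vgen_sqr a n : xw a * Vgen K n * (xw a * Vgen K n) = 0.
Proof. by rewrite char2_mulACA Vgen_sqr mulr0. Qed.

Lemma xP_sqr j : xP K j * xP K j = 0. Proof. by rewrite gen_mul xi_sqr. Qed.

Lemma FS_word_cons i a n : (i < n)%N -> FS (xw (i :: a) * Vgen K n) = 0.
Proof.
move=> lt; have hg := hom_xwv SP a n; have hx := phom_gen K (xg i).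
rewrite xw_cons -mulrA (FS_M hx hg) ?xP_sqr ?xw_Vgen_sqr //.
have -> : PB (gen K (xg i)) (xw a * Vgen K n) = 0 := br_x_xwv SP a lt.
by rewrite mul0r.
Qed.

(** The summands of the recursion have formal square 0, so only their bracket is left. This is the
    counterpart of [Vo_sqr]. *)
Lemma FS_Vgen n : FS (Vgen K n) = xw [:: n.+1] * Vgen K n.+3.
Proof.
have hy := phom_gen K (yg n); have hu := hom_xxv SP n.
rewrite Vgen_rec (FS_D hy hu) FS_gen add0r.
have -> : FS (xP K n * xP K n.+1 * Vgen K n.+3) = 0.
  have := @FS_word_cons n [:: n.+1] n.+3; rewrite !xw_cons xw_nil mulr1; apply; lia.
have -> : PB (gen K (yg n)) (xP K n * xP K n.+1 * Vgen K n.+3) = xP K n.+1 * Vgen K n.+3.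
  by have := brd_xxv SP n; rewrite /d /= VgenB.
by rewrite add0r xw_cons xw_nil mulr1.
Qed.

Variables (F : realFieldType) (lam : F).
Hypotheses (lam3 : lam ^+ 3 = lam + 2%:R) (lam_gt : 3%:R / 2%:R < lam).

(** [FS] is quadratic with polar form [PB], so sums are handled by closure under the bracket. The
    claim [f * f = 0] is carried along for the product rule [FS_M] in [prodspan_FS]. *)
Lemma goodspan_FS b w p f : goodspan SP lam b w p f ->
  f * f = 0 /\ prodspan SP lam false (w + w) (FS f).
Proof.
move=> G; have w0 := goodspan_ge0 lam3 lam_gt G; have ww : 0 <= w + w by apply: addr_ge0.
elim: G => [[|i a] n ua ga bn wa _|_|f1 f2 G1 [s1 I1] G2 [s2 I2]|c f1 G1 [s1 I1]].
- split; first exact: xw_Vgen_sqr.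
  rewrite xw_nil mul1r FS_Vgen; apply: prodspan_good; apply: goodspan_any_word => //.
    by split=> [j|j E]; rewrite !inE; [move/eqP->|lia].
  move: wa; rewrite /weight !wsumE (pw3 lam3); lra.
- split; first exact: xw_Vgen_sqr.
  rewrite FS_word_cons; first exact: prodspan0.
  by have := ga.1 i; rewrite inE eqxx => /(_ isT); lia.
- split; first exact: mul0r.
  have -> : FS 0 = 0.
    by have := @FS_Z true 0 0 (hom0 SP true); rewrite scale0r mul0r scale0r.
  exact: prodspan0.
- have h1 := goodspan_hom G1; have h2 := goodspan_hom G2; split.
    by rewrite mulrDl !mulrDr s1 s2 add0r addr0 (char2_mulC f2) char2_addrr.
  rewrite (FS_D h1 h2); apply: prodspanD; first exact: prodspanD.
  rewrite -(addbb p); apply: (prodspan_br lam3 lam_gt (S := SP)); apply: prodspan_good.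
    exact: goodspan_weaken (leq0n _) (lexx _) G1.
  exact: goodspan_weaken (leq0n _) (lexx _) G2.
- split; first by rewrite -scalerAl -scalerAr s1 !scaler0.
  by rewrite (FS_Z _ (goodspan_hom G1)); apply: prodspanZ.
Qed.

Lemma prodspan_FS p w f : prodspan SP lam p w f ->
  f * f = 0 /\ prodspan SP lam false (w + w) (FS f).
Proof.
elim=> {p w f} [w p f G|p q s w1 w2 w f g sE le Hf [sf If] Hg [sg' Ig]|
  p w f g Hf [sf If] Hg [sg' Ig]|p w c f Hf [sf If]].
- exact: goodspan_FS G.
- subst s; split; first by rewrite char2_mulACA sf mul0r.
  rewrite (FS_M (prodspan_hom Hf) (prodspan_hom Hg)) //.
  apply: (prodspanM (p := p (+) q) (q := p (+) q) (w := w) (w' := w)); rewrite ?addbb //.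
    apply: prodspan_weaken le _; exact: (prodspan_br lam3 lam_gt Hf Hg).
  exact: prodspanM le Hf Hg.
- split; first by rewrite mulrDl !mulrDr sf sg' add0r addr0 (char2_mulC g) char2_addrr.
  rewrite (FS_D (prodspan_hom Hf) (prodspan_hom Hg)); apply: prodspanD; first exact: prodspanD.
  by rewrite -(addbb p); apply: (prodspan_br lam3 lam_gt Hf Hg).
- split; first by rewrite -scalerAl -scalerAr sf !scaler0.
  by rewrite (FS_Z _ (prodspan_hom Hf)); apply: prodspanZ.
Qed.

End FormalSquare.

(** * Growth bounds for the Poisson superalgebra *)

Section GrowthP.
Variables (K : fieldType) (F : realFieldType) (lam : F).
Hypotheses (lam3 : lam ^+ 3 = lam + 2%:R) (lam_gt : 3%:R / 2%:R < lam).
Local Notation pw n := (lam ^+ n).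
Local Notation SP := (superP K).
Local Notation evP := (fun (f : ser K) (T : mono) => f T).
Local Notation spanP := (evspan (fun _ : mono => True) evP).

(** Membership in [inB 0] is kept in the induction because it identifies the truncated [pbr] and
    [fsq] with [PB] and [FS]. *)
Lemma pmon_prodspan k (f : ser K) : pmon k f ->
  inB 0 f /\ exists p, prodspan SP lam p (lam ^+ 2 * k%:R) f.
Proof.
elim=> {k f} [i i3|a b f g _ [bf [p Hf]] _ [bg [q Hg]]|a b f g _ [bf [p Hf]] _ [bg [q Hg]]|
  a f two0 _ _ [bf [p Hf]]].
- split; first exact: inB_Vgen.
  exists true; apply: prodspan_good; rewrite mulr1.
  have -> : Vgen K i = xw SP [::] * v SP i by rewrite xw_nil mul1r.
  apply: goodspan_word => //; rewrite /weight wsum_nil subr0 ler_eXn2l; first lia.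
  by have := lam_gt; lra.
- split; first exact: inBM.
  exists (p (+) q); apply: prodspanM Hf Hg => //.
  by rewrite natrD mulrDr.
- rewrite pbr_PB //; split; first exact: inB_PB.
  exists (p (+) q); rewrite natrD mulrDr.
  exact: (prodspan_br lam3 lam_gt Hf Hg).
- rewrite (fsq_FS two0 bf); split; first exact: inB_FS.
  exists false; have [_] := prodspan_FS two0 lam3 lam_gt Hf.
  by rewrite mul2n -addnn natrD mulrDr.
Qed.

Lemma lspan_evspanP (l : seq (ser K)) f : lspan (fun g => g \in l) f -> spanP l f.
Proof.
move=> /lspan_seq[c E]; exists c => T _; rewrite {1}E ser_sum.
by apply: eq_bigr => k _; rewrite serZ (set_nth_default 0).
Qed.

Lemma P_upper_span N n : lam ^+ 2 * n%:R < wconst lam * pw N.+1 ->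
  exists l : seq (ser K), size l = (4 ^ N.+1)%N /\
    forall f, (exists k, (k <= n)%N /\ pmon k f) -> spanP l f.
Proof.
move=> lt; have [l [sl Hl]] := prodspan_list lam3 lam_gt (@phom_mulC K) (@Vgen_sqr K) N.
exists l; split=> // f [k [kn /pmon_prodspan[_ [p Hf]]]]; apply: lspan_evspanP.
apply: Hl Hf; apply: le_lt_trans lt; rewrite ler_wpM2l ?ler_nat //.
by rewrite exprn_ge0 // ltW // (lam_gt0 lam_gt).
Qed.

Lemma deg_phom p (t : F) f : deg SP p t f -> phom p f.
Proof.
elim=> {p t f} [i t _ _|p q s t t' t'' f g -> _ _ hf _ hg|p q s t t' t'' f g -> _ _ hf _ hg|p t f _ hf].
- exact: phom_Vgen.
- exact: (@homM _ _ SP _ _ _ _ hf hg).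
- exact: (@hombr _ _ SP _ _ _ _ hf hg).
- exact: (homN (S := SP) hf).
Qed.

Lemma sgZ_mul (e e' : bool) (f g : ser K) :
  (sg e *: f) * (sg e' *: g) = sg (e (+) e') *: (f * g).
Proof. by rewrite -scalerAl -scalerAr scalerA /sg -signr_addb. Qed.

(** [deg] is closed under negation and [pmon] has no such rule, hence the sign. *)
Lemma deg_pmon p (t : F) f : deg SP p t f ->
  exists (e : bool) k, k%:R <= t /\ pmon k (sg e *: f).
Proof.
elim=> {p t f} [i t i3 t1|p q s t t' t'' f g _ le Df [e [k [kt Hf]]] Dg [e' [k' [kt' Hg]]]|
  p q s t t' t'' f g _ le Df [e [k [kt Hf]]] Dg [e' [k' [kt' Hg]]]|p t f _ [e [k [kt Hf]]]].
- by exists false, 1%N; split=> //; rewrite /sg expr0 scale1r; apply: pmon_gen.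
- exists (e (+) e'), (k + k')%N; split; first by rewrite natrD; apply: le_trans le; apply: lerD.
  by rewrite -sgZ_mul; apply: pmon_mul.
- exists (e (+) e'), (k + k')%N; split; first by rewrite natrD; apply: le_trans le; apply: lerD.
  have hf := deg_phom Df; have hg := deg_phom Dg.
  have -> : sg (e (+) e') *: br SP p q f g = pbr (sg e *: f) (sg e' *: g).
    rewrite pbr_PB; [|exact: (pmon_prodspan Hf).1|exact: (pmon_prodspan Hg).1].
    rewrite -[RHS]/(br SP p q _ _) brZl //; last exact: (@homZ _ _ SP _ _ _ hg).
    by rewrite brZr // scalerA /sg -signr_addb.
  exact: pmon_br.
- exists (~~ e), k; split=> //; suff -> : sg (~~ e) *: - f = sg e *: f by [].
  by rewrite scalerN -scaleNr /sg; case: e {Hf}; rewrite ?expr0 ?expr1 ?opprK.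
Qed.

Lemma mem_map_xg (a : seq nat) k : (xg k \in [seq xg i | i <- a]) = (k \in a).
Proof. by rewrite mem_map // => i j; rewrite /xg; lia. Qed.

Lemma xw_xiw a (f : ser K) : xw SP a * f = xiw [seq xg i | i <- a] f.
Proof.
elim: a => [|i a IH]; first by rewrite xw_nil mul1r.
by rewrite xw_cons -mulrA IH -[x SP i]/(gen K (xg i)) gen_mul.
Qed.

(* On monomials without [x]'s only the summand [y_i] of [V_i] contributes. *)
Lemma vw_y_part c (T : mono) : (forall i, xg i \notin T) ->
  vw SP c T = xiw [seq yg i | i <- c] 1 T.
Proof.
elim: c T => [|k c IH] T H; first by rewrite /vw big_nil.
rewrite vw_cons -[v SP k]/(Vgen K k) Vgen_rec mulrDl serD -!mulrA !gen_mul.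
rewrite [X in _ + X](_ : _ = 0) ?addr0; last by rewrite /xi (negPf (H k)).
rewrite /= /xi; case: ifP => // kT; rewrite IH // => i.
by rewrite !inE negb_and H orbT.
Qed.

(** The element for [(a, b)] is tested at the monomial formed by [x^a], [y_N] and [y^b]. A nonzero
    coefficient at the monomial of [(a', b')] forces [a] to lie in [a'], and for [a = a'] it forces
    [b = b']. *)
Lemma P_lower q n d : 3%:R * pw (3 * q).+3 <= n%:R -> growthP K n d ->
  (2 ^ (3 * q).+1 * 2 ^ (3 * q).+3 <= d)%N.
Proof.
set m := (3 * q).+1; set N := (3 * q).+3 => le; rewrite /growthP.
pose J := (m.-tuple bool * N.-tuple bool)%type.
pose E (j : J) : ser K := xw SP (sel j.1) * v SP N * vw SP (sel j.2).
pose Y (j : J) : mono := [fset i in [seq yg i | i <- N :: sel j.2]].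
pose X (j : J) : mono := [fset i in [seq xg i | i <- sel j.1]].
pose th (j : J) : mono := X j `|` Y j.
have uN (u : N.-tuple bool) : uniq (N :: sel u).
  by rewrite /= sel_uniq andbT; apply/negP => /sel_lt; rewrite ltnn.
have YE k j : (k \in Y j) = (k \in [seq yg i | i <- N :: sel j.2]) by rewrite !inE.
have XE k j : (k \in X j) = (k \in [seq xg i | i <- sel j.1]) by rewrite !inE.
have xY i j : xg i \notin Y j.
  by rewrite YE; apply/negP => /mapP[k _ /eqP]; rewrite (negPf (xg_neq_yg _ _)).
have EE (j : J) T : E j T = xiw [seq xg i | i <- sel j.1] (vw SP (N :: sel j.2)) T.
  by rewrite /E -mulrA -vw_cons xw_xiw.
have sub (i j : J) : E j (th i) != 0 -> {subset sel j.1 <= sel i.1}.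
  rewrite EE => /xiw_subset H k; rewrite -mem_map_xg => /H.
  by rewrite in_fsetU (negPf (xY _ _)) orbF XE mem_map_xg.
have thX (i : J) : th i `\` X i = Y i.
  apply/fsetP => k; rewrite in_fsetD in_fsetU; have [kX|//] := boolP (k \in X i).
  by apply/esym/negbTE; move: kX; rewrite XE => /mapP[l _ ->].
have evE (i j : J) : i.1 = j.1 -> exists b : bool,
    E j (th i) = sg b * xiw [seq yg k | k <- N :: sel j.2] 1 (Y i).
  move=> ij; have [||b Eb] := @xiwE K [seq xg k | k <- sel j.1] (vw SP (N :: sel j.2)) (th i).
  - by rewrite map_inj_uniq ?sel_uniq // => k l; rewrite /xg; lia.
  - by move=> k; rewrite in_fsetU XE ij => ->.
  exists b; rewrite EE Eb -ij -/(X i) thX vw_y_part //.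
have uY (u : N.-tuple bool) : uniq [seq yg k | k <- N :: sel u].
  by rewrite map_inj_uniq ?uN // => k l; rewrite /yg; lia.
have oneE (T : mono) : (1 : ser K) T = (T == fset0)%:R by [].
move=> dim.
have -> : (2 ^ m * 2 ^ N)%N = size [seq E j | j <- enum {: J}].
  by rewrite size_map -cardE card_prod !card_tuple card_bool.
apply: dim_span_ge dim => [k x0|].
  rewrite size_map => lk; rewrite (nth_map (nseq_tuple m false, nseq_tuple N false)) //.
  set j := nth _ _ _.
  have [p Hp] := deg_basis SP lam3 lam_gt (nth false j.1) (sel_uniq j.2) (@sel_lt _ j.2).
  have [e [k' [kt Hk]]] := deg_pmon Hp; exists [:: sg e *: E j]; split.
    constructor; last by constructor.
    by exists k'; split=> //; rewrite -(ler_nat F); apply: le_trans le.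
  exists (fun=> sg e) => T _; rewrite big_ord1 /= serZ mulrA.
  by rewrite /sg -signr_addb addbb expr0 mul1r.
apply: (triangular_indep (J := J) (E := E) (th := th)
  (rk := fun j => size (sel j.1))) => [|//|j _|i j _ _ ne].
- exact: enum_uniq.
- have [b ->] := evE j j erefl.
  have [|b' ->] := @xiwE K [seq yg k | k <- N :: sel j.2] 1 (Y j) (uY _).
    by move=> k; rewrite YE.
  by rewrite -/(Y j) fsetDv oneE eqxx mulr1 mulf_neq0 ?sg_neq0.
have [E1|] := subset_sel (sub i j ne); [left|by right].
have [b Eb] := evE i j (esym E1); move: ne; rewrite Eb mulf_eq0 negb_or => /andP[_ ne].
have [|b' Eb'] := @xiwE K [seq yg k | k <- N :: sel j.2] 1 (Y i) (uY _).
  exact: xiw_subset ne.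
have YY : {subset Y i <= Y j}.
  move: ne; rewrite Eb' oneE -/(Y j); have [E0 _|_] := eqVneq (Y i `\` Y j) fset0;
    last by rewrite mulr0 eqxx.
  by apply/fsubsetP; rewrite -fsetD_eq0 E0.
have YY' : {subset Y j <= Y i}.
  by move=> k; rewrite YE => /(xiw_subset ne).
case: i j E1 YY YY' {Eb Eb' ne} => [i1 i2] [j1 j2] /= -> YY YY'; congr (_, _).
have memY (t : N.-tuple bool) (s : m.-tuple bool) k : (k < N)%N ->
    (yg k \in Y (s, t)) = (k \in sel t).
  move=> kN; rewrite YE mem_map; last by move=> k1 k2; rewrite /yg; lia.
  by rewrite inE ltn_eqF.
apply: eq_mem_sel => k; have [kN|kN] := ltnP k N; last first.
  by rewrite !mem_sel ltnNge kN.
rewrite -(memY j2 j1) // -(memY i2 i1) //.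
by apply/idP/idP => [/YY'|/YY].
Qed.

End GrowthP.

(** * Asymptotics *)

Section Asymptotics.
Local Open Scope R_scope.

Lemma exists_pow_between (b y : R) : 1 < b -> 1 <= y ->
  exists N : nat, b ^ N <= y /\ y < b ^ N.+1.
Proof.
move=> b1 y1; have L : 0 < ln b by rewrite -ln_1; apply: ln_increasing; Lra.lra.
have ly : 0 <= ln y.
  by rewrite -ln_1; case: y1 => [lt|<-]; [left; apply: ln_increasing; Lra.lra|right].
have [N [N1 N2]] := nfloor_ex (ln y / ln b) (Rdiv_le_0_compat _ _ ly L).
have E : ln y / ln b * ln b = ln y.
  by rewrite /Rdiv Rmult_assoc Rinv_l ?Rmult_1_r //; Lra.lra.
have bp n : 0 < b ^ n by apply: pow_lt; Lra.lra.
exists N; split.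
  apply: Rnot_lt_le => lt; have := ln_increasing _ _ _ lt; rewrite ln_pow; last Lra.lra.
  move=> /(_ ltac:(Lra.lra)); have := Rmult_le_compat_r _ _ _ (Rlt_le _ _ L) N1; Lra.lra.
apply: ln_lt_inv => //; first Lra.lra.
rewrite ln_pow ?S_INR; last Lra.lra.
have := Rmult_lt_compat_r _ _ _ L N2; Lra.lra.
Qed.

Lemma ratio_limit (g : nat -> nat) (d M : R) :
  eventually (fun n => d * ln (INR n) - M <= ln (INR (g n)) <= d * ln (INR n) + M) ->
  is_lim_seq (gk_ratio g) d.
Proof.
move=> H.
have Hln : is_lim_seq (fun n => ln (INR n)) p_infty.
  apply: (is_lim_comp_seq ln INR p_infty p_infty is_lim_ln_p _ is_lim_seq_INR).
  by exists 0%N.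
have H0 : is_lim_seq (fun n => M * / ln (INR n)) 0.
  have -> : Rbar.Finite 0 = Rbar_mult M 0 by rewrite /= Rmult_0_r.
  apply: is_lim_seq_scal_l; have -> : Rbar.Finite 0 = Rbar_inv p_infty by [].
  by apply: is_lim_seq_inv.
have Hpos : eventually (fun n => 0 < ln (INR n)).
  by have := Hln; rewrite -is_lim_seq_spec => /(_ 0).
apply: (is_lim_seq_le_le_loc (fun n => d - M * / ln (INR n)) _ (fun n => d + M * / ln (INR n))).
- apply: filter_imp (filter_and _ _ H Hpos) => n [[l u] p]; rewrite /gk_ratio.
  have pi := Rinv_0_lt_compat _ p; have e := Rinv_r _ (Rgt_not_eq _ _ p).
  have l' := Rmult_le_compat_r _ _ _ (Rlt_le _ _ pi) l.
  have u' := Rmult_le_compat_r _ _ _ (Rlt_le _ _ pi) u.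
  have e' : d * ln (INR n) * / ln (INR n) = d by rewrite Rmult_assoc e Rmult_1_r.
  by rewrite /Rdiv; split; move: l' u'; rewrite Rmult_minus_distr_r Rmult_plus_distr_r e'; Lra.lra.
- have := is_lim_seq_minus' _ _ _ _ (is_lim_seq_const d) H0; by rewrite Rminus_0_r.
- have := is_lim_seq_plus' _ _ _ _ (is_lim_seq_const d) H0; by rewrite Rplus_0_r.
Qed.

(** Choose [N] and [q] so that [lam^N] and [lam^(3 q)] equal [n] up to constant factors. As
    [d * ln lam = 2 ln 2 = ln 4], both bounds read [d * ln n + O(1)]. *)
Lemma growth_limit (lam C : R) (g : nat -> nat) : 1 < lam -> 0 < C ->
  (forall N n : nat, C * INR n < lam ^ N.+1 -> INR (g n) <= 4 ^ N.+1) ->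
  (forall q n : nat, 3 * lam ^ (3 * q).+3 <= INR n -> 2 ^ (6 * q) <= INR (g n)) ->
  is_lim_seq (gk_ratio g) (two_log2 lam).
Proof.
move=> lam1 C0 up lo; set d := two_log2 lam.
have L : 0 < ln lam by rewrite -ln_1; apply: ln_increasing; Lra.lra.
have l2 : 0 < ln 2 by rewrite -ln_1; apply: ln_increasing; Lra.lra.
have dL : d * ln lam = 2 * ln 2.
  by rewrite /d /two_log2 /Rdiv !Rmult_assoc Rinv_l ?Rmult_1_r //; Lra.lra.
have d0 : 0 < d by rewrite /d /two_log2; apply: Rmult_lt_0_compat; [Lra.lra|apply: Rdiv_lt_0_compat].
have l4 : ln 4 = 2 * ln 2.
  have -> : 4 = 2 ^ 2 by rewrite /=; Lra.lra.
  by rewrite ln_pow //; Lra.lra.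
(* [M1] is the error from [lam^(N+1) <= lam * C * n], [M2] the one from [n < 3 * lam^(3 q + 6)],
   where [6 d ln lam = 12 ln 2]. *)
pose M1 := d * Rabs (ln (lam * C)).
pose M2 := d * ln 3 + 12 * ln 2.
have l3 : 0 < ln 3 by rewrite -ln_1; apply: ln_increasing; Lra.lra.
have M10 : 0 <= M1 by apply: Rmult_le_pos; [Lra.lra|apply: Rabs_pos].
have M20 : 0 <= M2 by rewrite /M2; have := Rmult_lt_0_compat _ _ d0 l3; Lra.lra.
apply: (@ratio_limit g d (M1 + M2)).
have Hbig (B : R) : eventually (fun n => B < INR n).
  by have := is_lim_seq_INR; rewrite -is_lim_seq_spec => /(_ B).
apply: filter_imp (filter_and _ _ (Hbig (/ C)) (Hbig (3 * lam ^ 3))) => n [nC n3].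
have lam3 : 1 < lam ^ 3 by apply: Rlt_pow_R1 => //; lia.
have n0 : 0 < INR n by Lra.lra.
have Cn : 1 <= C * INR n.
  have := Rmult_lt_compat_l _ _ _ C0 nC; rewrite Rinv_r; Lra.lra.
have [N [N1 N2]] := exists_pow_between lam1 Cn.
have y1 : 1 <= INR n / (3 * lam ^ 3).
  apply: (Rmult_le_reg_r (3 * lam ^ 3)); first Lra.lra.
  rewrite /Rdiv Rmult_assoc Rinv_l; Lra.lra.
have [q [q1 q2]] := exists_pow_between lam3 y1.
have nE : INR n / (3 * lam ^ 3) * (3 * lam ^ 3) = INR n.
  rewrite /Rdiv Rmult_assoc Rinv_l; Lra.lra.
have q1' : 3 * lam ^ (3 * q).+3 <= INR n.
  have -> : (3 * q).+3 = (3 * q + 3)%N by rewrite addn3.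
  rewrite pow_add pow_mult -nE.
  have := Rmult_le_compat_r (3 * lam ^ 3) _ _ ltac:(Lra.lra) q1; Lra.lra.
have q2' : INR n < 3 * lam ^ (3 * q + 6).
  have -> : (3 * q + 6 = 3 * q.+1 + 3)%N by lia.
  rewrite pow_add pow_mult -nE.
  have := Rmult_lt_compat_r (3 * lam ^ 3) _ _ ltac:(Lra.lra) q2; Lra.lra.
have g1 := lo _ _ q1'; have g0 : 0 < INR (g n).
  by apply: Rlt_le_trans g1; apply: pow_lt; Lra.lra.
have lampos k : 0 < lam ^ k by apply: pow_lt; Lra.lra.
split.
  have e1 : ln (2 ^ (6 * q)) <= ln (INR (g n)).
    by apply: ln_le g1; apply: pow_lt; Lra.lra.
  have e2 : ln (INR n) < ln (3 * lam ^ (3 * q + 6)) by apply: ln_increasing.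
  move: e1 e2; rewrite ln_mult; [|Lra.lra|exact: lampos].
  rewrite !ln_pow; [|Lra.lra|Lra.lra].
  rewrite -!plusE -!multE plus_INR !mult_INR /= => e1 e2.
  have := Rmult_lt_compat_l _ _ _ d0 e2; rewrite /M2.
  have -> : d * (ln 3 + ((1 + 1 + 1) * INR q + (1 + 1 + 1 + 1 + 1 + 1)) * ln lam) =
    d * ln 3 + (3 * INR q + 6) * (d * ln lam) by Lra.lra.
  rewrite dL; Lra.lra.
have e1 := up _ _ N2.
have e2 : ln (INR (g n)) <= ln (4 ^ N.+1) by apply: ln_le.
have e3 : ln (lam ^ N.+1) <= ln (lam * C * INR n).
  apply: ln_le => //; rewrite -[lam ^ N.+1]/(lam * lam ^ N) Rmult_assoc.
  by apply: Rmult_le_compat_l => //; Lra.lra.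
move: e2 e3; rewrite ln_mult //; last by apply: Rmult_lt_0_compat; Lra.lra.
rewrite !ln_pow; [|Lra.lra|Lra.lra] => e2 e3.
have := Rmult_le_compat_l _ _ _ (Rlt_le _ _ d0) e3; rewrite l4 in e2.
have -> : d * (INR N.+1 * ln lam) = INR N.+1 * (d * ln lam) by Lra.lra.
rewrite dL.
have := Rmult_le_compat_l _ _ _ (Rlt_le _ _ d0) (Rle_abs (ln (lam * C))).
rewrite -/M1 => ? ?; Lra.lra.
Qed.

Lemma GK_of_limit g d : is_lim_seq (gk_ratio g) (Rbar.Finite d) ->
  GKdim_is g d /\ lowerGKdim_is g d.
Proof.
move=> H; split.
  by apply: is_LimSup_seq_unique; apply: is_lim_LimSup_seq.
by apply: is_LimInf_seq_unique; apply: is_lim_LimInf_seq.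
Qed.

Lemma cubic_root_gt lam : cubic_root lam -> 3 / 2 < lam.
Proof.
rewrite /cubic_root => H; apply: Rnot_le_lt => le.
(* This is the cofactor of [t - 3/2] in the difference between the cubic at [t] and at 3/2, where
   its value is -1/8. *)
have : 0 < lam * lam + 3 / 2 * lam + 5 / 4 by Lra.nra.
Lra.nra.
Qed.

Lemma cubic_root_exists : exists lam, cubic_root lam.
Proof.
have c : continuity (fun t => t * t * t - t - 2).
  by reg.
have [lam [_ H]] := IVT _ 0 2 c ltac:(Lra.lra) ltac:(Lra.lra) ltac:(Lra.lra).
by exists lam.
Qed.
End Asymptotics.

Lemma cubic_root_ring (lam : R) : cubic_root lam ->
  lam ^+ 3 = lam + 2%:R /\ 3%:R / 2%:R < lam.
Proof.
move=> H; split.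
  apply/eqP; rewrite -subr_eq0; apply/eqP; rewrite -[RHS]H.
  by rewrite /= !RealsE /=; ring.
by have /RltP := cubic_root_gt H; rewrite !RealsE.
Qed.

Lemma growth_exists (K : fieldType) (V I : Type) (P : I -> Prop) (ev : V -> I -> K)
    (Sn : nat -> V -> Prop) :
  (forall n, exists L, forall f, Sn n f -> evspan P ev L f) ->
  exists g : nat -> nat, forall n, Defs.dim_span P ev (Sn n) (g n).
Proof.
move=> H; have [|g gP] := @choice nat nat (fun n d => Defs.dim_span P ev (Sn n) d).
  move=> n; have [L HL] := H n; apply: (dim_span_exists (B := size L)) => l Sl.
  by apply: indep_size_le; apply: List.Forall_impl Sl.
by exists g.
Qed.

Lemma growth_dims (lam : R) (g : nat -> nat) : cubic_root lam ->
  (forall N n, lam ^+ 2 * n%:R < wconst lam * lam ^+ N.+1 -> (g n <= 4 ^ N.+1)%N) ->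
  (forall q n, 3%:R * lam ^+ (3 * q).+3 <= n%:R ->
     (2 ^ (3 * q).+1 * 2 ^ (3 * q).+3 <= g n)%N) ->
  GKdim_is g (two_log2 lam) /\ lowerGKdim_is g (two_log2 lam).
Proof.
move=> H up lo; have [lam3 lam_gt] := cubic_root_ring H.
have w0 := wconst_gt0 lam_gt; have l0 := lam_gt0 lam_gt.
apply: GK_of_limit; apply: (@growth_limit lam (lam ^+ 2 / wconst lam)).
- by apply/RltP; rewrite RealsE; lra.
- by apply/RltP; rewrite divr_gt0 // exprn_gt0.
- move=> N n /RltP; rewrite !RealsE => lt.
  have /up : lam ^+ 2 * n%:R < wconst lam * lam ^+ N.+1.
    by rewrite -ltr_pdivrMl // mulrA [_^-1 * _]mulrC.
  by rewrite -(ler_nat R) => le; apply/RleP; rewrite -natrX.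
- move=> q n /RleP; rewrite !RealsE => /lo le; apply/RleP; rewrite -natrX ler_nat.
  by apply: leq_trans le; rewrite -expnD leq_exp2l //; lia.
Qed.

Lemma pow_unbounded (lam : R) (c : R) : 1 < lam -> exists N : nat, c < lam ^+ N.+1.
Proof.
move=> /RltP lam1; have [N [_ HN]] := exists_pow_between lam1 (Rmax_l 1 c).
exists N; rewrite -RpowE; apply/RltP; apply: Rle_lt_trans HN; exact: Rmax_r.
Qed.

Theorem theorem11p3 (K : fieldType) :
  (exists gP : nat -> nat, forall n, growthP K n (gP n)) /\
  (exists gA : nat -> nat, forall n, growthA K n (gA n)) /\
  (forall (lam : R) (gP gA : nat -> nat),
     cubic_root lam ->
     (forall n, growthP K n (gP n)) ->
     (forall n, growthA K n (gA n)) ->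
     GKdim_is gP (two_log2 lam) /\ lowerGKdim_is gP (two_log2 lam) /\
     GKdim_is gA (two_log2 lam) /\ lowerGKdim_is gA (two_log2 lam)).
Proof.
(* The existence of the growth functions does not mention [lam], yet the bound on dimensions does,
   so a root is produced first. *)
have [lam0 H0] := cubic_root_exists; have [lam30 lam_gt0'] := cubic_root_ring H0.
have large n : exists N, lam0 ^+ 2 * n%:R < wconst lam0 * lam0 ^+ N.+1.
  have w0 := wconst_gt0 lam_gt0'.
  have [|N HN] := @pow_unbounded lam0 (lam0 ^+ 2 * n%:R / wconst lam0); first by lra.
  by exists N; rewrite -ltr_pdivrMl // mulrC.
split; [|split].
- apply: growth_exists => n; have [N lt] := large n.
  by have [l [_ Hl]] := P_upper_span K lam30 lam_gt0' lt; exists l.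
- apply: growth_exists => n; have [N lt] := large n.
  by have [l [_ Hl]] := A_upper_span K lam30 lam_gt0' lt; exists l.
move=> lam gP gA H HP HA; have [lam3 lam_gt] := cubic_root_ring H.
have [P1 P2] : GKdim_is gP (two_log2 lam) /\ lowerGKdim_is gP (two_log2 lam).
  apply: growth_dims => // [N n lt|q n le].
    by have [l [<- Hl]] := P_upper_span K lam3 lam_gt lt; apply: dim_span_le Hl (HP n).
  exact: P_lower le (HP n).
have [A1 A2] : GKdim_is gA (two_log2 lam) /\ lowerGKdim_is gA (two_log2 lam).
  apply: growth_dims => // [N n lt|q n le].
    by have [l [<- Hl]] := A_upper_span K lam3 lam_gt lt; apply: dim_span_le Hl (HA n).
  exact: A_lower le (HA n).
by [].
Qed.
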